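(* Let $L(Y)=0$ be a homogeneous linear differential equation for which $B\subseteq E$ is a Picard-Vessiot extension such that the constant field is algebraically closed. Suppose that $\operatorname{Gal}(E/B)=:G_0\triangleright G_1\triangleright\cdots\triangleright G_m=\{1\}$, where $m\in\mathbb{Z}^+$. Then there exist intermediate differential fields $(B=)B_0,B_1,\dots,B_m(=E)$ such that $\operatorname{Gal}(B_i/B_{i-1})\cong G_{i-1}/G_i$ for all $i=1,\dots,m$, and homogeneous linear differential equations $L_1(Y)=0,\dots,L_m(Y)=0$ such that for all $i=1,\dots,m$, $B_{i-1}\subseteq B_i$ is a Picard-Vessiot extension for $L_i(Y)=0$. And for any solution of $L(Y)=0$ in $E$, there is a formula which only involves differential field operations over $B$ on the solutions of the equations $L_1(Y)=0,\dots,L_m(Y)=0$ in $E$. Moreover, if $\operatorname{Gal}(E/B)\triangleright G_1\triangleright\cdots\triangleright G_m=\{1\}$ is a composition Zariski-closed series, then for all $i=1,\dots,m$ the Picard-Vessiot extension $B_{i-1}\subseteq B_i$ for $L_i(Y)=0$ is irreducible.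
   Context: $\operatorname{Gal}(E/B)$ denotes the differential Galois group of the extension $B\subseteq E$, and $G\triangleright H$ means that $H$ is a normal subgroup of $G$. A normal Zariski-closed series of a group $G$ is a normal series $G=G_0\triangleright G_1\triangleright\cdots\triangleright G_m=\{1\}$ ($m\in\mathbb{Z}^+$) in which every $G_i$ is a Zariski-closed subgroup of a general linear group over a field; it is a composition Zariski-closed series of $G$ if moreover any possible proper refinement of it is not a normal Zariski-closed series. A Picard-Vessiot extension $B\subseteq E$ is irreducible if no $K$ with $B\subsetneq K\subsetneq E$ is a Picard-Vessiot extension of $B$ (trivially, $B=E$ is irreducible). For a differential field extension $B\subseteq B(U)$ generated by $U$, ''differential field operations over $B$ on $U$'' means rational functions over $B$ on $U$ and the derivation function of $B(U)$.
   Formalization: The groups G_0, ..., G_m are assumed to be Zariski-closed throughout (a normal Zariski-closed series), not merely normal; without this the claim fails, e.g. for B = C(x), E = B(log x) and the series C ▷ Z ▷ {0}. *)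

(* Defs.v *)
From HB Require Import structures.
From mathcomp Require Import all_boot all_order all_algebra.
From mathcomp Require Import boolp classical_sets functions.
From mathcomp Require Import mpoly.

Set Implicit Arguments.
Unset Strict Implicit.
Unset Printing Implicit Defensive.

Import GRing.Theory.

Local Open Scope classical_set_scope.
Local Open Scope ring_scope.

HB.mixin Record Field_isDifferential F of GRing.Field F := {
  der : F -> F;
  derD : {morph der : x y / x + y};
  derM : forall x y : F, der (x * y) = der x * y + x * der y
}.

#[short(type="diffFieldType")]
HB.structure Definition DiffField :=
  {F of GRing.Field F & Field_isDifferential F}.

HB.mixin Record isDerClosed (F : diffFieldType) (S : {pred F}) := {
  der_closed : {in S, forall x, der x \in S}
}.

#[short(type="diffSubfield")]
HB.structure Definition DiffSubfield (F : diffFieldType) :=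
  {S of isDerClosed F S & GRing.DivringClosed F S}.

Section SubfieldType.
Variables (F : diffFieldType) (K : diffSubfield F).

Record dsub := Dsub { dsub_val :> F; dsub_valP : dsub_val \in K }.

HB.instance Definition _ := [isSub for dsub_val].
HB.instance Definition _ := [Choice of dsub by <:].
HB.instance Definition _ := [SubChoice_isSubIntegralDomain of dsub by <:].
HB.instance Definition _ := [SubIntegralDomain_isSubField of dsub by <:].

Definition dsub_der (x : dsub) : dsub :=
  Dsub (der_closed _ (dsub_valP x)).

Fact dsub_derD : {morph dsub_der : x y / x + y}.
Proof. by move=> x y; apply: val_inj; rewrite /= derD. Qed.

Fact dsub_derM (x y : dsub) : dsub_der (x * y) = dsub_der x * y + x * dsub_der y.
Proof. by apply: val_inj; rewrite /= derM. Qed.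

HB.instance Definition _ := Field_isDifferential.Build dsub dsub_derD dsub_derM.

End SubfieldType.

Section Constants.
Variables (F : diffFieldType) (K : diffSubfield F).

Definition constants : {pred F} := [pred x | (x \in K) && (der x == 0)].

Fact der0 : der (0 : F) = 0.
Proof. by apply: (addIr (der 0)); rewrite -derD !add0r. Qed.

Fact der1 : der (1 : F) = 0.
Proof.
have := derM (1 : F) 1; rewrite !mulr1 mul1r => e.
by apply: (addIr (der 1)); rewrite add0r -e.
Qed.

Fact derN (x : F) : der (- x) = - der x.
Proof. by apply: (addIr (der x)); rewrite -derD !addNr der0. Qed.

Fact constants_divring_closed : divring_closed constants.
Proof.
split=> [|x y|x y]; rewrite !inE.
- by rewrite rpred1 der1 eqxx.
- move=> /andP[xK /eqP dx] /andP[yK /eqP dy].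
  by rewrite rpredB // derD derN dx dy subrr eqxx.
move=> /andP[xK /eqP dx] /andP[yK /eqP dy]; rewrite rpred_div //=.
have [->|y0] := eqVneq y 0; first by rewrite invr0 mulr0 der0.
have := derM (x / y) y; rewrite divfK // dx dy mulr0 addr0 => /esym/eqP.
by rewrite mulf_eq0 (negPf y0) orbF.
Qed.

Fact constants_der_closed : {in constants, forall x, der x \in constants}.
Proof. by move=> x /andP[_ /eqP->]; rewrite inE rpred0 der0 eqxx. Qed.

HB.instance Definition _ :=
  GRing.isDivringClosed.Build F constants constants_divring_closed.
HB.instance Definition _ := isDerClosed.Build F constants constants_der_closed.

End Constants.

(* The values of all expressions built from elements of B and U by field
   operations and the derivation, that is, the underlying set of B<U>. *)
Inductive diff_formula (F : diffFieldType) (B : diffSubfield F) (U : set F) :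
  F -> Prop :=
| DFconst b of b \in B : diff_formula B U b
| DFgen u of U u : diff_formula B U u
| DFadd x y of diff_formula B U x & diff_formula B U y :
    diff_formula B U (x + y)
| DFopp x of diff_formula B U x : diff_formula B U (- x)
| DFmul x y of diff_formula B U x & diff_formula B U y :
    diff_formula B U (x * y)
| DFinv x of diff_formula B U x & x != 0 : diff_formula B U x^-1
| DFder x of diff_formula B U x : diff_formula B U (der x).

(* A polynomial L encodes the operator Y |-> \sum_i L`_i Y^(i). *)
Definition diff_order (F : diffFieldType) (L : {poly F}) : nat := (size L).-1.

Definition diffop (F : diffFieldType) (L : {poly F}) (y : F) : F :=
  \sum_(i < size L) L`_i * iter i der y.

Definition solutions (F : diffFieldType) (E : diffSubfield F) (L : {poly F}) :
  set F := [set y | y \in E /\ diffop L y = 0].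

(* Homogeneous linear differential equation of positive order over B. *)
Definition hlde (F : diffFieldType) (B : diffSubfield F) (L : {poly F}) :=
  L \is a polyOver B /\ (0 < diff_order L)%N.

Definition fundamental_system (F : diffFieldType) (E : diffSubfield F)
    (L : {poly F}) (y : 'rV[dsub E]_(diff_order L)) :=
  (forall j, solutions E L (val (y 0 j))) /\
  (forall c : 'cV[dsub (constants E)]_(diff_order L),
     \sum_j val (c j 0) * val (y 0 j) = 0 -> c = 0).

Record picard_vessiot (F : diffFieldType) (B E : diffSubfield F)
    (L : {poly F}) : Prop := PicardVessiot {
  pv_sub : {subset B <= E};
  pv_equation : hlde B L;
  pv_constants : constants E =i constants B;
  pv_generated : exists2 y : 'rV[dsub E]_(diff_order L), fundamental_system y &
    forall x, x \in E -> diff_formula B [set val (y 0 j) | j in setT] x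
}.

Definition pv_irreducible (F : diffFieldType) (B E : diffSubfield F) :=
  forall K : diffSubfield F,
    {subset B <= K} -> ~ (K =i B) -> {subset K <= E} -> ~ (K =i E) ->
    ~ (exists L, picard_vessiot B K L).

Section Galois.
Variables (F : diffFieldType) (E B : diffSubfield F).

Record diff_gal := DiffGal {
  gal_fun : dsub E -> dsub E;
  gal_inv : dsub E -> dsub E;
  gal_funK : cancel gal_fun gal_inv;
  gal_invK : cancel gal_inv gal_fun;
  gal_zmod : zmod_morphism gal_fun;
  gal_monoid : GRing.monoid_morphism gal_fun;
  gal_der : {morph gal_fun : x / der x};
  gal_fix : forall x : dsub E, val x \in B -> gal_fun x = x
}.

HB.instance Definition _ := gen_eqMixin diff_gal.
HB.instance Definition _ := gen_choiceMixin diff_gal.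

Lemma diff_gal_inj (s t : diff_gal) : gal_fun s =1 gal_fun t -> s = t.
Proof.
move=> e; have e1 : gal_fun s = gal_fun t by apply: funext.
have e2 : gal_inv s = gal_inv t.
  by apply: funext => x; rewrite -[LHS](gal_funK t) -e gal_invK.
case: s t e1 e2 {e} => [f g ? ? ? ? ? ?] [f' g' ? ? ? ? ? ?] /= e1 e2.
by subst f' g'; congr DiffGal; apply: Prop_irrelevance.
Qed.

Definition diff_gal_one : diff_gal.
Proof. by refine (@DiffGal id id _ _ _ _ _ _). Defined.

Definition diff_gal_mul (s t : diff_gal) : diff_gal.
Proof.
refine (@DiffGal (gal_fun s \o gal_fun t) (gal_inv t \o gal_inv s) _ _ _ _ _ _).
- by apply: can_comp; apply: gal_funK.
- by apply: can_comp; apply: gal_invK.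
- by move=> x y /=; rewrite !gal_zmod.
- split=> [|x y] /=; first by rewrite !(gal_monoid _).1.
  by rewrite !(gal_monoid _).2.
- by move=> x /=; rewrite !gal_der.
- by move=> x xB /=; rewrite !gal_fix.
Defined.

Definition diff_gal_inv (s : diff_gal) : diff_gal.
Proof.
refine (@DiffGal (gal_inv s) (gal_fun s) _ _ _ _ _ _).
- exact: gal_invK.
- exact: gal_funK.
- move=> x y; apply: (can_inj (gal_funK s)).
  by rewrite gal_zmod !gal_invK.
- split=> [|x y]; apply: (can_inj (gal_funK s)).
    by rewrite gal_invK (gal_monoid s).1.
  by rewrite (gal_monoid s).2 !gal_invK.
- by move=> x; apply: (can_inj (gal_funK s)); rewrite gal_der !gal_invK.
- by move=> x xB; apply: (can_inj (gal_funK s)); rewrite gal_invK gal_fix.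
Defined.

Fact diff_gal_mulA : associative diff_gal_mul.
Proof. by move=> s t u; apply: diff_gal_inj. Qed.
Fact diff_gal_mul1g : left_id diff_gal_one diff_gal_mul.
Proof. by move=> s; apply: diff_gal_inj. Qed.
Fact diff_gal_mulg1 : right_id diff_gal_one diff_gal_mul.
Proof. by move=> s; apply: diff_gal_inj. Qed.
Fact diff_gal_mulVg : left_inverse diff_gal_one diff_gal_inv diff_gal_mul.
Proof. by move=> s; apply: diff_gal_inj => x /=; rewrite gal_funK. Qed.
Fact diff_gal_mulgV : right_inverse diff_gal_one diff_gal_inv diff_gal_mul.
Proof. by move=> s; apply: diff_gal_inj => x /=; rewrite gal_invK. Qed.

HB.instance Definition _ := isGroup.Build diff_gal diff_gal_mulA
  diff_gal_mul1g diff_gal_mulg1 diff_gal_mulVg diff_gal_mulgV.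

End Galois.

Notation "''DGal' ( E / B )" := (diff_gal E B)
  (at level 8, E at level 35, format "''DGal' ( E  /  B )") : type_scope.

Section Quotient.
Local Open Scope group_scope.
Variable gT : groupType.
Implicit Types G H : set gT.

Definition subgroup G := group_closed [pred x | x \in G].

Definition normal_subgroup H G :=
  [/\ subgroup H, H `<=` G & forall g h, G g -> H h -> H (h ^ g)].

Definition mulset (A C : set gT) : set gT :=
  [set a * c | a in A & c in C].

Definition quotient_set G H : set (set gT) :=
  [set [set g * h | h in H] | g in G].

(* G / H ~= gT', the operation of G / H being the product of cosets as sets. *)
Definition quotient_isog G H (gT' : groupType) :=
  exists f : set gT -> gT',
    set_bij (quotient_set G H) [set: gT'] f /\
    forall A C, quotient_set G H A -> quotient_set G H C ->
      f (mulset A C) = f A * f C.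

End Quotient.

(* Zariski-closed subsets of GL_n(C); inverting the determinant gives no
   further closed sets, so polynomials in the entries suffice. *)
Definition zariski_closed (C : fieldType) (n : nat) (S : set 'M[C]_n) :=
  exists P : set {mpoly C[n * n]},
    S = [set A : 'M[C]_n | A \in unitmx /\
           forall p, P p -> p.@[fun k => mxvec A 0 k] = 0].

Section GaloisSeries.
Variables (F : diffFieldType) (B E : diffSubfield F) (L : {poly F}).

(* A is the matrix of s with respect to y: (s y_1, .., s y_n) = (y_1, .., y_n) A. *)
Definition gal_matrix (y : 'rV[dsub E]_(diff_order L)) (s : 'DGal(E / B))
    (A : 'M[dsub (constants E)]_(diff_order L)) :=
  forall j, val (gal_fun s (y 0 j)) = \sum_i val (y 0 i) * val (A i j).

(* H is Zariski-closed in GL_n(C), n the order of L and C the constants of E;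
   the choice of fundamental system only conjugates the image of H. *)
Definition gal_zariski_closed (H : set 'DGal(E / B)) :=
  exists2 y : 'rV[dsub E]_(diff_order L), fundamental_system y &
    zariski_closed [set A | exists2 s, H s & gal_matrix y s A].

(* Only the values G 0, .., G m matter. *)
Record normal_zclosed_series (m : nat) (G : nat -> set 'DGal(E / B)) : Prop :=
  NormalZclosedSeries {
  nzs_length : (0 < m)%N;
  nzs_first : G 0%N = setT;
  nzs_last : G m = [set 1%g];
  nzs_normal : forall i, (i < m)%N -> normal_subgroup (G i.+1) (G i);
  nzs_closed : forall i, (i <= m)%N -> gal_zariski_closed (G i)
}.

(* G' arises from G by inserting terms, at least one of which does not occur
   in G (mere repetitions of terms are not proper). *)
Definition proper_refinement (m : nat) (G : nat -> set 'DGal(E / B))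
    (m' : nat) (G' : nat -> set 'DGal(E / B)) :=
  (exists f : nat -> nat,
     [/\ {in [pred i | (i <= m)%N] &, {homo f : i j / (i < j)%N}},
         forall i, (i <= m)%N -> (f i <= m')%N &
         forall i, (i <= m)%N -> G' (f i) = G i]) /\
  (exists2 j, (j <= m')%N & forall i, (i <= m)%N -> G' j <> G i).

Definition composition_zclosed_series (m : nat) (G : nat -> set 'DGal(E / B)) :=
  normal_zclosed_series m G /\
  forall m' G', proper_refinement m G m' G' -> ~ normal_zclosed_series m' G'.

End GaloisSeries.

(* Main.v *)
Require Import Defs.
From HB Require Import structures.
From mathcomp Require Import all_boot all_order all_algebra.
From mathcomp Require Import boolp classical_sets functions.
From mathcomp Require Import mpoly ring zify.

Set Implicit Arguments.
Unset Strict Implicit.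
Unset Printing Implicit Defensive.

Import GRing.Theory.

Local Open Scope classical_set_scope.
Local Open Scope ring_scope.

(** Put K_i = E^(G_i), the field of elements fixed by G_i. Everything follows
    from a Galois correspondence for E over B, which comes from one source.

    Let Y be the Wronskian matrix of a fundamental system of L and C the field
    of constants. An automorphism multiplies Y on the right by a matrix M over
    C, and YM satisfies the algebraic relations of Y. Conversely, for a field K
    between B and E and an automorphism tau of K, let U be the E-span of the
    polynomials f^tau(YZ) in the entries of a generic matrix Z, for f a relation
    of Y over K. As Y' = AY, the ideal U is stable under derivation of the
    coefficients, hence spanned by polynomials over C ([descent],
    [specialisesP]); as C is algebraically closed, the Nullstellensatz gives
    - an invertible zero M of U, since linear disjointness prevents U from
      containing a power of det Z ([specialisation_exists]). Then Y |-> YM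
      extends tau to E: the relations cannot grow under a surjective map of
      a Noetherian ring ([specialisation_injective], [galois_extension]);
    - for tau the identity, that an element x = a(Y)/b(Y) fixed by all
      automorphisms over K makes a power of (a - xb)(YZ) det Z lie in U, so
      that the minimal polynomial of x over K is a power of T - x; thus x is in
      K in characteristic 0 ([fixed_by_galois]). In characteristic p the p-th
      powers are constants and E = C.

    The same descent, for automorphisms instead of derivations, shows that a
    closed subgroup H is the fixer of finitely many elements of E^H
    ([closed_fixer]). If H is normal in G, each of these is a ratio u/v of
    semi-invariants of H with the same character, u and v being solutions of
    linear equations over B ([ratio_of_semi_invariants]); the conjugates of
    matrices by a Wronskian matrix then yield a finite-dimensional space of
    elements of E^H, stable under G, on which u/v depends rationally
    ([normal_invariants]). A basis of the sum of these spaces is a fundamental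
    system of an equation M over E^G, which makes E^H a Picard-Vessiot extension
    of E^G ([normal_subextension]). Restriction to E^H gives the isomorphism of
    the quotient with its group ([galois_quotient]).

    The solution formulas hold since each K_i is generated over K_(i-1) by
    solutions of M_i and K_m = E. Finally, the fixer of an intermediate field is
    closed, as it consists of the zeros of U ([fixer_closed]), and the fixer of
    a Picard-Vessiot extension of K_(i-1) is normal in G_(i-1) ([pv_stable]);
    so a field violating irreducibility would refine the series. *)

(** * Ideals, the basis theorem and the Nullstellensatz *)

Lemma least_nat (P : nat -> Prop) :
  (exists n, P n) -> exists2 n, P n & forall k, P k -> (n <= k)%N.
Proof.
move=> [n Pn]; have ex : exists n, `[< P n >] by exists n; apply/asboolP.
case: (ex_minnP ex) => k /asboolP Pk kmin; exists k => // j Pj.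
by apply: kmin; apply/asboolP.
Qed.

Section Ideals.
Variable A : comNzRingType.
Implicit Types (I J : set A) (x y : A).

Record ideal I : Prop := Ideal {
  ideal0 : I 0;
  ideal_add : forall x y, I x -> I y -> I (x + y);
  ideal_mul : forall a x, I x -> I (a * x)
}.

Lemma ideal_mulr I x a : ideal I -> I x -> I (x * a).
Proof. by move=> idI Ix; rewrite mulrC; apply: ideal_mul. Qed.

Lemma ideal_opp I x : ideal I -> I x -> I (- x).
Proof. by move=> idI Ix; rewrite -mulN1r; apply: ideal_mul. Qed.

Lemma ideal_sub I x y : ideal I -> I x -> I y -> I (x - y).
Proof. by move=> idI Ix Iy; apply: ideal_add => //; apply: ideal_opp. Qed.

Lemma ideal_sum I (T : Type) (r : seq T) (Q : pred T) (f : T -> A) :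
  ideal I -> (forall t, Q t -> I (f t)) -> I (\sum_(t <- r | Q t) f t).
Proof.
move=> idI If; elim/big_ind: _ => //; first exact: ideal0.
exact: ideal_add.
Qed.

Lemma idealI I J : ideal I -> ideal J -> ideal (I `&` J).
Proof.
move=> idI idJ; split; first by split; exact: ideal0.
  by move=> x y [? ?] [? ?]; split; apply: ideal_add.
by move=> a x [? ?]; split; apply: ideal_mul.
Qed.

Record prime_ideal I : Prop := PrimeIdeal {
  prime_idealP : ideal I;
  prime_ideal1 : ~ I 1;
  prime_idealM : forall x y, I (x * y) -> I x \/ I y
}.

Lemma prime_idealX I x k : prime_ideal I -> I (x ^+ k) -> I x.
Proof.
move=> pI; elim: k => [|k ih]; first by rewrite expr0 => /(prime_ideal1 pI).
by rewrite exprS => /(prime_idealM pI)[].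
Qed.

(** Finite generation is stated by comparison with the other ideals, which
    avoids handling explicit linear combinations. *)
Definition noetherian :=
  forall I, ideal I -> exists2 s : seq A,
    (forall x, x \in s -> I x) &
    forall J, ideal J -> (forall x, x \in s -> J x) -> I `<=` J.

(** An ideal maximal among those that avoid the powers of g is prime. *)
Lemma prime_avoiding I (g : A) :
  ideal I -> (forall k, ~ I (g ^+ k)) ->
  exists2 P, prime_ideal P & I `<=` P /\ ~ P g.
Proof.
move=> idI Ig.
pose S J := (J = set0) \/ [/\ ideal J, I `<=` J & forall k, ~ J (g ^+ k)].
have [F FS Ftot|J [SJ Jmax]] := @Zorn_bigcup A S.
  have [[J FJ [x Jx]]|F0] := pselect (exists2 J, F J & J !=set0); last first.
    left; apply/seteqP; split=> // x [J FJ Jx]; apply: F0.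
    by exists J => //; exists x.
  have {}FS J' z : F J' -> J' z ->
      [/\ ideal J', I `<=` J' & forall k, ~ J' (g ^+ k)].
    by move=> /FS [->|].
  have [idJ IJ _] := FS J x FJ Jx.
  right; split.
  - split; first by exists J => //; apply: ideal0.
      move=> y z [J1 F1 Jy] [J2 F2 Jz].
      have [id1 _ _] := FS _ _ F1 Jy; have [id2 _ _] := FS _ _ F2 Jz.
      have [s12|s21] := Ftot _ _ F1 F2.
        by exists J2 => //; apply: ideal_add => //; apply: s12.
      by exists J1 => //; apply: ideal_add => //; apply: s21.
    move=> a y [J1 F1 Jy]; have [id1 _ _] := FS _ _ F1 Jy.
    by exists J1 => //; apply: ideal_mul.
  - by move=> y /IJ Jy; exists J.
  - by move=> k [J1 F1 Jy]; have [_ _ /(_ k)] := FS _ _ F1 Jy.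
have {SJ} [idJ IJ Jg] : [/\ ideal J, I `<=` J & forall k, ~ J (g ^+ k)].
  case: SJ => // J0; exfalso; apply: (Jmax I); last by right; split.
  by rewrite J0; split=> // /(_ _ (ideal0 idI)).
exists J; last by split=> //; rewrite -(expr1 g); apply: Jg.
(* If x is outside J, then J + (x) contains a power of g. *)
have big x : ~ J x -> exists a k, J (g ^+ k - a * x).
  move=> Jx; pose J' := [set z | exists a, J (z - a * x)].
  have idJ' : ideal J'.
    split; first by exists 0; rewrite mul0r subr0; apply: ideal0.
      move=> y z [a ya] [b zb]; exists (a + b).
      by rewrite mulrDl opprD addrACA; apply: ideal_add.
    by move=> b z [a za]; exists (b * a); rewrite -mulrA -mulrBr; apply: ideal_mul.
  have JJ' : J `<=` J' by move=> z Jz; exists 0; rewrite mul0r subr0.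
  apply: contrapT => no; apply: (Jmax J').
    split=> // /(_ x) xJ; apply/Jx/xJ.
    by exists 1; rewrite mul1r subrr; apply: ideal0.
  right; split=> // [z /IJ /JJ' //|k [a Ja]].
  by apply: no; exists a, k.
split=> //; first by move=> J1; apply: (Jg 0); rewrite expr0.
move=> x y Jxy; have [|Jx] := pselect (J x); first by left.
have [|Jy] := pselect (J y); first by right.
have [a [k xk]] := big _ Jx; have [b [l yl]] := big _ Jy.
case: (Jg (k + l)%N); rewrite exprD.
have -> : g ^+ k * g ^+ l = (g ^+ k - a * x) * g ^+ l +
   (a * x) * (g ^+ l - b * y) + (a * b) * (x * y).
  by rewrite mulrBl mulrBr addrA subrK mulrACA subrK.
do 2?[apply: ideal_add => //]; [exact: ideal_mulr|exact: ideal_mul|exact: ideal_mul].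
Qed.

End Ideals.

Lemma ideal_preim (A A' : comNzRingType) (f : {rmorphism A -> A'}) (I : set A') :
  ideal I -> ideal (f @^-1` I).
Proof.
move=> idI; split; first by rewrite /preimage /= rmorph0; apply: ideal0.
  by move=> x y Ix Iy; rewrite /preimage /= rmorphD; apply: ideal_add.
by move=> a x Ix; rewrite /preimage /= rmorphM; apply: ideal_mul.
Qed.

Lemma prime_preim (A A' : comNzRingType) (f : {rmorphism A -> A'}) (I : set A') :
  prime_ideal I -> prime_ideal (f @^-1` I).
Proof.
move=> [idI I1 IM]; split; first exact: ideal_preim.
  by rewrite /preimage /= rmorph1.
by move=> x y; rewrite /preimage /= rmorphM => /IM.
Qed.

Lemma noetherian_onto (A A' : comNzRingType) (f : {rmorphism A -> A'})
    (g : A' -> A) : cancel g f -> noetherian A -> noetherian A'.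
Proof.
move=> gK nA I idI; have [s sI sgen] := nA _ (ideal_preim f idI).
exists (map f s) => [_ /mapP[x /sI Ix ->] //|J idJ sJ y Iy].
rewrite -(gK y); apply: (sgen _ (ideal_preim f idJ)) => [x xs|].
  by apply: sJ; apply: map_f.
by rewrite /preimage /= gK.
Qed.

Lemma noetherian_field (C : fieldType) : noetherian C.
Proof.
move=> I idI; have [[x Ix x0]|I0] := pselect (exists2 x, I x & x != 0).
  exists [:: x] => [y|J idJ Jx y _]; first by rewrite inE => /eqP->.
  by rewrite -(divfK x0 y); apply: ideal_mul => //; apply: Jx; rewrite inE.
exists [::] => // J idJ _ y Iy; have [->|y0] := eqVneq y 0; first exact: ideal0.
by case: I0; exists y.
Qed.

Section HilbertBasis.
Variable A : comNzRingType.
Implicit Types I J : set {poly A}.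

Definition lead_ideal I d : set A :=
  [set a | exists f : {poly A}, [/\ I f, (size f <= d.+1)%N & f`_d = a]].

Lemma lead_ideal_ideal I d : ideal I -> ideal (lead_ideal I d).
Proof.
move=> idI; split.
- by exists 0; rewrite size_poly0 coef0; split=> //; exact: ideal0.
- move=> _ _ [f [If sf <-]] [g [Ig sg <-]]; exists (f + g).
  rewrite coefD; split=> //; first exact: ideal_add.
  by rewrite (leq_trans (size_polyD _ _)) // geq_max sf.
move=> a _ [f [If sf <-]]; exists (a%:P * f); rewrite coefCM; split=> //.
  exact: ideal_mul.
by rewrite mul_polyC (leq_trans (size_scale_leq _ _)).
Qed.

Lemma lead_ideal_mono I d e : ideal I -> (d <= e)%N ->
  lead_ideal I d `<=` lead_ideal I e.
Proof.
move=> idI le_de _ [f [If sf <-]]; exists ('X^(e - d) * f); split.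
- exact: ideal_mul.
- rewrite (leq_trans (size_polyMleq _ _)) // size_polyXn addSn /=.
  by rewrite -(leq_add2l (e - d)) in sf; rewrite (leq_trans sf) // addnS subnK.
by rewrite coefXnM ltnNge leq_subr /= subKn.
Qed.

(** The leading coefficients of the members of degree d form an increasing
    sequence of ideals; an ideal is generated by polynomials whose leading
    coefficients generate the first few of them. *)
Lemma noetherian_poly : noetherian A -> noetherian {poly A}.
Proof.
move=> nA I idI.
have gens d : exists s : seq {poly A}, (forall f, f \in s -> I f) /\
    forall J, ideal J -> (forall f, f \in s -> J f) ->
      lead_ideal I d `<=` lead_ideal (I `&` J) d.
  have [s sL sgen] := nA _ (lead_ideal_ideal d idI).
  have [w wP] : exists w : A -> {poly A}, forall a, a \in s ->
      [/\ I (w a), (size (w a) <= d.+1)%N & (w a)`_d = a].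
    have /choice[w wP] : forall a, exists f : {poly A}, a \in s ->
        [/\ I f, (size f <= d.+1)%N & f`_d = a].
      move=> a; have [/sL[f fP]|_] := boolP (a \in s); first by exists f.
      by exists 0.
    by exists w.
  exists (map w s); split=> [_ /mapP[a /wP[Iw _ _] ->] //|J idJ sJ].
  apply: sgen => [|a as_]; first by apply: lead_ideal_ideal; exact: idealI.
  have [Iw sw wd] := wP _ as_; exists (w a); split=> //; split=> //.
  by apply: sJ; apply: map_f.
have /choice[F FP] := gens.
pose L := [set a | exists d, lead_ideal I d a].
have idL : ideal L.
  split; first by exists 0%N; apply: ideal0 (lead_ideal_ideal _ idI).
    move=> a b [d da] [e eb]; exists (maxn d e).
    apply: ideal_add; first exact: lead_ideal_ideal.
      exact: lead_ideal_mono (leq_maxl _ _) _ da.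
    exact: lead_ideal_mono (leq_maxr _ _) _ eb.
  by move=> a b [d db]; exists d; apply: ideal_mul => //; apply: lead_ideal_ideal.
have [s sL sgen] := nA _ idL.
have [D LD] : exists D, L `<=` lead_ideal I D.
  suff [D sD] : exists D, forall a, a \in s -> lead_ideal I D a.
    by exists D; apply: sgen => //; apply: lead_ideal_ideal.
  elim: s sL {sgen} => [|a s ih] sL; first by exists 0%N.
  have [|D sD] := ih; first by move=> b bs; apply: sL; rewrite inE bs orbT.
  have [d ad] : L a by apply: sL; rewrite inE eqxx.
  exists (maxn d D) => b; rewrite inE => /predU1P[->|/sD].
    exact: lead_ideal_mono (leq_maxl _ _) _ ad.
  by apply: lead_ideal_mono (leq_maxr _ _) _.
exists (flatten [seq F d | d <- iota 0 D.+1]) => [f|J idJ sJ].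
  by move=> /flatten_mapP[d _]; apply: (FP d).1.
have leadJ d : lead_ideal I d `<=` lead_ideal (I `&` J) d.
  have small e : (e <= D)%N -> lead_ideal I e `<=` lead_ideal (I `&` J) e.
    move=> eD; apply: (FP e).2 => // f fe; apply: sJ.
    by apply/flatten_mapP; exists e; rewrite // mem_iota.
  have [/small//|/ltnW Dd] := leqP d D.
  move=> a ad; apply: (lead_ideal_mono (idealI idI idJ) Dd).
  by apply: small => //; apply: LD; exists d.
move=> f; move: {2}(size f) (leqnn (size f)) => k.
elim: k f => [|k ih] f; first by rewrite leqn0 size_poly_eq0 => /eqP-> _; exact: ideal0.
move=> sf If; have [g [[Ig Jg] sg gk]] : lead_ideal (I `&` J) k f`_k.
  by apply: leadJ; exists f.
rewrite -(subrK g f); apply: ideal_add => //; apply: ih; last exact: ideal_sub.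
apply/leq_sizeP => j; rewrite leq_eqVlt coefB => /predU1P[<-|kj].
  by rewrite gk subrr.
by rewrite !nth_default ?subrr //; [exact: leq_trans kj|exact: leq_trans kj].
Qed.

End HilbertBasis.

(** ** Polynomials in several variables *)

Lemma mpoly_rmorph_ext n (R : nzRingType) (S : nzRingType)
    (f g : {rmorphism {mpoly R[n]} -> S}) :
  (forall c, f c%:MP = g c%:MP) -> (forall i, f 'X_i = g 'X_i) -> f =1 g.
Proof.
move=> fgC fgX p; rewrite (mpolyE p) !rmorph_sum; apply: eq_bigr => m _ /=.
rewrite -mul_mpolyC !rmorphM fgC; congr (_ * _); rewrite mpolyXE_id !rmorph_prod.
by apply: eq_bigr => i _; rewrite !rmorphXn fgX.
Qed.

Section LastVariable.
Variables (R : comNzRingType) (n : nat).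

Definition munion : {poly {mpoly R[n]}} -> {mpoly R[n.+1]} :=
  fun p => (map_poly (@mwiden n R) p).['X_ord_max].

Fact munion_zmod : zmod_morphism munion.
Proof. by move=> p q; rewrite /munion rmorphB hornerD hornerN. Qed.
Fact munion_monoid : GRing.monoid_morphism munion.
Proof.
by split=> [|p q]; rewrite /munion ?rmorph1 ?hornerC // rmorphM hornerM.
Qed.
HB.instance Definition _ := GRing.isZmodMorphism.Build _ _ munion munion_zmod.
HB.instance Definition _ := GRing.isMonoidMorphism.Build _ _ munion munion_monoid.

Lemma muniK : cancel (@muni n R) munion.
Proof.
move=> p.
apply: (@mpoly_rmorph_ext _ _ _ (munion \o @muni n R) idfun) => {p} /= [c|i].
  by rewrite muniC /munion map_polyC /= hornerC mwidenC.
rewrite muniE msuppX big_seq1 mcoeffX eqxx scale1r.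
rewrite /munion -mul_polyC rmorphM /= map_polyC map_polyXn hornerM hornerC hornerXn /=.
rewrite mwidenX mpolyXn -mpolyXD; congr 'X_[_]; apply/mnmP => j.
rewrite mnmDE mulmnE !mnm1E.
case: (unliftP ord_max j) => [k ->|->].
  rewrite -[X in mnmwiden _ X]/(lift ord_max k).
  have -> : lift ord_max k = widen_ord (leqnSn n) k.
    by apply: val_inj; rewrite /= /bump leqNgt ltn_ord.
  rewrite mnmwiden_widen mnmE mnm1E.
  have /negPf-> : (ord_max : 'I_n.+1) != widen_ord (leqnSn n) k.
    by rewrite -val_eqE /= neq_ltn ltn_ord orbT.
  by rewrite mul0n addn0.
by rewrite mnmwiden_ordmax eqxx mul1n add0n.
Qed.

End LastVariable.

Lemma noetherian_mpoly (C : fieldType) n : noetherian {mpoly C[n]}.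
Proof.
elim: n => [|n ih]; last exact: noetherian_onto (@muniK C n) (noetherian_poly ih).
apply: (noetherian_onto (f := @mpolyC 0 C) (g := @mcoeff 0 C 0%MM)).
  exact: mpolyKC.
exact: noetherian_field.
Qed.

Section Nullstellensatz.
Variables (C : fieldType) (closedC : GRing.closed_field_axiom C).

(** The form of the Nullstellensatz that passes from A to A[T]; i is the structure
    map of A over C. *)
Definition has_points (A : comNzRingType) (i : C -> A) :=
  forall (P : set A) (g : A), prime_ideal P -> ~ P g ->
  exists phi : {rmorphism A -> C},
    [/\ forall c, phi (i c) = c, forall a, P a -> phi a = 0 & phi g != 0].

(** A point of A lifts to a point of A[T]: if the prime ideal has a member with
    a coefficient outside its trace on A, take one of least degree, p; the
    point goes to a root of the image of p, and pseudo-division by p controls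
    all other members. That root avoids g as g and p are coprime over the
    fraction field of A modulo the trace. *)
Lemma has_points_poly (A : idomainType) (i : C -> A) :
  has_points i -> has_points (fun c => (i c)%:P).
Proof.
move=> ptA P g pP Pg; have idP := prime_idealP pP.
pose P0 := [set a | P a%:P].
have pP0 : prime_ideal P0 by apply: (prime_preim (@polyC A)).
have idP0 := prime_idealP pP0.
pose small (f : {poly A}) := forall k, P0 f`_k.
have smallP f : small f -> P f.
  move=> sf; rewrite -(coefK f) poly_def; apply: ideal_sum => // k _.
  by rewrite -mul_polyC; apply: ideal_mulr => //; apply: sf.
have small_mul a f : small f -> small (a * f).
  move=> sf k; rewrite coefM; apply: ideal_sum => // j _; exact: ideal_mul.
have small_mulr a f : small f -> small (f * a).
  by rewrite mulrC; apply: small_mul.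
have smallD f h : small f -> small h -> small (f + h).
  by move=> sf sh k; rewrite coefD; apply: ideal_add.
have small_opp f : small f -> small (- f).
  by move=> sf k; rewrite coefN; apply: ideal_opp.
have smallC c : P0 c -> small c%:P.
  by move=> Pc [|k]; rewrite coefC //=; apply: ideal0.
have evalE (phi : {rmorphism A -> C}) : (forall c, phi (i c) = c) ->
    forall z, exists2 psi : {rmorphism {poly A} -> C},
    (forall c, psi (i c)%:P = c) & forall f, psi f = (map_poly phi f).[z].
  move=> phiC z; exists (horner_eval z \o map_poly phi) => [c|//].
  by rewrite /= map_polyC /horner_eval hornerC /= phiC.
have [[p Pp psmall]|allsmall] := pselect (exists2 p, P p & ~ small p); last first.
  have /existsNP[k gk] : ~ small g by move/smallP.
  have [phi [phiC phiP phig]] := ptA _ _ pP0 gk.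
  have [|z zg] := elimT (PreClosedField.closed_nonrootP closedC (map_poly phi g)).
    by apply: contraNneq phig => e; rewrite -coef_map e coef0.
  have [psi psiC psiE] := evalE _ phiC z.
  exists psi; split=> // [f Pf|]; rewrite psiE //.
  have sf : small f by apply: contrapT => nsf; apply: allsmall; exists f.
  suff -> : map_poly phi f = 0 by rewrite horner0.
  by apply/polyP => j; rewrite coef_map coef0 /=; apply/phiP/sf.
(* In a set stable under the removal of small terms, members of least size
   have a leading coefficient outside the trace. *)
have minimal (Q : set {poly A}) : (exists2 q, Q q & ~ small q) ->
    (forall f h, Q f -> small h -> Q (f - h)) ->
    exists q, [/\ Q q, ~ small q, ~ P0 (lead_coef q) &
      forall f, Q f -> (size f < size q)%N -> small f].
  move=> [f0 Qf0 f0s] Qs.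
  have [|s [q [Qq qs <-]] smin] :=
      @least_nat (fun s => exists q, [/\ Q q, ~ small q & size q = s]).
    by exists (size f0), f0.
  have qmin f : Q f -> (size f < size q)%N -> small f.
    move=> Qf fq; apply: contrapT => nsf.
    by move: fq; rewrite ltnNge smin //; exists f.
  exists q; split=> // lq.
  have sh : small ((lead_coef q)%:P * 'X^((size q).-1)) by apply: small_mulr; apply: smallC.
  apply: (qs); rewrite -(subrK ((lead_coef q)%:P * 'X^((size q).-1)) q).
  apply: smallD => //; apply: qmin; first exact: Qs.
  have q0 : q != 0.
    by apply: contra_not_neq qs => -> k; rewrite coef0; apply: ideal0.
  rewrite -[ltnRHS](@prednK (size q)) ?size_poly_gt0 // ltnS.
  apply/leq_sizeP => j; rewrite leq_eqVlt coefB coefCM coefXn => /predU1P[<-|jq].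
    by rewrite eqxx mulr1 subrr.
  rewrite gtn_eqF // mulr0 subr0 nth_default //.
  by move: jq; case: (size q).
have {p Pp psmall} [p [Pp psmall lp pmin]] : exists p,
    [/\ P p, ~ small p, ~ P0 (lead_coef p) &
      forall f, P f -> (size f < size p)%N -> small f].
  apply: minimal; first by exists p.
  by move=> f h Pf /smallP Ph; apply: ideal_sub.
pose Q := [set q | exists u w, small (q - (u * g + w * p))].
have [q [[u [w quw]] qsmall lq qmin]] : exists q,
    [/\ Q q, ~ small q, ~ P0 (lead_coef q) &
      forall f, Q f -> (size f < size q)%N -> small f].
  apply: minimal; first exists p => //.
    exists 0, 1; rewrite mul0r add0r mul1r subrr => k; rewrite coef0.
    exact: ideal0.
  move=> f h [u [w fuw]] sh; exists u, w.
  by rewrite addrAC; apply: smallD => //; apply: small_opp.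
(* Pseudo-division by q leaves small remainders on p and g. *)
have divq f : (exists u w, f = u * g + w * p) ->
    exists a k r, [/\ (lead_coef q)^+ k *: f = a * q + r, small r
      & (size r < size q)%N].
  move=> [u' [w' fE]].
  have q0 : q != 0.
    by apply: contra_not_neq qsmall => -> k; rewrite coef0; apply: ideal0.
  exists (Pdiv.Ring.rdivp f q), (Pdiv.Ring.rscalp f q), (Pdiv.Ring.rmodp f q).
  have dE := Pdiv.ComRing.rdivp_eq q f.
  have sr : (size (Pdiv.Ring.rmodp f q) < size q)%N by rewrite Pdiv.Ring.ltn_rmodp.
  split=> //; apply: qmin => //.
  set c := lead_coef q ^+ _ in dE; set a := Pdiv.Ring.rdivp f q in dE *.
  set r := Pdiv.Ring.rmodp f q in dE *.
  exists (c%:P * u' - a * u), (c%:P * w' - a * w).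
  have -> : r - ((c%:P * u' - a * u) * g + (c%:P * w' - a * w) * p) =
      - (a * (q - (u * g + w * p))).
    have -> : r = c%:P * f - a * q by rewrite mul_polyC dE addrAC subrr add0r.
    by rewrite fE; ring.
  by apply: small_opp; apply: small_mul.
have lqX k : ~ P0 (lead_coef q ^+ k) by move/(prime_idealX pP0).
have sq : size q = 1%N.
  have qp : (size q <= size p)%N.
    rewrite leqNgt; apply/negP => /qmin-/(_ _)/psmall; apply.
    exists 0, 1; rewrite mul0r add0r mul1r subrr => k; rewrite coef0.
    exact: ideal0.
  have qg1 : (0 < size q)%N.
    rewrite size_poly_gt0; apply: contra_not_neq qsmall => -> k.
    by rewrite coef0; apply: ideal0.
  apply/eqP; rewrite eqn_leq qg1 andbT leqNgt; apply/negP => sq.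
  have [|a [k [r [dp sr szr]]]] := divq p.
    by exists 0, 1; rewrite mul0r add0r mul1r.
  have [|a' [l [r' [dg sr' _]]]] := divq g.
    by exists 1, 0; rewrite mul0r addr0 mul1r.
  have /(prime_idealM pP)[Pa|Pq] : P (a * q).
  - have -> : a * q = (lead_coef q ^+ k)%:P * p - r.
      by rewrite mul_polyC dp addrK.
    by apply: ideal_sub => //; [exact: ideal_mul|exact: smallP].
  - have sa : small a.
      apply: pmin => //.
      have q0 : q != 0 by rewrite -size_poly_gt0.
      have lp0 : lead_coef p != 0.
        by apply: contra_not_neq lp => ->; apply: ideal0.
      have sp : size (a * q) = size p.
        have -> : a * q = lead_coef q ^+ k *: p - r by rewrite dp addrK.
        rewrite size_polyDl size_scale ?expf_neq0 ?lead_coef_eq0 //.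
        by rewrite size_polyN (leq_trans szr).
      have a0 : a != 0.
        apply: contraTneq qg1 => a0.
        by rewrite -leqNgt (leq_trans qp) // -sp a0 mul0r size_poly0.
      rewrite -sp size_mul //; move: (size a) (size q) sq => sa' sq' h.
      by lia.
    have : small (lead_coef q ^+ k *: p).
      by rewrite dp; apply: smallD => //; apply: small_mulr.
    move=> /(_ (size p).-1); rewrite coefZ => /(prime_idealM pP0)[/lqX//|].
    exact: lp.
  - apply: Pg; have : P ((lead_coef q ^+ l)%:P * g).
      rewrite mul_polyC dg; apply: ideal_add => //; first exact: ideal_mul.
      exact: smallP.
    by move=> /(prime_idealM pP)[/lqX|].
pose c := lead_coef q.
have qE : q = c%:P by rewrite {1}(size1_polyC (eq_leq sq)) /c /lead_coef sq.
have [|phi [phiC phiP]] := ptA _ (lead_coef p * c) pP0.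
  by move=> /(prime_idealM pP0)[].
rewrite rmorphM mulf_eq0 negb_or => /andP[phip phic].
have sp : (1 < size p)%N.
  rewrite ltnNge; apply/negP => /size1_polyC pE; apply: lp.
  by rewrite pE lead_coefC /P0 /= -pE.
have [|z pz] := elimT (PreClosedField.closed_rootP closedC (map_poly phi p)).
  by rewrite size_map_poly_id0 // neq_ltn sp orbT.
have [psi psiC psiE] := evalE phi phiC z.
have psi_small f : small f -> psi f = 0.
  move=> sf; rewrite psiE; suff -> : map_poly phi f = 0 by rewrite horner0.
  by apply/polyP => j; rewrite coef_map coef0 /=; apply/phiP/sf.
have psip : psi p = 0 by rewrite psiE; apply/eqP.
exists psi; split=> // [f Pf|].
  set k := Pdiv.Ring.rscalp f p; set r := Pdiv.Ring.rmodp f p.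
  have dE := Pdiv.ComRing.rdivp_eq p f.
  have Pr : small r.
    apply: pmin; last by rewrite Pdiv.Ring.ltn_rmodp -size_poly_gt0 ltnW.
    have -> : r = (lead_coef p ^+ k)%:P * f - Pdiv.Ring.rdivp f p * p.
      by rewrite mul_polyC dE addrAC subrr add0r.
    by apply: ideal_sub => //; apply: ideal_mul.
  move: dE; rewrite -mul_polyC => /(congr1 psi).
  rewrite rmorphD !rmorphM psip mulr0 add0r (psi_small _ Pr) => /eqP.
  rewrite psiE map_polyC hornerC mulf_eq0 /= rmorphXn expf_eq0 (negPf phip).
  by rewrite andbF => /eqP.
apply: contraNneq phic => psig.
have := psi_small _ quw.
rewrite rmorphB rmorphD !rmorphM psip psig !mulr0 addr0 subr0 qE psiE.
by rewrite map_polyC hornerC => ->.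
Qed.

Lemma has_points_mpoly n : has_points (@mpolyC n C).
Proof.
elim: n => [|n ih] P g pP Pg.
  exists (@mcoeff 0 C 0%MM); split=> [c|f Pf|]; first by rewrite /= mcoeffC eqxx mulr1.
    apply: contrapT => f0; apply: (prime_ideal1 pP).
    have /eqP f0' := f0.
    have -> : 1 = (f@_0%MM)^-1%:MP * f.
      by rewrite {2}[f]nvar0_mpolyC -mpolyCM mulVf ?mpolyC1.
    by apply: ideal_mul => //; apply: prime_idealP.
  apply: contra_notN Pg => /eqP g0; rewrite [g]nvar0_mpolyC g0 mpolyC0.
  exact: (ideal0 (prime_idealP pP)).
have [|phi [phiC phiP phig]] := has_points_poly ih (prime_preim (@munion C n) pP) (g := muni g).
  by rewrite /preimage /= muniK.
exists (phi \o @muni n C); split=> // [c|f Pf]; first by rewrite /= muniC.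
by apply: phiP; rewrite /preimage /= muniK.
Qed.

(** If I contains no power of g, a prime ideal above I avoids g, and has a point
    where g does not vanish. *)
Lemma nullstellensatz n (I : set {mpoly C[n]}) g : ideal I ->
  (forall v, (forall f, I f -> f.@[v] = 0) -> g.@[v] = 0) ->
  exists k, I (g ^+ k).
Proof.
move=> idI Ig; apply: contrapT => no.
have [k gk|P pP [IP Pg]] := prime_avoiding idI (g := g); first by apply: no; exists k.
have [phi [phiC phiP /eqP phig]] := has_points_mpoly pP Pg; apply: phig.
pose v i := phi 'X_i.
have phiE : phi =1 meval v.
  apply: mpoly_rmorph_ext => [c|i]; first by rewrite phiC /= mevalC.
  by rewrite /= mevalXU.
rewrite phiE; apply: Ig => f /IP Pf; rewrite -phiE; exact: phiP.
Qed.

End Nullstellensatz.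

(** * Descent for subspaces stable under derivations or automorphisms *)

Section Descent.
Variable E : fieldType.

Record subspace (V : lmodType E) (U : set V) : Prop := Subspace {
  subspace0 : U 0;
  subspaceD : forall u v, U u -> U v -> U (u + v);
  subspaceZ : forall e u, U u -> U (e *: u)
}.

Lemma subspaceB (V : lmodType E) (U : set V) u v :
  subspace U -> U u -> U v -> U (u - v).
Proof.
by move=> sU Uu Uv; rewrite -scaleN1r; apply: subspaceD => //; apply: subspaceZ.
Qed.

(** Both a derivation and the difference of an automorphism and the identity
    kill 1. A member of U of least support, normalised to have a coefficient 1,
    therefore has all coefficients killed, as applying theta to it shortens its
    support. *)
Lemma descent n (T : Type) (theta : T -> {additive E -> E})
    (U : set {mpoly E[n]}) :
  (forall t, theta t 1 = 0) -> subspace U ->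
  (forall t u, U u -> U (map_mpoly (theta t) u)) ->
  forall V, subspace V ->
    (forall v, U v -> (forall t m, theta t v@_m = 0) -> V v) -> U `<=` V.
Proof.
move=> theta1 sU Utheta V sV UV u.
have suppE (v : {mpoly E[n]}) m : (m \in msupp v) = (v@_m != 0).
  by rewrite mcoeff_msupp.
have [k] := ubnP (size (msupp u)); elim: k u => // k ih u /ltnSE su Uu.
have [->|u0] := eqVneq u 0; first by case: sV.
have [|s [v [Uv v0 vu <-]] smin] := @least_nat (fun s => exists v,
    [/\ U v, v != 0, {subset msupp v <= msupp u} & size (msupp v) = s]).
  by exists (size (msupp u)), u; split.
have [m mv] : exists m, m \in msupp v.
  by exists (mlead v); apply: mlead_supp.
have vm : v@_m != 0 by rewrite -suppE.
pose w := (v@_m)^-1 *: v.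
have wm : w@_m = 1 by rewrite mcoeffZ mulVf.
have Uw : U w by apply: subspaceZ.
have wv : {subset msupp w <= msupp v} by exact: msuppZ_le.
have strict (x y : {mpoly E[n]}) : {subset msupp x <= msupp y} ->
    m \in msupp y -> m \notin msupp x -> (size (msupp x) < size (msupp y))%N.
  move=> xy my mx; rewrite -[X in (X <= _)%N]/(size (m :: msupp x)).
  apply: uniq_leq_size; first by rewrite /= mx msupp_uniq.
  by move=> j; rewrite inE => /predU1P[->|/xy].
have wker t : map_mpoly (theta t) w = 0.
  apply/eqP; apply: contraT => tw0.
  have tw : {subset msupp (map_mpoly (theta t) w) <= msupp w}.
    move=> j; rewrite !suppE mcoeff_map_mpoly.
    by apply: contraNneq => ->; rewrite raddf0.
  have := smin (size (msupp (map_mpoly (theta t) w))).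
  rewrite leqNgt strict //; last by rewrite suppE mcoeff_map_mpoly wm theta1 eqxx.
    move=> h; exfalso; apply/notF/h; exists (map_mpoly (theta t) w); split=> //.
      exact: Utheta.
    by move=> j /tw/wv/vu.
  by move=> j /tw/wv.
have Vw : V w.
  by apply: UV => // t j; rewrite -mcoeff_map_mpoly wker mcoeff0.
rewrite -(subrK (u@_m *: w) u); apply: subspaceD => //; last exact: subspaceZ.
have mu : m \in msupp u by apply: vu.
apply: ih; last by apply: subspaceB => //; apply: subspaceZ.
rewrite (leq_trans _ su) // strict //.
  move=> j; rewrite !suppE mcoeffB mcoeffZ; apply: contraNneq => uj.
  have : j \notin msupp w by apply/negP => /wv/vu; rewrite suppE uj eqxx.
  by rewrite suppE negbK uj => /eqP ->; rewrite mulr0 subrr.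
by rewrite suppE mcoeffB mcoeffZ wm mulr1 subrr eqxx.
Qed.

End Descent.

(** * Finite-dimensional spaces over the constants *)

Section Span.
Variables (E C : fieldType) (ic : {rmorphism C -> E}).

Definition independent n (b : 'rV[E]_n) :=
  forall c : 'cV[C]_n, b *m map_mx ic c = 0 -> c = 0.

Record csubspace (V : set E) : Prop := Csubspace {
  csubspace0 : V 0;
  csubspaceD : forall x y, V x -> V y -> V (x + y);
  csubspaceZ : forall c x, V x -> V (ic c * x)
}.

Definition cspan (s : seq E) : set E :=
  [set z | forall V, csubspace V -> (forall x, x \in s -> V x) -> V z].

Definition rspan n (b : 'rV[E]_n) : set E :=
  [set z | exists c : 'cV[C]_n, z = (b *m map_mx ic c) 0 0].

Lemma cspan_csubspace s : csubspace (cspan s).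
Proof.
split=> [V [] //|x y sx sy V sV Vs|c x sx V sV Vs].
  by apply: (csubspaceD sV); [apply: sx|apply: sy].
by apply: (csubspaceZ sV); apply: sx.
Qed.

Lemma cspan_mem s x : x \in s -> cspan s x.
Proof. by move=> xs V _; apply. Qed.

Lemma cspan_sub s (V : set E) : csubspace V -> (forall x, x \in s -> V x) ->
  cspan s `<=` V.
Proof. by move=> sV Vs x; apply. Qed.

Lemma cspanS s t : {subset s <= t} -> cspan s `<=` cspan t.
Proof.
by move=> st; apply: cspan_sub (cspan_csubspace t) _ => x /st; apply: cspan_mem.
Qed.

Lemma csubspace_sum (V : set E) (T : Type) (r : seq T) (f : T -> E) :
  csubspace V -> (forall t, V (f t)) -> V (\sum_(t <- r) f t).
Proof.
move=> sV Vf; elim/big_ind: _ => [|x y|t _]; [by case: sV|exact: csubspaceD|exact: Vf].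
Qed.

Lemma cspanM s t x y : cspan s x -> cspan t y ->
  cspan [seq a * b | a <- s, b <- t] (x * y).
Proof.
set st := [seq _ | _ <- _, _ <- _] => sx ty; have sst := cspan_csubspace st.
apply: (sx [set x | cspan st (x * y)]); first split.
- by rewrite /= mul0r; case: sst.
- by move=> a b; rewrite /= mulrDl; apply: csubspaceD.
- by move=> c a; rewrite /= -mulrA; apply: csubspaceZ.
move=> a as_; apply: (ty [set y | cspan st (a * y)]); first split.
- by rewrite /= mulr0; case: sst.
- by move=> b d; rewrite /= mulrDr; apply: csubspaceD.
- by move=> c b; rewrite /= mulrCA; apply: csubspaceZ.
by move=> b bt; apply: cspan_mem; apply/allpairsP; exists (a, b).
Qed.

Lemma rspan_csubspace n (b : 'rV[E]_n) : csubspace (rspan b).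
Proof.
split; first by exists 0; rewrite map_mx0 mulmx0 mxE.
  by move=> x y [c ->] [d ->]; exists (c + d); rewrite map_mxD mulmxDr [RHS]mxE.
by move=> e x [c ->]; exists (e *: c); rewrite map_mxZ -scalemxAr [RHS]mxE.
Qed.

Lemma rspan_mem n (b : 'rV[E]_n) j : rspan b (b 0 j).
Proof. by exists (delta_mx j 0); rewrite map_delta_mx -colE mxE. Qed.

Lemma cspan_rspan s : cspan s `<=` rspan (\row_(j < size s) s`_j).
Proof.
apply: cspan_sub (rspan_csubspace _) _ => x /(nthP 0)[i si <-].
by have := rspan_mem (\row_(j < size s) s`_j) (Ordinal si); rewrite mxE.
Qed.

Lemma rspan_matrix n r (b : 'rV[E]_n) (b' : 'rV[E]_r) :
  (forall j, rspan b (b' 0 j)) -> exists T : 'M[C]_(n, r), b' = b *m map_mx ic T.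
Proof.
move=> /choice[c cP]; exists (\matrix_(i, j) c j i 0); apply/rowP => j.
by rewrite cP !mxE; apply: eq_bigr => i _; rewrite !mxE.
Qed.

Lemma independent_bound n r (b : 'rV[E]_n) (b' : 'rV[E]_r) :
  independent b' -> (forall j, rspan b (b' 0 j)) -> (r <= n)%N.
Proof.
move=> ind /rspan_matrix[T b'E]; rewrite leqNgt; apply/negP => nr.
have : kermx T^T != 0.
  rewrite -mxrank_eq0 mxrank_ker -lt0n subn_gt0 mxrank_tr.
  by rewrite (leq_ltn_trans (rank_leq_row T)).
move=> /rowV0Pn[v /sub_kermxP vT]; apply/negP/negPn.
rewrite -(trmxK v) (ind v^T) ?trmx0 // b'E -mulmxA -map_mxM -[T]trmxK -trmx_mul vT.
by rewrite trmx0 map_mx0 mulmx0.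
Qed.

Lemma independent_extend n (b : 'rV[E]_n) z :
  independent b -> ~ rspan b z -> independent (row_mx b (\row_(j < 1) z)).
Proof.
move=> ind bz c; rewrite -(vsubmxK c); move: (usubmx c) (dsubmx c) => d e.
rewrite map_col_mx mul_row_col => de.
have e0 : e 0 0 = 0.
  apply: contra_notP bz => /eqP e0; exists (- (e 0 0)^-1 *: d).
  have e1 : ic (e 0 0) != 0 by rewrite fmorph_eq0.
  apply: (mulfI e1); rewrite map_mxZ -scalemxAr [in RHS]mxE mulrA -rmorphM mulrN.
  rewrite mulfV // rmorphN rmorph1 mulN1r; apply/eqP; rewrite -addr_eq0 addrC; apply/eqP.
  have /matrixP/(_ 0 0) := de; rewrite [LHS]mxE [RHS]mxE [X in _ + X = _]mxE big_ord1.
  by rewrite [map_mx ic e _ _]mxE [(\row_ _ z) _ _]mxE mulrC => <-.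
have ez : e = 0 by apply/matrixP => i j; rewrite !ord1 e0 mxE.
by move: de; rewrite ez map_mx0 mulmx0 addr0 => /ind ->; rewrite col_mx0.
Qed.

Lemma basis_extend (T : set E) s n (b : 'rV[E]_n) :
  T `<=` cspan s -> independent b -> (forall j, T (b 0 j)) ->
  exists r (b' : 'rV[E]_r), [/\ independent b', forall j, T (b' 0 j),
    T `<=` rspan b' & forall j, exists k, b' 0 k = b 0 j].
Proof.
move=> Ts; have [k] := ubnP (size s - n); elim: k n b => // k ih n b sk ind bT.
have [all|] := pselect (T `<=` rspan b); first by exists n, b; split=> // j; exists j.
move=> /existsNP[z /not_implyP[Tz bz]].
have ind' := independent_extend ind bz.
have bT' j : T (row_mx b (\row_(j < 1) z) 0 j).
  by case: (split_ordP j) => l ->; rewrite ?row_mxEl ?row_mxEr ?mxE.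
have ns : (n + 1 <= size s)%N.
  by apply: independent_bound ind' _ => j; apply: cspan_rspan; apply: Ts.
have [|r [b' [ind'' b'T Tb' bb']]] := ih _ _ _ ind' bT'.
  by move: sk ns; move: (size s) => m; lia.
exists r, b'; split=> // j; have [l lE] := bb' (lshift 1 j).
by exists l; rewrite lE row_mxEl.
Qed.

Lemma basis_exists (T : set E) s : T `<=` cspan s ->
  exists r (b : 'rV[E]_r),
    [/\ independent b, forall j, T (b 0 j) & T `<=` rspan b].
Proof.
move=> Ts; have ind0 : independent (0 : 'rV_0) by move=> c _; apply/matrixP => -[].
have T0 (j : 'I_0) : T ((0 : 'rV_0) 0 j) by case: j.
by have [r [b [ib bT Tb _]]] := basis_extend Ts ind0 T0; exists r, b.
Qed.

End Span.

(** * Differential algebra *)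

Lemma derB (F : diffFieldType) : zmod_morphism (@der F).
Proof. by move=> x y; rewrite derD derN. Qed.
HB.instance Definition _ (F : diffFieldType) :=
  GRing.isZmodMorphism.Build F F (@der F) (@derB F).

Section Wronskian.
Variables (E : diffFieldType) (C : fieldType) (ic : {rmorphism C -> E}).
Hypothesis icP : forall x : E, der x = 0 -> exists c, x = ic c.

Definition wronskian n (b : 'rV[E]_n) : 'M[E]_n :=
  \matrix_(i, j) iter i der (b 0 j).

(** A kernel vector of the Wronskian matrix that ends in 1 has a constant
    remainder: its derivative is in the kernel of the Wronskian matrix of the
    other functions, which is invertible by induction. *)
Lemma wronskian_unit n (b : 'rV[E]_n) : independent ic b -> wronskian b \in unitmx.
Proof.
elim: n b => [|n ih] b indb; first by rewrite unitmxE det_mx00 unitr1.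
pose w (j : 'I_n) := widen_ord (leqnSn n) j.
pose b' : 'rV_n := \row_j b 0 (w j).
have indb' : independent ic b'.
  move=> c bc; pose d : 'cV[C]_n.+1 :=
    \col_j (if insub (val j) is Some k then c k 0 else 0).
  have dw j : d (w j) 0 = c j 0 by rewrite mxE /= valK.
  have d0 : d ord_max 0 = 0 by rewrite mxE insubF //= ltnn.
  clearbody d.
  have dz : d = 0.
    apply: indb; apply/matrixP => i j; rewrite !ord1 !mxE big_ord_recr /= mxE d0.
    rewrite rmorph0 mulr0 addr0 -[RHS](_ : (b' *m map_mx ic c) 0 0 = _).
      by rewrite mxE; apply: eq_bigr => k _; rewrite !mxE dw.
    by rewrite bc mxE.
  by apply/matrixP => i j; rewrite ord1 -dw dz !mxE.
have u' := ih _ indb'.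
rewrite unitmxE unitfE -det_tr; apply/negP => /det0P[v v0 vW].
have vE (i : 'I_n.+1) :
    \sum_(j < n) v 0 (w j) * iter i der (b 0 (w j)) +
      v 0 ord_max * iter i der (b 0 ord_max) = 0.
  have /matrixP/(_ 0 i) := vW; rewrite !mxE big_ord_recr /= !mxE => e.
  rewrite -[RHS]e; congr (_ + _).
  by apply: eq_bigr => j _; rewrite !mxE.
have kerb' (u : 'I_n -> E) :
    (forall i : 'I_n, \sum_(j < n) u j * iter i der (b 0 (w j)) = 0) ->
    forall j, u j = 0.
  move=> uW j; pose x := \col_j u j.
  have : wronskian b' *m x = 0.
    apply/matrixP => i k; rewrite ord1 !mxE -[RHS](uW i).
    by apply: eq_bigr => l _; rewrite !mxE mulrC.
  move=> /(congr1 (mulmx (invmx (wronskian b')))).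
  by rewrite mulKmx // mulmx0 => /matrixP/(_ j 0); rewrite !mxE.
have vm : v 0 ord_max != 0.
  apply: contraNneq v0 => vm; apply/eqP/matrixP => i j; rewrite ord1 mxE.
  case: (unliftP ord_max j) => [k ->|->//].
  have -> : lift ord_max k = w k by apply: val_inj; rewrite /= /bump leqNgt ltn_ord.
  apply: (kerb' (fun k => v 0 (w k))) => i'.
  by rewrite -[RHS](vE (w i')) vm mul0r addr0.
pose u j := v 0 (w j) / v 0 ord_max.
have uE (i : 'I_n.+1) :
    \sum_(j < n) u j * iter i der (b 0 (w j)) + iter i der (b 0 ord_max) = 0.
  apply: (mulfI vm); rewrite mulrDr mulr0 -[RHS](vE i); congr (_ + _).
  rewrite mulr_sumr; apply: eq_bigr => j _.
  by rewrite mulrA /u [_ * (_ / _)]mulrC divfK.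
have du j : der (u j) = 0.
  apply: (kerb' (fun j => der (u j))) => i.
  have := congr1 der (uE (w i)); rewrite derD raddf_sum der0 /=.
  under eq_bigr do rewrite derM.
  rewrite big_split /= -addrA.
  by have := uE (lift ord0 i); rewrite /= => ->; rewrite addr0.
have /choice[c cE] : forall j, exists c, u j = ic c by move=> j; apply: icP.
pose d : 'cV[C]_n.+1 := \col_j (if insub (val j) is Some k then c k else 1).
have dw j : d (w j) 0 = c j by rewrite mxE /= valK.
have d1 : d ord_max 0 = 1 by rewrite mxE insubF //= ltnn.
clearbody d.
have : d = 0.
  apply: indb; apply/matrixP => i j; rewrite !ord1 !mxE big_ord_recr /= mxE d1.
  rewrite rmorph1 mulr1 -[RHS](uE ord0); congr (_ + _).
  by apply: eq_bigr => k _; rewrite !mxE dw cE mulrC.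
by move=> /matrixP/(_ ord_max 0); rewrite d1 mxE => /eqP; rewrite oner_eq0.
Qed.

End Wronskian.

(** ** Polynomials in the entries of a matrix *)

Section MatrixEval.
Variables (R : nzRingType) (n : nat).

Definition peval (S : comNzRingType) (f : R -> S) (X : 'M[S]_n) :
  {mpoly R[n * n]} -> S := mmap f (fun k => mxvec X 0 k).

HB.instance Definition _ (S : comNzRingType) (f : {rmorphism R -> S}) X :=
  GRing.RMorphism.copy (peval f X) (peval f X).

Definition generic_mx : 'M[{mpoly R[n * n]}]_n := \matrix_(i, j) 'X_(mxvec_index i j).

Lemma pevalC (S : comNzRingType) (f : {rmorphism R -> S}) X c :
  peval f X c%:MP = f c.
Proof. exact: mmapC. Qed.

Lemma pevalX (S : comNzRingType) (f : {rmorphism R -> S}) X i j :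
  peval f X (generic_mx i j) = X i j.
Proof. by rewrite mxE /peval mmapX mmap1U mxvecE. Qed.

Lemma map_generic (S : comNzRingType) (f : {rmorphism R -> S}) X :
  map_mx (peval f X) generic_mx = X.
Proof. by apply/matrixP => i j; rewrite mxE pevalX. Qed.

Lemma generic_var k : exists i j, 'X_k = generic_mx i j.
Proof. by case/mxvec_indexP: k => i j; exists i, j; rewrite mxE. Qed.

Lemma peval_ext (S : nzRingType) (f g : {rmorphism {mpoly R[n * n]} -> S}) :
  (forall c, f c%:MP = g c%:MP) ->
  (forall i j, f (generic_mx i j) = g (generic_mx i j)) -> f =1 g.
Proof.
by move=> fg fgX; apply: mpoly_rmorph_ext => // k; have [i [j ->]] := generic_var k.
Qed.

Lemma pevalZ (S : comNzRingType) (f : {rmorphism R -> S}) X c p :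
  peval f X (c *: p) = f c * peval f X p.
Proof. exact: mmapZ. Qed.

Lemma pevalM (S : comNzRingType) (f : {rmorphism R -> S}) X :
  {morph peval f X : p q / p * q}.
Proof. exact: rmorphM. Qed.

Lemma pevalD (S : comNzRingType) (f : {rmorphism R -> S}) X :
  {morph peval f X : p q / p + q}.
Proof. exact: rmorphD. Qed.

Lemma pevalB (S : comNzRingType) (f : {rmorphism R -> S}) X :
  {morph peval f X : p q / p - q}.
Proof. exact: rmorphB. Qed.

Lemma peval1 (S : comNzRingType) (f : {rmorphism R -> S}) X : peval f X 1 = 1.
Proof. exact: rmorph1. Qed.

Lemma peval_comp (S S' : comNzRingType) (f : {rmorphism R -> S})
    (g : {rmorphism S -> S'}) X p :
  g (peval f X p) = peval (g \o f) (map_mx g X) p.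
Proof.
apply: (@peval_ext _ (g \o peval f X) (peval (g \o f) (map_mx g X))) => [c|i j].
  by rewrite /= !pevalC.
by rewrite /= !pevalX !mxE.
Qed.

End MatrixEval.

Lemma peval_map_mpoly (R : nzRingType) (S : comNzRingType) n
    (f : {rmorphism R -> S}) (X : 'M[S]_n) p :
  peval idfun X (map_mpoly f p) = peval f X p.
Proof.
apply: (@peval_ext _ _ _ (peval idfun X \o map_mpoly f) (peval f X)) => [c|i j] /=.
  by rewrite map_mpolyC !pevalC.
transitivity (peval idfun X (generic_mx S n i j)); last by rewrite !pevalX.
by congr peval; rewrite !mxE map_mpolyX.
Qed.

Lemma peval_const (R S : comNzRingType) n (f : {rmorphism R -> S}) (A : 'M[R]_n) p :
  peval f (map_mx f A) p = f (peval idfun A p).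
Proof.
rewrite peval_comp.
by apply: (@peval_ext _ _ _ (peval f _) (peval (f \o idfun) _)) => [c|i j] /=;
  rewrite ?pevalC ?pevalX.
Qed.

Lemma mpoly_closed n (R : nzRingType) (Q : set {mpoly R[n]}) :
  (forall c, Q c%:MP) -> (forall i, Q 'X_i) ->
  (forall p q, Q p -> Q q -> Q (p + q)) -> (forall p q, Q p -> Q q -> Q (p * q)) ->
  forall p, Q p.
Proof.
move=> QC QX QD QM p; rewrite (mpolyE p).
elim/big_ind: _ => [|x y|m _]; [by rewrite -mpolyC0|exact: QD|].
rewrite -mul_mpolyC; apply: (QM) => //; rewrite mpolyXE_id.
elim/big_ind: _ => [|x y|i _]; [by rewrite -mpolyC1|exact: QM|].
elim: (m i) => [|k ih]; first by rewrite expr0 -mpolyC1.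
by rewrite exprS; apply: QM.
Qed.

Section CoefDerivation.
Variables (E : diffFieldType) (n : nat).

Lemma map_derM (p q : {mpoly E[n]}) :
  map_mpoly der (p * q) = map_mpoly der p * q + p * map_mpoly der q.
Proof.
apply/mpolyP => m; rewrite mcoeff_map_mpoly mcoeffM raddf_sum mcoeffD !mcoeffM.
rewrite -big_split; apply: eq_bigr => k _ /=.
by rewrite derM !mcoeff_map_mpoly.
Qed.

Lemma map_derZ e (p : {mpoly E[n]}) :
  map_mpoly der (e *: p) = der e *: p + e *: map_mpoly der p.
Proof.
by apply/mpolyP => m; rewrite mcoeffD !mcoeffZ !mcoeff_map_mpoly /= mcoeffZ derM.
Qed.

Lemma map_der_eval (v : 'I_n -> E) (p : {mpoly E[n]}) :
  (forall i, der (v i) = 0) -> (map_mpoly der p).@[v] = der p.@[v].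
Proof.
move=> dv; move: p; apply: mpoly_closed => [c|i|p q dp dq|p q dp dq].
- by rewrite map_mpolyC !mevalC.
- rewrite mevalXU dv; suff -> : map_mpoly der 'X_i = 0 :> {mpoly E[n]} by rewrite meval0.
  apply/mpolyP => m; rewrite mcoeff_map_mpoly mcoeffX mcoeff0.
  by case: eqP => _; [exact: der1|exact: der0].
- by rewrite raddfD !mevalD dp dq derD.
by rewrite map_derM mevalD !mevalM dp dq derM.
Qed.

End CoefDerivation.

(** For a linear differential system X' = AX, the derivative of a polynomial in
    the entries of X is a polynomial in these entries, in the same way for all
    solutions X in all differential rings. *)
Lemma der_peval (K : diffFieldType) n (A : 'M[K]_n) (p : {mpoly K[n * n]}) :
  exists q, forall (S : comNzRingType) (d : {additive S -> S})
    (f : {rmorphism K -> S}) X,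
    (forall x y, d (x * y) = d x * y + x * d y) ->
    (forall a, d (f a) = f (der a)) -> map_mx d X = map_mx f A *m X ->
    d (peval f X p) = peval f X q.
Proof.
move: p; apply: mpoly_closed => [c|k|p1 p2 [q1 e1] [q2 e2]|p1 p2 [q1 e1] [q2 e2]].
- by exists (der c)%:MP => S d f X _ df _; rewrite !pevalC df.
- have [i [j ->]] := generic_var K k; exists ((map_mx (@mpolyC _ K) A *m generic_mx K n) i j).
  move=> S d f X _ _ /matrixP/(_ i j); rewrite [LHS]mxE [RHS]mxE pevalX => ->.
  rewrite [X in peval _ _ X]mxE rmorph_sum; apply: eq_bigr => l _.
  by rewrite rmorphM /= pevalX ![map_mx _ _ _ _]mxE pevalC.
- exists (q1 + q2) => S d f X dM df dX; rewrite !rmorphD raddfD.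
  by rewrite (e1 _ _ _ _ dM df dX) (e2 _ _ _ _ dM df dX).
exists (q1 * p2 + p1 * q2) => S d f X dM df dX; rewrite rmorphD !rmorphM dM.
by rewrite (e1 _ _ _ _ dM df dX) (e2 _ _ _ _ dM df dX).
Qed.

(** * Specialising a fundamental matrix *)

Lemma radicalD (A : comNzRingType) (I : set A) x y k l :
  ideal I -> I (x ^+ k) -> I (y ^+ l) -> I ((x + y) ^+ (k + l)).
Proof.
move=> idI Ix Iy; rewrite exprDn; apply: ideal_sum => // i _.
rewrite -mulr_natl; apply: ideal_mul => //.
have [li|il] := leqP l i.
  by rewrite -(subnK li) [y ^+ _]exprD mulrA; apply: ideal_mul.
rewrite mulrC; apply: ideal_mul => //.
have e : (k + l - i = (l - i) + k)%N by move: (nat_of_ord i) il => j; lia.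
by rewrite [X in x ^+ X]e exprD; apply: ideal_mul.
Qed.

Section Specialisation.
Variables (E K : diffFieldType) (C : fieldType) (ic : {rmorphism C -> E}).
Hypothesis icP : forall x : E, der x = 0 -> exists c, x = ic c.
Hypothesis ic_der : forall c, der (ic c) = 0.
Hypothesis closedC : GRing.closed_field_axiom C.
Variables (ik ik' : {rmorphism K -> E}).
Hypothesis ik_der : forall a, der (ik a) = ik (der a).
Hypothesis ik'_der : forall a, der (ik' a) = ik' (der a).
Variables (n : nat) (Y : 'M[E]_n) (A : 'M[K]_n).
Hypothesis unitY : Y \in unitmx.
Hypothesis derY : map_mx der Y = map_mx ik A *m Y.
Hypothesis derY' : map_mx der Y = map_mx ik' A *m Y.

Local Notation Z := (generic_mx E n).

Definition relation (f : {mpoly K[n * n]}) := peval ik Y f = 0.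

Definition subst : {mpoly K[n * n]} -> {mpoly E[n * n]} :=
  peval (@mpolyC _ E \o ik') (map_mx (@mpolyC _ E) Y *m Z).
HB.instance Definition _ := GRing.RMorphism.copy subst subst.

(** The E-span of the polynomials f(YZ), for f among the relations of Y with
    coefficients carried over by ik'; the zeros M of this span give the
    specialisations YM of Y. *)
Definition relspan : set {mpoly E[n * n]} :=
  [set u | forall V, subspace V -> (forall f, relation f -> V (subst f)) -> V u].

Definition specialises (M : 'M[C]_n) :=
  M \in unitmx /\ forall f, relation f -> peval ik' (Y *m map_mx ic M) f = 0.

Lemma relation_ideal : ideal relation.
Proof.
split; first exact: rmorph0.
  by move=> f g; rewrite /relation rmorphD /= => -> ->; rewrite addr0.
by move=> a f; rewrite /relation rmorphM /= => ->; rewrite mulr0.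
Qed.

Lemma relspan_subspace : subspace relspan.
Proof.
split=> [V sV _|u v Uu Uv V sV gV|e u Uu V sV gV].
- by case: sV.
- by apply: (subspaceD sV); [apply: Uu|apply: Uv].
by apply: (subspaceZ sV); apply: Uu.
Qed.

Lemma relspan_gen f : relation f -> relspan (subst f).
Proof. by move=> If V sV; apply. Qed.

Lemma relspan_ideal : ideal relspan.
Proof.
have sU := relspan_subspace.
split=> [|u v|a u]; [by case: sU|exact: (subspaceD sU)|].
pose W := [set a | forall u, relspan u -> relspan (a * u)].
suff Wa : forall a, W a by move=> /Wa.
have WD b c : W b -> W c -> W (b + c).
  by move=> Wb Wc v Uv; rewrite mulrDl; apply: (subspaceD sU); [apply: Wb|apply: Wc].
have WM b c : W b -> W c -> W (b * c).
  by move=> Wb Wc v Uv; rewrite -mulrA; apply: Wb; apply: Wc.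
have WC c : W c%:MP by move=> v Uv; rewrite mul_mpolyC; apply: (subspaceZ sU).
have Wsubst g : W (subst g).
  move=> v Uv; apply: (Uv [set x | relspan (subst g * x)]); first split.
  - by rewrite /= mulr0; case: sU.
  - by move=> v1 v2 U1 U2; rewrite /= mulrDr; apply: (subspaceD sU).
  - by move=> e v1 U1; rewrite /= -scalerAr; apply: (subspaceZ sU).
  move=> f If; rewrite /= -rmorphM; apply: relspan_gen.
  by apply: ideal_mul => //; exact: relation_ideal.
move=> {u}; apply: mpoly_closed => // k; have [i [j ->]] := generic_var E k.
have -> : Z i j = \sum_l (invmx Y i l)%:MP * subst (generic_mx K n l j).
  have -> : Z = map_mx (@mpolyC _ E) (invmx Y) *m (map_mx (@mpolyC _ E) Y *m Z).
    by rewrite mulmxA -map_mxM mulVmx // map_mx1 mul1mx.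
  by rewrite mxE; apply: eq_bigr => l _; rewrite mxE /subst pevalX.
elim/big_ind: _ => [|x y|l _]; [by rewrite -mpolyC0|exact: WD|exact: WM].
Qed.

Lemma relspan_der u : relspan u -> relspan (map_mpoly der u).
Proof.
have sU := relspan_subspace => Uu.
have [] // : [set v | relspan v /\ relspan (map_mpoly der v)] u.
apply: Uu; first split.
- by rewrite /= raddf0; split; case: sU.
- by move=> v w [? ?] [? ?]; rewrite /= raddfD; split; apply: (subspaceD sU).
- move=> e v [? ?]; rewrite /= map_derZ; split; first exact: (subspaceZ sU).
  by apply: (subspaceD sU); apply: (subspaceZ sU).
move=> f If; split; first exact: relspan_gen.
have [g gP] := der_peval A f.
suff -> : map_mpoly der (subst f) = subst g.
  apply: relspan_gen; rewrite /relation.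
  rewrite -(gP _ (@der E) ik Y (@derM E) ik_der derY).
  by rewrite [peval _ _ _]If raddf0.
apply: gP => [p q|a|]; first exact: map_derM.
  by rewrite /= map_mpolyC /= ik'_der.
have -> : map_mx (@mpolyC _ E \o ik') A *m (map_mx (@mpolyC _ E) Y *m Z) =
    map_mx (@mpolyC _ E) (map_mx der Y) *m Z.
  by rewrite derY' map_mx_comp mulmxA map_mxM.
apply/matrixP => i j; rewrite mxE mxE raddf_sum mxE; apply: eq_bigr => l _.
rewrite !mxE /= map_derM map_mpolyC /= -[RHS]addr0; congr (_ + _).
rewrite (_ : map_mpoly der 'X__ = 0) ?mulr0 //.
apply/mpolyP => m; rewrite mcoeff_map_mpoly mcoeffX mcoeff0.
by case: eqP => _; [exact: der1|exact: der0].
Qed.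

Lemma subst_eval M f :
  (subst f).@[fun k => mxvec (map_mx ic M) 0 k] = peval ik' (Y *m map_mx ic M) f.
Proof.
set v := fun k => _.
rewrite -[LHS]/(meval v (subst f)) /subst peval_comp.
have -> : map_mx (meval v) (map_mx (@mpolyC _ E) Y *m Z) = Y *m map_mx ic M.
  rewrite map_mxM -map_mx_comp; congr (_ *m _).
    by apply/matrixP => i j; rewrite mxE /= mevalC.
  exact: (@map_generic _ _ _ idfun).
apply: (@peval_ext _ _ _ (peval (meval v \o (@mpolyC _ E \o ik')) _) (peval ik' _)) => [c|i j].
  by rewrite /= !pevalC /= mevalC.
by rewrite /= !pevalX.
Qed.

Lemma map_det_generic (R : comNzRingType) (S : comNzRingType) (f : {rmorphism R -> S}) X :
  peval f X (\det (generic_mx R n)) = \det X.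
Proof. by rewrite -det_map_mx map_generic. Qed.

Lemma relspan_const (v : {mpoly E[n * n]}) :
  (forall (t : unit) m, der v@_m = 0) -> exists p : {mpoly C[n * n]}, v = map_mpoly ic p.
Proof.
move=> dv; have /choice[c cE] : forall m, exists c, v@_m = ic c.
  by move=> m; apply: icP; apply: dv tt m.
exists (\sum_(m <- msupp v) c m *: 'X_[m]).
rewrite rmorph_sum {1}(mpolyE v); apply: eq_bigr => m _.
by rewrite /= map_mpolyZ map_mpolyX cE.
Qed.

Local Notation ev M := (peval idfun (map_mx ic M)).

Lemma eval_zero_subspace M : subspace [set u : {mpoly E[n * n]} | ev M u = 0].
Proof.
split; first exact: rmorph0.
  by move=> u v; rewrite /= pevalD => -> ->; rewrite addr0.
by move=> e u; rewrite /= pevalZ => ->; rewrite mulr0.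
Qed.

Let theta (t : unit) : {additive E -> E} := @der E.
Let theta1 t : theta t 1 = 0. Proof. exact: der1. Qed.

(** The span is stable under the coefficientwise derivation, hence spanned by
    polynomials over C. *)
Lemma specialisesP M : M \in unitmx ->
  (specialises M <-> forall p, relspan (map_mpoly ic p) -> peval idfun M p = 0).
Proof.
move=> uM; split=> [[_ sM] p Up|PM].
  apply: (fmorph_inj ic); rewrite rmorph0 -peval_const -peval_map_mpoly.
  apply: (Up _ (eval_zero_subspace M)) => f If /=.
  by rewrite -[LHS]/((subst f).@[_]) subst_eval sM.
split=> // f If; rewrite -subst_eval.
apply: (descent theta1 relspan_subspace _ (eval_zero_subspace M)) => [t u|v Uv dv|].
- exact: relspan_der.
- have [p pE] := relspan_const dv.
  by rewrite pE /= peval_map_mpoly peval_const PM ?rmorph0 // -pE.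
exact: relspan_gen.
Qed.

(** Descent to constants turns the span into an ideal over C, to which the
    Nullstellensatz applies; the polynomials vanishing at all M as below are
    themselves spanned by polynomials with constant coefficients. *)
Lemma specialisation_nullstellensatz (h : {mpoly E[n * n]}) :
  (forall M, specialises M -> ev M h = 0) ->
  exists N, relspan ((h * \det Z) ^+ N).
Proof.
move=> hM; pose W := [set u | forall M, specialises M -> ev M u = 0].
pose V := [set u | exists N, relspan ((u * \det Z) ^+ N)].
have sU := relspan_subspace; have idU := relspan_ideal.
have dev M u : ev M (map_mpoly der u) = der (ev M u).
  by apply: map_der_eval => k; case/mxvec_indexP: k => i j; rewrite mxvecE mxE ic_der.
pose P := [set p : {mpoly C[n * n]} | relspan (map_mpoly ic p)].
have idP : ideal P by apply: (ideal_preim (map_mpoly ic)).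
apply: (@descent _ _ _ theta W theta1 _ _ V) => //.
- split=> [M _|u v Wu Wv M sM|e u Wu M sM]; first by case: (eval_zero_subspace M).
    by apply: (subspaceD (eval_zero_subspace M)); [apply: Wu|apply: Wv].
  by apply: (subspaceZ (eval_zero_subspace M)); apply: Wu.
- by move=> t u Wu M sM; rewrite dev Wu // der0.
- split; first by exists 1%N; rewrite mul0r expr0n; case: sU.
    move=> u v [k Uu] [l Uv]; exists (k + l)%N; rewrite mulrDl.
    exact: (radicalD idU Uu Uv).
  move=> e u [k Uu]; exists k; rewrite -scalerAl exprZn; exact: (subspaceZ sU).
move=> v Wv dv; have [p pE] := relspan_const dv.
have [|k kP] := nullstellensatz closedC (g := p * \det (generic_mx C n)) idP.
  move=> z zP; pose M := vec_mx (\row_k z k) : 'M_n.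
  have zE q : q.@[z] = peval idfun M q.
    by apply: meval_eq => k; rewrite /M vec_mxK mxE.
  have [uM|uM] := boolP (M \in unitmx).
    rewrite mevalM zE; suff -> : peval idfun M p = 0 by rewrite mul0r.
    apply: (fmorph_inj ic); rewrite rmorph0 -peval_const -peval_map_mpoly -pE.
    by apply: Wv; apply/(specialisesP uM) => q Pq; rewrite -zE; apply: zP.
  rewrite mevalM [X in _ * X]zE map_det_generic.
  by move: uM; rewrite unitmxE unitfE negbK => /eqP->; rewrite mulr0.
exists k; move: kP; rewrite /P /= rmorphXn rmorphM /= -pE -det_map_mx.
suff -> : map_mx (map_mpoly ic) (generic_mx C n) = Z by [].
by apply/matrixP => i j; rewrite !mxE /= map_mpolyX.
Qed.

Lemma relspan_explicit u : relspan u ->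
  exists s : seq (E * {mpoly K[n * n]}),
    (forall ef, ef \in s -> relation ef.2) /\
    u = \sum_(ef <- s) ef.1 *: subst ef.2.
Proof.
move=> Uu; pose V := [set v | exists s : seq (E * {mpoly K[n * n]}),
    (forall ef, ef \in s -> relation ef.2) /\
    v = \sum_(ef <- s) ef.1 *: subst ef.2].
suff : V u by [].
apply: Uu; first split.
- by exists [::]; rewrite big_nil.
- move=> _ _ [s [sI ->]] [r [rI ->]]; exists (s ++ r); rewrite big_cat; split=> //.
  by move=> ef; rewrite mem_cat => /orP[/sI|/rI].
- move=> e _ [s [sI ->]]; exists [seq (e * ef.1, ef.2) | ef <- s]; split.
    by move=> _ /mapP[ef /sI ? ->].
  by rewrite big_map scaler_sumr; apply: eq_bigr => ef _; rewrite scalerA.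
move=> f If; exists [:: (1, f)]; rewrite big_seq1 scale1r; split=> // ef.
by rewrite inE => /eqP->.
Qed.

(** Z |-> Y^-1 Z undoes the substitution of YZ for X. *)
Lemma unsubst (f : {mpoly K[n * n]}) :
  peval (@mpolyC _ E) (map_mx (@mpolyC _ E) (invmx Y) *m Z) (subst f) =
  map_mpoly ik' f.
Proof.
set X := _ *m _; rewrite /subst peval_comp.
apply: (@peval_ext _ _ _ (peval (peval (@mpolyC _ E) X \o (@mpolyC _ E \o ik')) _)
   (map_mpoly ik')) => [c|i j] /=.
  by rewrite !pevalC /= pevalC map_mpolyC.
rewrite pevalX map_mxM map_generic /X mulmxA.
have -> : map_mx (peval (@mpolyC _ E) (map_mx (@mpolyC _ E) (invmx Y) *m Z))
    (map_mx (@mpolyC _ E) Y) = map_mx (@mpolyC _ E) Y.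
  by apply/matrixP => k l; rewrite !mxE pevalC.
by rewrite -map_mxM mulmxV // map_mx1 mul1mx !mxE map_mpolyX.
Qed.

(** Extension of scalars from K to E creates no new relations: the vectors of
    E occurring in a combination of relations are absorbed one by one, either
    into the K-span of t or as a new independent vector. *)
Lemma relspan_coef r (t : nat -> E) (g : nat -> {mpoly K[n * n]}) :
  (forall c : nat -> K, \sum_(j < r) ik' (c j) * t j = 0 ->
     forall j, (j < r)%N -> c j = 0) ->
  relspan (\sum_(j < r) t j *: subst (g j)) ->
  forall j, (j < r)%N -> relation (g j).
Proof.
move=> indt /relspan_explicit[s [sI]].
elim: s r t g indt sI => [|[e f] s ih] r t g indt sI.
  rewrite big_nil => /(congr1 (peval (@mpolyC _ E) (map_mx (@mpolyC _ E) (invmx Y) *m Z))).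
  rewrite rmorph_sum rmorph0 /=.
  under eq_bigr do rewrite pevalZ unsubst mul_mpolyC.
  move=> tg j jr; suff -> : g j = 0 by exact: rmorph0.
  apply/mpolyP => m; rewrite mcoeff0; apply: (indt (fun j => (g j)@_m)) => //.
  have := congr1 (mcoeff m) tg; rewrite raddf_sum mcoeff0 => tg0.
  rewrite -[RHS]tg0; apply: eq_bigr => i _.
  by rewrite /= mcoeffZ mcoeff_map_mpoly mulrC.
have If : relation f by apply: (sI (e, f)); rewrite inE eqxx.
have {}sI ef : ef \in s -> relation ef.2.
  by move=> es; apply: sI; rewrite inE es orbT.
rewrite big_cons /= => tg.
have [[c eE]|enot] := pselect (exists c : nat -> K, e = \sum_(j < r) ik' (c j) * t j).
  pose g' j := g j - c j *: f => j jr.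
  have := ih r t g' indt sI _ j jr.
  rewrite /g' /relation rmorphB /= pevalZ [peval ik Y f]If mulr0 subr0; apply.
  move: tg => /(canLR (addKr _)) <-; rewrite eE addrC scaler_suml -sumrB.
  apply: eq_bigr => i _; rewrite rmorphB scalerBr; congr (_ - _).
  by rewrite /= /subst pevalZ /= mul_mpolyC scalerA mulrC.
pose t' j := if (j < r)%N then t j else e.
pose g' j := if (j < r)%N then g j else - f.
move=> j jr; have := ih r.+1 t' g' _ sI _ j (ltnW jr); rewrite /g' jr; apply.
  move=> c; rewrite big_ord_recr /= {2}/t' ltnn.
  under eq_bigr => i _ do rewrite /t' ltn_ord.
  move=> ce; have cr : c r = 0.
    apply: contra_notP enot => cr; have {}cr : ik' (c r) != 0.
      by rewrite fmorph_eq0; apply/eqP.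
    exists (fun j => - (c j / c r)); apply: (mulfI cr).
    move/eqP: ce; rewrite addrC addr_eq0 => /eqP->.
    rewrite mulr_sumr -sumrN; apply: eq_bigr => i _.
    by rewrite rmorphN fmorph_div mulNr mulrN mulrA mulrCA mulrV ?mulr1 ?unitfE.
  move=> i; rewrite ltnS leq_eqVlt => /predU1P[->//|].
  by apply: indt; rewrite -[RHS]ce cr rmorph0 mul0r addr0.
rewrite big_ord_recr /= /t' !ltnn.
under eq_bigr => i _ do rewrite !ltn_ord.
by rewrite tg rmorphN scalerN addrAC subrr add0r.
Qed.

Lemma subst_det N : subst (\det (generic_mx K n) ^+ N) =
  \det Y ^+ N *: \det Z ^+ N.
Proof.
rewrite rmorphXn /= /subst map_det_generic det_mulmx det_map_mx exprMn.
by rewrite -mul_mpolyC rmorphXn.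
Qed.

(** Otherwise a power of det Z would be in the span, hence a power of the
    determinant would be a relation, although det Y is not 0. *)
Lemma specialisation_exists : exists M, specialises M.
Proof.
apply: contrapT => noM; have [|N UN] := specialisation_nullstellensatz (h := 1).
  by move=> M sM; case: noM; exists M.
suff : relation (\det (generic_mx K n) ^+ N).
  rewrite /relation rmorphXn /= map_det_generic => /eqP; rewrite expf_eq0.
  by move: unitY; rewrite unitmxE unitfE => /negPf->; rewrite andbF.
have := @relspan_coef 1 (fun=> 1) (fun=> \det (generic_mx K n) ^+ N) _ _ 0%N.
apply=> //.
  move=> c; rewrite big_ord1 mulr1 => /eqP; rewrite fmorph_eq0 => /eqP c0 j.
  by rewrite ltnS leqn0 => /eqP->.
rewrite big_ord1 scale1r subst_det; apply: (subspaceZ relspan_subspace).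
by move: UN; rewrite mul1r.
Qed.

End Specialisation.

(** ** Elements fixed by all specialisations *)

Section FixedElement.
Variables (E K : diffFieldType) (C : fieldType) (ic : {rmorphism C -> E}).
Hypothesis icP : forall x : E, der x = 0 -> exists c, x = ic c.
Hypothesis ic_der : forall c, der (ic c) = 0.
Hypothesis closedC : GRing.closed_field_axiom C.
Variable ik : {rmorphism K -> E}.
Hypothesis ik_der : forall a, der (ik a) = ik (der a).
Variables (n : nat) (Y : 'M[E]_n) (A : 'M[K]_n).
Hypothesis unitY : Y \in unitmx.
Hypothesis derY : map_mx der Y = map_mx ik A *m Y.

(** If all specialisations of Y fix x = a(Y)/b(Y), then a power of
    a - xb is in the span of the relations, up to a factor det, which amounts
    to (x - T)^N being zero modulo the minimal polynomial of x over K. So this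
    polynomial is a power of T - x, and in characteristic 0 its second
    coefficient gives x. *)
Lemma fixed_by_specialisations a b x :
  (forall k, (0 < k)%N -> k%:R != 0 :> E) ->
  peval ik Y b != 0 -> peval ik Y a = x * peval ik Y b ->
  (forall M, specialises ic ik ik Y M ->
     peval ik (Y *m map_mx ic M) a = x * peval ik (Y *m map_mx ic M) b) ->
  exists k, x = ik k.
Proof.
move=> char0 bY aY fixx.
pose h : {mpoly E[n * n]} := subst ik Y a - x *: subst ik Y b.
have [|N UN] := specialisation_nullstellensatz icP ic_der closedC ik_der ik_der unitY
    derY derY (h := h).
  move=> M sM; rewrite pevalB pevalZ ![peval idfun _ (subst _ _ _)]subst_eval.
  by rewrite fixx // subrr.
pose d := \det (generic_mx K n).
pose G i := 'C(N, i)%:R * a ^+ (N - i) * (- b) ^+ i * d ^+ N.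
have sU := relspan_subspace ik ik Y.
have {}UN : relspan ik ik Y (\sum_(i < N.+1) x ^+ i *: subst ik Y (G i)).
  move: UN; rewrite exprMn => /(subspaceZ sU (\det Y ^+ N)).
  rewrite scalerAr -(subst_det ik Y N).
  congr relspan; rewrite /h exprDn mulr_suml; apply: eq_bigr => i _.
  rewrite /G !rmorphM /= !rmorphXn /= rmorphN rmorph_nat /=.
  rewrite -!mul_mpolyC rmorphXn /= -mulr_natl.
  by rewrite -[- (_ * _)]mulrN exprMn; ring.
have dY : peval ik Y d != 0.
  by rewrite map_det_generic -unitfE -unitmxE.
have Grel i : peval ik Y (G i) =
    ('C(N, i)%:R * x ^+ (N - i) * (-1) ^+ i) *
    (peval ik Y b ^+ (N - i + i) * peval ik Y d ^+ N).
  rewrite /G !rmorphM !rmorphXn rmorphN rmorph_nat /= aY.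
  by rewrite exprMn exprD -[- _ in LHS]mulN1r exprMn; ring.
have [[p1 p1_neq0 p1x]|noroot] := pselect
    (exists2 p : {poly K}, p != 0 & (map_poly ik p).[x] = 0); last first.
  (* The powers of a transcendental x are independent, so that the coefficient
     b^N det^N of x^N would be a relation. *)
  have /(_ (fun i => x ^+ i) _) := @relspan_coef E K ik ik n Y unitY N.+1.
  move=> /(_ G _ UN N (ltnSn N)); rewrite /relation Grel => rel.
  suff /rel/eqP : forall c : nat -> K, \sum_(j < N.+1) ik (c j) * x ^+ j = 0 ->
      forall j, (j < N.+1)%N -> c j = 0.
    rewrite binn subnn !mulf_eq0 !expf_eq0 oppr_eq0 !oner_eq0 /= (negPf bY).
    by rewrite (negPf dY) !andbF.
  move=> c cx j jN; apply: contrapT => cj; apply: noroot.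
  exists (\poly_(i < N.+1) c i).
    apply/eqP => /(congr1 (fun p : {poly K} => p`_j)).
    by rewrite coef_poly jN coef0.
  rewrite (@horner_coef_wide _ N.+1) ?size_map_poly ?size_poly // -[RHS]cx.
  by apply: eq_bigr => i _; rewrite coef_map coef_poly ltn_ord.
have [|s [p [p0 px ps]] smin] := @least_nat (fun s => exists p : {poly K},
    [/\ p != 0, (map_poly ik p).[x] = 0 & size p = s]).
  by exists (size p1), p1.
pose r := s.-1; pose P := map_poly ik p.
have sr : s = r.+1 by rewrite /r -ps prednK // size_poly_gt0.
pose rho i j := ('X^i %% p)`_j.
have srho i : (size ('X^i %% p)%R <= r)%N by rewrite -ltnS -sr -ps ltn_modp.
have xrho i : x ^+ i = \sum_(j < r) ik (rho i j) * x ^+ j.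
  have := congr1 (fun q : {poly K} => (map_poly ik q).[x]) (divp_eq 'X^i p).
  rewrite /= map_polyXn hornerXn rmorphD rmorphM hornerD hornerM px mulr0 add0r => ->.
  rewrite (@horner_coef_wide _ r) ?size_map_poly //.
  by apply: eq_bigr => j _; rewrite coef_map.
have rel j : (j < r)%N -> relation ik Y (\sum_(i < N.+1) rho i j *: G i).
  have /(_ (fun i => x ^+ i) (fun j => \sum_(i < N.+1) rho i j *: G i)) :=
    @relspan_coef E K ik ik n Y unitY r.
  apply.
    move=> c cx k kr; apply: contrapT => ck.
    suff : (s <= r)%N by rewrite sr ltnn.
    apply: leq_trans (size_poly r c); apply: smin; exists (\poly_(i < r) c i); split=> //.
      apply/eqP => /(congr1 (fun p : {poly K} => p`_k)).
      by rewrite coef_poly kr coef0.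
    rewrite (@horner_coef_wide _ r) ?size_map_poly ?size_poly // -[RHS]cx.
    by apply: eq_bigr => i _; rewrite coef_map coef_poly ltn_ord.
  move: UN; congr relspan; under eq_bigr => i _ do rewrite xrho scaler_suml.
  rewrite exchange_big; apply: eq_bigr => k _ /=.
  rewrite rmorph_sum scaler_sumr; apply: eq_bigr => i _.
  by rewrite /= /subst pevalZ /= mul_mpolyC scalerA mulrC.
pose e i := 'C(N, i)%:R * x ^+ (N - i) * (-1) ^+ i.
have erho j : (j < r)%N -> \sum_(i < N.+1) e i * ik (rho i j) = 0.
  move=> /rel; rewrite /relation rmorph_sum => rel0.
  have z0 : peval ik Y b ^+ N * peval ik Y d ^+ N != 0.
    by rewrite mulf_neq0 ?expf_neq0.
  apply: (mulIf z0); rewrite mul0r -[RHS]rel0 mulr_suml; apply: eq_bigr => i _.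
  rewrite /= pevalZ Grel subnK -1?ltnS // -/(e i).
  by rewrite [e i * ik _]mulrC -mulrA.
have PxX : P %| ('X - x%:P) ^+ N.
  have -> : ('X - x%:P) ^+ N = (-1) ^+ N * \sum_(i < N.+1) e i *: 'X^i.
    rewrite -opprB [LHS]exprNn; congr (_ * _); rewrite exprBn; apply: eq_bigr => i _.
    rewrite -mulr_natl -mul_polyC /e !polyCM !rmorphXn /= rmorphN rmorph_nat.
    by rewrite rmorph1; ring.
  apply: dvdp_mull; apply/modp_eq0P.
  have modS (I : Type) (t : seq I) (f : I -> {poly E}) :
      (\sum_(i <- t) f i) %% P = \sum_(i <- t) (f i %% P).
    by apply: (big_morph (fun q => q %% P)) => [u v|]; rewrite ?modpD ?mod0p.
  rewrite modS; apply/polyP => j; rewrite coef0 coef_sum.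
  have coefE (i : 'I_N.+1) : ((e i *: 'X^i) %% P)`_j = e i * ik (rho i j).
    by rewrite modpZl coefZ -(map_polyXn ik) -map_modp coef_map.
  under eq_bigr do rewrite coefE.
  have [/erho //|rj] := ltnP j r.
  apply: big1 => i _; rewrite (_ : rho i j = 0) ?rmorph0 ?mulr0 //.
  by rewrite /rho nth_default // (leq_trans (srho i)).
have [k kN] := elimT dvdp_exp_XsubCP PxX.
move=> /eqpf_eq[c c0 PE].
have sP : size P = k.+1 by rewrite PE size_scale // size_exp_XsubC.
have k0 : (0 < k)%N.
  rewrite lt0n; apply/eqP => k0; move: px; rewrite -/P PE k0 expr0 hornerZ hornerC.
  by move/eqP; rewrite mulr1 (negPf c0).
have XkE : ('X - x%:P) ^+ k = \prod_(z <- nseq k x) ('X - z%:P).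
  by rewrite big_nseq -Monoid.iteropE.
have Pk1 : P`_k.-1 = - (c * (x *+ k)).
  rewrite PE coefZ XkE -{2}(size_nseq k x) coefPn_prod_XsubC ?size_nseq -?lt0n //.
  by rewrite big_nseq iter_addr_0 mulrN.
have Pk : P`_k = c.
  rewrite PE coefZ; suff -> : (('X - x%:P) ^+ k)`_k = 1 by rewrite mulr1.
  have := lead_coef_exp ('X - x%:P) k; rewrite lead_coefXsubC expr1n.
  by rewrite lead_coefE size_exp_XsubC.
exists (- (p`_k.-1 / (p`_k *+ k))).
rewrite rmorphN fmorph_div rmorphMn /= -!coef_map -/P Pk Pk1 mulNr opprK.
rewrite -[x *+ k]mulr_natl -[c *+ k]mulr_natr mulrA mulrAC divff ?mul1r //.
by rewrite mulf_neq0 // char0.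
Qed.

End FixedElement.

(** ** Extending automorphisms *)

(** The substitution X -> XP, combined with tau on the coefficients. *)
Definition twisted_subst (K : fieldType) n (tau : {rmorphism K -> K}) (P : 'M[K]_n) :
    {mpoly K[n * n]} -> {mpoly K[n * n]} :=
  peval (@mpolyC _ K \o tau) (generic_mx K n *m map_mx (@mpolyC _ K) P).

HB.instance Definition _ (K : fieldType) n (tau : {rmorphism K -> K}) (P : 'M[K]_n) :=
  GRing.RMorphism.copy (twisted_subst tau P) (twisted_subst tau P).

Lemma peval_twisted_subst (K : fieldType) n (tau : {rmorphism K -> K}) (P : 'M[K]_n)
    (S : comNzRingType) (f : {rmorphism K -> S}) X g :
  peval f X (twisted_subst tau P g) = peval (f \o tau) (X *m map_mx f P) g.
Proof.
rewrite /twisted_subst peval_comp map_mxM map_generic -map_mx_comp.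
have -> : map_mx (peval f X \o @mpolyC (n * n) K) P = map_mx f P.
  by apply/matrixP => i j; rewrite !mxE /= pevalC.
apply: (@peval_ext _ _ _ (peval (peval f X \o (@mpolyC _ K \o tau)) _)
  (peval (f \o tau) _)) => [c|i j] /=; first by rewrite !pevalC /= pevalC.
by rewrite !pevalX.
Qed.

Lemma twisted_substK (K : fieldType) n (tau tau' : {rmorphism K -> K}) (P Q : 'M[K]_n) :
  cancel tau' tau -> P *m map_mx tau Q = 1%:M ->
  cancel (twisted_subst tau' Q) (twisted_subst tau P).
Proof.
move=> tauK PQ g; rewrite {1}/twisted_subst peval_twisted_subst.
rewrite -mulmxA [map_mx (_ \o tau) Q]map_mx_comp -map_mxM PQ map_mx1 mulmx1.
apply: (@peval_ext _ _ _ (peval ((@mpolyC _ K \o tau) \o tau') _) idfun) => [c|i j] /=.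
  by rewrite pevalC /= tauK.
by rewrite pevalX.
Qed.

Section Extension.
Variables (E K : diffFieldType) (C : fieldType) (ic : {rmorphism C -> E}).
Hypothesis ic_der : forall c, der (ic c) = 0.
Variable ik : {rmorphism K -> E}.
Hypothesis ik_der : forall a, der (ik a) = ik (der a).
Variables tau tau' : {rmorphism K -> K}.
Hypothesis tauK' : cancel tau' tau.
Hypothesis tau_der : forall a, der (tau a) = tau (der a).
Hypothesis tau_const : forall c, exists2 k, ik k = ic c & tau k = k.
Variables (n : nat) (Y : 'M[E]_n) (A : 'M[K]_n).
Hypothesis derY : map_mx der Y = map_mx ik A *m Y.
Hypothesis derY' : map_mx der Y = map_mx (ik \o tau) A *m Y.
Hypothesis fracY : forall x, exists a b,
  peval ik Y b != 0 /\ x = peval ik Y a / peval ik Y b.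

Variable M : 'M[C]_n.
Hypothesis spM : specialises ic ik (ik \o tau) Y M.

Local Notation evM := (peval (ik \o tau) (Y *m map_mx ic M)).

(** The substitution X -> XM, combined with tau on the coefficients, is
    surjective on K[X] and maps the ideal of relations into itself, so its
    preimages form an increasing sequence, which is stationary; this forces the
    first step to be an equality. *)
Lemma specialisation_injective f : evM f = 0 -> relation ik Y f.
Proof.
have /choice[kc kcP] : forall c, exists k, ik k = ic c /\ tau k = k.
  by move=> c; have [k] := tau_const c; exists k.
pose MK := map_mx kc M.
have ikM : map_mx ik MK = map_mx ic M.
  by apply/matrixP => i j; rewrite !mxE (kcP _).1.
have tauM : map_mx tau MK = MK by apply/matrixP => i j; rewrite !mxE (kcP _).2.
have uM : MK \in unitmx by rewrite -(map_unitmx ik) ikM map_unitmx; case: spM.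
pose phi := twisted_subst tau MK; pose psi := twisted_subst tau' (invmx MK).
have phipsi : cancel psi phi.
  by apply: twisted_substK => //; rewrite map_invmx tauM mulmxV.
have phiE g : peval ik Y (phi g) = evM g by rewrite peval_twisted_subst ikM.
have idI := relation_ideal ik Y.
have up g : relation ik Y g -> relation ik Y (phi g).
  by rewrite {2}/relation phiE; case: spM => _; apply.
pose J k := [set g | relation ik Y (iter k phi g)].
have idJ k : ideal (J k).
  elim: k => [|k ih]; first by case: idI.
  have -> : J k.+1 = phi @^-1` J k.
    by apply/seteqP; split=> g; rewrite /J /preimage /= -iterSr.
  exact: ideal_preim.
have Jmono k l : (k <= l)%N -> J k `<=` J l.
  move=> /subnK <-; elim: (l - k)%N => // j ih g /ih.
  by rewrite /J /= => /up.
have idU : ideal [set g | exists k, J k g].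
  split; first by exists 0%N; apply: ideal0.
    move=> g h [k Jg] [l Jh]; exists (maxn k l); apply: ideal_add => //.
      by apply: Jmono (leq_maxl _ _) _ Jg.
    by apply: Jmono (leq_maxr _ _) _ Jh.
  by move=> a g [k Jg]; exists k; apply: ideal_mul.
have [s sU sgen] := noetherian_mpoly idU.
have [k Jk] : exists k, forall g, g \in s -> J k g.
  elim: s sU {sgen} => [|h s ih] sU; first by exists 0%N.
  have [|k kP] := ih; first by move=> g gs; apply: sU; rewrite inE gs orbT.
  have [l lP] : exists l, J l h by apply: sU; rewrite inE eqxx.
  exists (maxn l k) => g; rewrite inE => /predU1P[->|/kP].
    by apply: Jmono lP; apply: leq_maxl.
  by apply: Jmono; apply: leq_maxr.
move=> f0; have fE : iter k phi (iter k psi f) = f.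
  elim: k {Jk} f {f0} => [|k ih] f; first by [].
  by rewrite [iter _ phi _]iterSr [iter _ psi f]iterS phipsi ih.
have : J k (iter k psi f).
  apply: (sgen _ (idJ k) Jk); exists k.+1.
  by rewrite /J /mkset iterS fE /relation phiE f0.
by rewrite /J /mkset fE.
Qed.

(** By injectivity f(Y) |-> f^tau(YM) is well defined on fractions. It commutes
    with the derivation as YM satisfies the system of Y carried over by tau, and
    is onto as tau is and M is invertible. *)
Lemma specialisation_automorphism : exists sigma sigma' : E -> E,
  [/\ [/\ cancel sigma sigma', cancel sigma' sigma, zmod_morphism sigma &
        GRing.monoid_morphism sigma],
      {morph sigma : x / der x}, forall k, sigma (ik k) = ik (tau k) &
      map_mx sigma Y = Y *m map_mx ic M].
Proof.
have evM0 f : peval ik Y f != 0 -> evM f != 0.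
  by apply: contraNneq => /specialisation_injective/eqP.
have /choice[w wP] : forall x, exists ab,
    peval ik Y ab.2 != 0 /\ x = peval ik Y ab.1 / peval ik Y ab.2.
  by move=> x; have [a [b ab]] := fracY x; exists (a, b).
pose sigma x := evM (w x).1 / evM (w x).2.
have sigmaE a b : peval ik Y b != 0 ->
    sigma (peval ik Y a / peval ik Y b) = evM a / evM b.
  move=> b0; rewrite /sigma; set x := peval ik Y a / _; have [c0 xE] := wP x.
  apply/eqP; rewrite eqr_div ?evM0 //.
  rewrite -!pevalM -subr_eq0 -pevalB.
  apply/eqP/spM.2; rewrite /relation pevalB !pevalM; apply/eqP.
  by rewrite subr_eq0 -eqr_div // -xE.
have sigmaP a : sigma (peval ik Y a) = evM a.
  by rewrite -[peval ik Y a]divr1 -(peval1 ik Y) sigmaE ?peval1 ?oner_eq0 ?divr1.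
have sZ : zmod_morphism sigma.
  move=> x y; have [b0 xE] := wP x; have [d0 yE] := wP y.
  rewrite {1}xE {1}yE -mulNr addf_div // mulNr -!pevalM -pevalB.
  rewrite sigmaE ?pevalM ?mulf_neq0 // pevalB !pevalM.
  by rewrite /sigma -[X in _ = _ + X]mulNr addf_div ?evM0 // mulNr.
have sM : GRing.monoid_morphism sigma.
  split=> [|x y]; first by rewrite -{1}(peval1 ik Y) sigmaP peval1.
  have [b0 xE] := wP x; have [d0 yE] := wP y.
  rewrite {1}xE {1}yE mulf_div -!pevalM sigmaE ?pevalM ?mulf_neq0 //.
  by rewrite /sigma mulf_div.
clearbody sigma.
pose sI := GRing.isZmodMorphism.Build _ _ sigma sZ.
pose sJ := GRing.isMonoidMorphism.Build _ _ sigma sM.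
pose s : {rmorphism E -> E} := HB.pack sigma sI sJ.
have sD : {morph sigma : x y / x + y} := rmorphD s.
have sMul : {morph sigma : x y / x * y} := rmorphM s.
have sk k : sigma (ik k) = ik (tau k) by rewrite -(pevalC ik Y) sigmaP pevalC.
have sY : map_mx sigma Y = Y *m map_mx ic M.
  by apply/matrixP => i j; rewrite mxE -{1}(pevalX ik Y i j) sigmaP pevalX.
have sC c : sigma (ic c) = ic c.
  by have [k <- kk] := tau_const c; rewrite sk kk.
have sder : {morph sigma : x / der x}.
  have poly_der f : sigma (der (peval ik Y f)) = der (sigma (peval ik Y f)).
    move: f; apply: mpoly_closed => [c|k|f g|f g].
    - by rewrite pevalC ik_der !sk ik_der tau_der.
    - have [i [j ->]] := generic_var K k; rewrite pevalX.
      transitivity (map_mx sigma (map_mx der Y) i j); first by rewrite !mxE.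
      transitivity (map_mx der (map_mx sigma Y) i j); last by rewrite !mxE.
      congr (fun_of_matrix _ i j); rewrite sY derY (map_mxM s) /= sY -map_mx_comp.
      have -> : map_mx (sigma \o ik) A = map_mx (ik \o tau) A.
        by apply/matrixP => k' l; rewrite !mxE /= sk.
      rewrite mulmxA -derY'; apply/matrixP => k' l; rewrite !mxE raddf_sum.
      by apply: eq_bigr => h _; rewrite !mxE /= derM ic_der mulr0 addr0.
    - by move=> fE gE; rewrite pevalD !derD !sD /= fE gE derD.
    move=> fE gE; rewrite pevalM derM sD !sMul /= fE gE.
    by rewrite derM.
  move=> x; have [b0 xE] := wP x; set a := _.1 in xE; set b := _.2 in b0 xE.
  have sb : sigma (peval ik Y b) != 0 by rewrite (fmorph_eq0 s).
  have := poly_der a; have -> : peval ik Y a = x * peval ik Y b.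
    by rewrite [X in X * _]xE divfK.
  rewrite derM sD !sMul derM /= poly_der => /addIr.
  by move=> /(mulIf sb).
have sinj : injective sigma by exact: (fmorph_inj s).
have ssurj x : exists y, sigma y = x.
  have [a [b [b0 ->]]] := fracY x.
  suff im f : exists y, sigma y = peval ik Y f.
    have [[y <-] [z <-]] := (im a, im b); exists (y / z); exact: (fmorph_div s).
  move: f; apply: mpoly_closed => [c|k|f g|f g].
  - by exists (ik (tau' c)); rewrite sk tauK' pevalC.
  - have [i [j ->]] := generic_var K k.
    exists ((Y *m map_mx ic (invmx M)) i j); rewrite pevalX.
    transitivity (map_mx sigma (Y *m map_mx ic (invmx M)) i j); first by rewrite !mxE.
    congr (fun_of_matrix _ i j); rewrite (map_mxM s) /= sY -map_mx_comp.
    have -> : map_mx (sigma \o ic) (invmx M) = map_mx ic (invmx M).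
      by apply/matrixP => k' l; rewrite !mxE /= sC.
    by rewrite -mulmxA -map_mxM mulmxV ?map_mx1 ?mulmx1 //; case: spM.
  - by move=> [y yE] [z zE]; exists (y + z); rewrite sD pevalD yE zE.
  by move=> [y yE] [z zE]; exists (y * z); rewrite sMul pevalM yE zE.
have [sigma' sK'] : exists sigma' : E -> E, cancel sigma' sigma.
  by have /choice[s' s'P] := ssurj; exists s'.
have sK : cancel sigma sigma' by move=> x; apply: sinj; rewrite sK'.
by exists sigma, sigma'.
Qed.

End Extension.

(** * Groups of differential automorphisms *)

Section GroupAction.
Variables (E : diffFieldType) (C : fieldType) (ic : {rmorphism C -> E}).
Hypothesis icP : forall x : E, der x = 0 -> exists c, x = ic c.
Hypothesis ic_der : forall c, der (ic c) = 0.
Variables (gT : groupType) (act : gT -> {rmorphism E -> E}).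
Hypothesis act1 : forall x, act 1%g x = x.
Hypothesis actM : forall g h x, act (g * h)%g x = act g (act h x).
Hypothesis act_der : forall g x, act g (der x) = der (act g x).
Hypothesis act_const : forall g c, act g (ic c) = ic c.

Lemma act_iter g i x : act g (iter i der x) = iter i der (act g x).
Proof. by elim: i => //= i ih; rewrite act_der ih. Qed.

Lemma act_map_const g m n (T : 'M[C]_(m, n)) : map_mx (act g) (map_mx ic T) = map_mx ic T.
Proof. by apply/matrixP => i j; rewrite !mxE act_const. Qed.

Lemma der_const_mul c x : der (ic c * x) = ic c * der x.
Proof. by rewrite derM ic_der mul0r add0r. Qed.

(** For the full Galois group, these are the elements that satisfy a linear
    differential equation over the base field. *)
Definition orbit_finite z := exists s, forall g, cspan ic s (act g z).

Lemma orbit_finiteD x y : orbit_finite x -> orbit_finite y -> orbit_finite (x + y).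
Proof.
move=> [s sx] [t ty]; exists (s ++ t) => g; rewrite rmorphD.
apply: (csubspaceD (cspan_csubspace ic (s ++ t))).
  by apply: cspanS (sx g) => a; rewrite mem_cat => ->.
by apply: cspanS (ty g) => a; rewrite mem_cat orbC => ->.
Qed.

Lemma orbit_finiteM x y : orbit_finite x -> orbit_finite y -> orbit_finite (x * y).
Proof.
move=> [s sx] [t ty]; exists [seq a * b | a <- s, b <- t] => g.
by rewrite rmorphM; apply: cspanM.
Qed.

Lemma orbit_finite_der x : orbit_finite x -> orbit_finite (der x).
Proof.
move=> [s sx]; exists (map der s) => g; rewrite act_der.
apply: (sx g [set z | cspan ic (map der s) (der z)]).
  have sp := cspan_csubspace ic (map der s).
  split=> [|a b da db|c a da]; first by rewrite /= raddf0; case: sp.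
    by rewrite /= raddfD; apply: (csubspaceD sp).
  by rewrite /= der_const_mul; apply: (csubspaceZ sp).
by move=> a as_; apply: cspan_mem; apply: map_f.
Qed.

Lemma orbit_finite_fixed x : (forall g, act g x = x) -> orbit_finite x.
Proof. by move=> fx; exists [:: x] => g; rewrite fx; apply: cspan_mem; rewrite inE. Qed.

Lemma orbit_finite_sum (T : Type) (r : seq T) (f : T -> E) :
  (forall t, orbit_finite (f t)) -> orbit_finite (\sum_(t <- r) f t).
Proof.
move=> fin; elim/big_ind: _ => // [|x y]; last exact: orbit_finiteD.
by apply: orbit_finite_fixed => g; rewrite rmorph0.
Qed.

Lemma orbit_finite_prod (T : Type) (r : seq T) (f : T -> E) :
  (forall t, orbit_finite (f t)) -> orbit_finite (\prod_(t <- r) f t).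
Proof.
move=> fin; elim/big_ind: _ => // [|x y]; last exact: orbit_finiteM.
by apply: orbit_finite_fixed => g; rewrite rmorph1.
Qed.

Lemma orbit_finite_det n (A : 'M[E]_n) :
  (forall i j, orbit_finite (A i j)) -> orbit_finite (\det A).
Proof.
move=> fin; apply: orbit_finite_sum => s; apply: orbit_finiteM; last exact: orbit_finite_prod.
by apply: orbit_finite_fixed => g; rewrite rmorph_sign.
Qed.

Lemma iter_der_act n k (b : 'rV[E]_n) g (T : 'M[C]_n) :
  map_mx (act g) b = b *m map_mx ic T ->
  map_mx (act g) (map_mx (iter k der) b) = map_mx (iter k der) b *m map_mx ic T.
Proof.
move=> bT; apply/rowP => j; rewrite !mxE act_iter.
have /rowP/(_ j) := bT; rewrite [LHS]mxE [RHS]mxE => ->.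
under eq_bigr do rewrite mxE; under [RHS]eq_bigr do rewrite !mxE.
elim: k => //= k ->; rewrite raddf_sum; apply: eq_bigr => l _ /=.
by rewrite mulrC der_const_mul mulrC.
Qed.

Lemma wronskian_act n (b : 'rV[E]_n) g (T : 'M[C]_n) :
  map_mx (act g) b = b *m map_mx ic T ->
  map_mx (act g) (wronskian b) = wronskian b *m map_mx ic T.
Proof.
move=> bT; apply/row_matrixP => i; rewrite row_mul -map_row.
have -> : row i (wronskian b) = map_mx (iter i der) b.
  by apply/rowP => j; rewrite !mxE.
exact: iter_der_act.
Qed.

(** The denominators D of x within a stable finite-dimensional space are stable
    under H; the Wronskian determinant of a basis of D is a semi-invariant of H,
    and so is the one where the first row is multiplied by x. *)
Lemma ratio_of_semi_invariants (H : set gT) x a b :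
  (forall h, H h -> act h x = x) ->
  orbit_finite a -> orbit_finite b -> b != 0 -> x = a / b ->
  exists u v, [/\ orbit_finite u, orbit_finite v, v != 0, u = x * v &
    forall h, H h -> exists c, act h v = ic c * v].
Proof.
move=> Hx [s sa] [t tb] b0 xE; pose st := s ++ t.
have sp := cspan_csubspace ic st.
pose S z := forall g, cspan ic st (act g z).
have sS : csubspace ic S.
  split=> [g|y z Sy Sz g|c y Sy g]; rewrite ?rmorph0 ?rmorphD ?rmorphM ?act_const.
  - by case: sp.
  - by apply: (csubspaceD sp); [apply: Sy|apply: Sz].
  - by apply: (csubspaceZ sp); apply: Sy.
have Sfin z : S z -> orbit_finite z by exists st.
have Sact g z : S z -> S (act g z) by move=> Sz k; rewrite -actM.
pose D := [set z | S z /\ S (z * x)].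
have Db : D b.
  split=> g; first by apply: cspanS (tb g) => z; rewrite mem_cat orbC => ->.
  by rewrite xE mulrC divfK //; apply: cspanS (sa g) => z; rewrite mem_cat => ->.
have Dst : D `<=` cspan ic st by move=> z [/(_ 1%g)]; rewrite act1.
have DH h z : H h -> D z -> D (act h z).
  move=> Hh [Sz Szx]; split; first exact: Sact.
  by rewrite -[X in _ * X](Hx h) // -rmorphM; apply: Sact.
have [r [e [ind eD De]]] := basis_exists Dst.
have r0 : (0 < r)%N.
  rewrite lt0n; apply/eqP => r0; have [c bE] := De _ Db.
  move: b0; rewrite bE mxE big1 ?eqxx // => i _; exfalso.
  by case: i => k; rewrite r0.
have unitW := wronskian_unit icP ind.
pose i0 := Ordinal r0.
pose d : 'rV[E]_r := \row_i (if i == i0 then x else 1).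
exists (\det (diag_mx d *m wronskian e)), (\det (wronskian e)); split.
- apply: orbit_finite_det => i j; rewrite mul_diag_mx !mxE.
  have [->|_] := eqVneq i i0.
    by rewrite mulrC /=; apply: Sfin; apply: (eD j).2.
  rewrite mul1r; elim: (nat_of_ord i) => [|k ih] /=; first exact: Sfin (eD j).1.
  exact: orbit_finite_der.
- apply: orbit_finite_det => i j; rewrite !mxE.
  elim: (nat_of_ord i) => [|k ih] /=; first exact: Sfin (eD j).1.
  exact: orbit_finite_der.
- by rewrite -unitfE -unitmxE.
- rewrite det_mulmx det_diag (bigD1 i0) //= mxE eqxx big1 ?mulr1 // => i /negPf ii0.
  by rewrite mxE ii0.
move=> h Hh; have [|T eT] := @rspan_matrix _ _ ic _ _ e (map_mx (act h) e).
  by move=> j; rewrite mxE; apply: De; apply: DH.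
exists (\det T); rewrite -det_map_mx (wronskian_act eT) det_mulmx mulrC.
by rewrite det_map_mx.
Qed.

(** Let b be a basis of the span of the orbits of u and v, made of elements of
    these orbits, so of semi-invariants of the normal subgroup H, and W its
    Wronskian matrix. The entries of the matrices WXW^-1, for X constant, span a
    finite-dimensional stable space; those fixed by H separate u/v, as shown by
    the matrices X sending v to u or v and the rest of the basis to 0. *)
Lemma normal_invariants (G H : set gT) u v :
  (forall g, G g -> G g^-1%g) -> (forall g h, G g -> H h -> H (h ^ g)%g) ->
  (forall g k, G g -> G k -> G (g * k)%g) -> G 1%g ->
  orbit_finite u -> orbit_finite v -> v != 0 ->
  (forall h, H h -> exists c, act h v = ic c * v /\ act h u = ic c * u) ->
  exists T : set E, [/\ exists s, T `<=` cspan ic s,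
    forall g z, G g -> T z -> T (act g z),
    forall h z, H h -> T z -> act h z = z &
    forall sigma : {rmorphism E -> E}, (forall c, sigma (ic c) = ic c) ->
      (forall z, T z -> sigma z = z) -> sigma (u / v) = u / v].
Proof.
move=> GV HG GM G1 [s su] [t tv] v0 Huv; pose st := s ++ t.
have [[c uE]|dep] := pselect (exists c, u = ic c * v).
  exists set0; split=> //; first by exists [::].
  by move=> sigma sc _; rewrite uE mulfK // sc.
pose T0 := [set z | exists2 g, G g & z = act g u \/ z = act g v].
have T0st : T0 `<=` cspan ic st.
  move=> _ [g Gg [->|->]]; first by apply: cspanS (su g) => a; rewrite mem_cat => ->.
  by apply: cspanS (tv g) => a; rewrite mem_cat orbC => ->.
have T0act g z : G g -> T0 z -> T0 (act g z).
  move=> Gg [k Gk zE]; exists (g * k)%g; first exact: GM.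
  by case: zE => ->; [left|right]; rewrite actM.
pose b0 : 'rV[E]_(1 + 1) := row_mx (\row_(j < 1) v) (\row_(j < 1) u).
have ind0 : independent ic b0.
  apply: independent_extend => [c /matrixP/(_ 0 0)|[c uE]].
    rewrite [LHS]mxE big_ord1 !mxE => /eqP; rewrite mulf_eq0 (negPf v0) fmorph_eq0.
    by move=> /eqP c0; apply/matrixP => i j; rewrite !ord1 c0 mxE.
  by apply: dep; exists (c 0 0); rewrite uE mxE big_ord1 !mxE mulrC.
have T0b0 j : T0 (b0 0 j).
  by exists 1%g => //; rewrite !act1 /b0; case: (split_ordP j) => k ->;
    rewrite ?row_mxEl ?row_mxEr mxE; [right|left].
have [N [b [ind bT0 T0b b0b]]] := basis_extend T0st ind0 T0b0.
have [iv bv] : exists i, b 0 i = v.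
  by have [k kE] := b0b (lshift 1 0); exists k; rewrite kE row_mxEl mxE.
have [iu bu] : exists i, b 0 i = u.
  by have [k kE] := b0b (rshift 1 0); exists k; rewrite kE row_mxEr mxE.
have eigen h z : H h -> T0 z -> exists c, act h z = ic c * z.
  move=> Hh [g Gg zE]; have [c [cv cu]] := Huv _ (HG _ _ Gg Hh).
  have actJ y : act h (act g y) = act g (act (h ^ g)%g y).
    by rewrite -!actM conjgE !mulgA mulgV mul1g.
  by exists c; case: zE => ->; rewrite actJ ?cv ?cu rmorphM act_const.
set W := wronskian b; have unitW : W \in unitmx := wronskian_unit icP ind.
pose Wm X := W *m map_mx ic X *m invmx W.
pose T := [set z | exists X i j, z = Wm X i j /\
  forall h, H h -> map_mx (act h) (Wm X) = Wm X].
have actb g : G g -> exists A, map_mx (act g) W = W *m map_mx ic A.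
  move=> Gg; have [|A bA] := @rspan_matrix _ _ ic _ _ b (map_mx (act g) b).
    by move=> j; rewrite mxE; apply: T0b; apply: T0act.
  by exists A; apply: wronskian_act.
have conjW g A X : map_mx (act g) W = W *m map_mx ic A ->
    A \in unitmx /\ map_mx (act g) (Wm X) = Wm (A *m X *m invmx A).
  move=> WA; have uA : A \in unitmx.
    have : W *m map_mx ic A \in unitmx by rewrite -WA map_unitmx.
    by rewrite unitmx_mul map_unitmx => /andP[].
  split=> //; rewrite /Wm !map_mxM map_invmx WA act_map_const.
  have -> : invmx (W *m map_mx ic A) = map_mx ic (invmx A) *m invmx W.
    have uWA : W *m map_mx ic A \in unitmx by rewrite unitmx_mul unitW map_unitmx.
    apply: (can_inj (mulKmx uWA)); rewrite mulmxV // -!mulmxA (mulmxA (map_mx ic A)).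
    by rewrite -map_mxM mulmxV // map_mx1 mul1mx mulmxV.
  by rewrite !mulmxA.
exists T; split.
- exists [seq W ai.1 ai.2 * invmx W jb.1 jb.2 | ai <- enum {: 'I_N * 'I_N},
    jb <- enum {: 'I_N * 'I_N}] => _ [X [i [j [-> _]]]].
  have sp := cspan_csubspace ic.
  rewrite /Wm mxE; apply: (csubspace_sum _ (sp _)) => k.
  rewrite mxE mulr_suml; apply: (csubspace_sum _ (sp _)) => l.
  rewrite [map_mx ic X _ _]mxE mulrAC mulrC; apply: (csubspaceZ (sp _)).
  apply: cspan_mem; apply/allpairsP; exists ((i, l), (k, j)).
  by rewrite !mem_enum.
- move=> g _ Gg [X [i [j [-> Xfix]]]]; have [A WA] := actb _ Gg.
  have [uA WX] := conjW _ _ X WA.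
  exists (A *m X *m invmx A), i, j; rewrite -WX; split=> [|h Hh].
    by rewrite [RHS]mxE.
  have -> : map_mx (act h) (map_mx (act g) (Wm X)) =
      map_mx (act g) (map_mx (act (h ^ g)%g) (Wm X)).
    rewrite -!map_mx_comp; apply: eq_map_mx => z /=.
    by rewrite -!actM conjgE !mulgA mulgV mul1g.
  by rewrite Xfix //; apply: HG.
- move=> h _ Hh [X [i [j [-> Xfix]]]].
  by have := Xfix h Hh; move=> /matrixP/(_ i j); rewrite [LHS]mxE.
move=> sigma _ sT; have N0 : (0 < N)%N := leq_ltn_trans (leq0n _) (ltn_ord iv).
pose i0 := Ordinal N0.
have TE i j : b 0 i = u \/ b 0 i = v -> T (b 0 i * invmx W iv j).
  move=> iuv; exists (delta_mx i iv), i0, j; split.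
    rewrite /Wm map_delta_mx -(mul_delta_mx (0 : 'I_1)) mulmxA -colE -mulmxA -rowE.
    by rewrite mxE big_ord1 !mxE.
  move=> h Hh; have /choice[d dE] : forall k, exists c, act h (b 0 k) = ic c * b 0 k.
    by move=> k; apply: eigen.
  have div : d i = d iv.
    have [c [cv cu]] := Huv _ Hh.
    have u0 : u != 0 by apply: contra_not_neq dep => ->; exists 0; rewrite rmorph0 mul0r.
    have eqd k z : z != 0 -> b 0 k = z -> act h z = ic c * z -> d k = c.
      move=> z0 bk hz; apply: (fmorph_inj ic); apply: (mulIf z0).
      by rewrite -hz -bk dE.
    by rewrite (eqd iv v) //; case: iuv => bi; [exact: eqd bi cu|exact: eqd bi cv].
  have WD : map_mx (act h) W = W *m map_mx ic (diag_mx (\row_k d k)).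
    apply: wronskian_act; rewrite map_diag_mx mul_mx_diag.
    by apply/matrixP => k l; rewrite !mxE ord1 dE mulrC.
  have [uD ->] := conjW _ _ (delta_mx i iv) WD; congr Wm.
  suff -> : diag_mx (\row_k d k) *m delta_mx i iv = delta_mx i iv *m diag_mx (\row_k d k).
    by rewrite mulmxK.
  apply/matrixP => k l; rewrite mul_diag_mx mul_mx_diag !mxE.
  by have [->|] := eqVneq k i; have [->|] := eqVneq l iv; rewrite ?mulr0 ?mul0r // div mulrC.
have [j jne] : exists j, invmx W iv j != 0.
  apply: contrapT => no; have : (invmx W *m W) iv iv = 0.
    rewrite mxE big1 // => j _; rewrite (_ : invmx W iv j = 0) ?mul0r //.
    by apply/eqP; apply: contra_notT no => ?; exists j.
  by rewrite mulVmx // mxE eqxx => /eqP; rewrite oner_eq0.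
have Tu := TE iu j (or_introl bu); have Tv := TE iv j (or_intror bv).
move: Tu Tv; rewrite bu bv => Tu Tv.
have -> : u / v = (u * invmx W iv j) / (v * invmx W iv j) by rewrite -mulf_div divff ?mulr1.
by rewrite fmorph_div !sT.
Qed.

End GroupAction.

(** ** Closed subgroups *)

Section ClosedSubgroup.
Variables (E : fieldType) (C : fieldType) (ic : {rmorphism C -> E}).
Variables (gT : groupType) (act : gT -> {rmorphism E -> E}).
Hypothesis actM : forall g h x, act (g * h)%g x = act g (act h x).
Variables (n : nat) (Y : 'M[E]_n).
Hypothesis unitY : Y \in unitmx.
Hypothesis actY : forall g, exists A : 'M[C]_n, map_mx (act g) Y = Y *m map_mx ic A.
Variables (H : set gT) (P : set {mpoly C[n * n]}).
Hypothesis H1 : H 1%g.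
Hypothesis HM : forall g h, H g -> H h -> H (g * h)%g.
Hypothesis HV : forall g, H g -> H g^-1%g.
Hypothesis HP : forall g A, map_mx (act g) Y = Y *m map_mx ic A ->
  (H g <-> forall p, P p -> peval idfun A p = 0).

Local Notation tw g := (map_mpoly (act g)).

Lemma map_act g h m k (A : 'M[E]_(m, k)) :
  map_mx (act g) (map_mx (act h) A) = map_mx (act (g * h)%g) A.
Proof. by apply/matrixP => i j; rewrite !mxE actM. Qed.

Lemma peval_act g X (u : {mpoly E[n * n]}) :
  peval idfun (map_mx (act g) X) (tw g u) = act g (peval idfun X u).
Proof.
rewrite peval_comp.
apply: (@peval_ext _ _ _ (peval idfun _ \o tw g) (peval (act g \o idfun) _)) => [c|i j] /=.
  by rewrite map_mpolyC !pevalC.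
transitivity (peval idfun (map_mx (act g) X) (generic_mx E n i j)).
  by congr peval; rewrite !mxE map_mpolyX.
by rewrite !pevalX.
Qed.

Lemma peval_translate (X : 'M[E]_n) p :
  peval idfun X
    (peval (@mpolyC _ E \o ic) (map_mx (@mpolyC _ E) (invmx Y) *m generic_mx E n) p) =
  peval ic (invmx Y *m X) p.
Proof.
rewrite peval_comp map_mxM map_generic -map_mx_comp.
have -> : map_mx (peval idfun X \o @mpolyC (n * n) E) (invmx Y) = invmx Y.
  by apply/matrixP => i j; rewrite !mxE /= pevalC.
apply: (@peval_ext _ _ _ (peval (peval idfun X \o (@mpolyC _ E \o ic)) _) (peval ic _))
  => [c|i j] /=.
  by rewrite !pevalC /= pevalC.
by rewrite !pevalX.
Qed.

(** The polynomials vanishing on the translate YH of H span a space U, whose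
    stabiliser in the whole group is H. By descent this space is spanned by
    polynomials with coefficients fixed by H, and as H is defined by finitely
    many equations, finitely many of these coefficients matter. *)
Lemma closed_subgroup_fixer : exists2 xs : seq E,
  forall x h, x \in xs -> H h -> act h x = x &
  forall g, (forall x, x \in xs -> act g x = x) -> H g.
Proof.
pose U := [set u : {mpoly E[n * n]} |
  forall h, H h -> peval idfun (map_mx (act h) Y) u = 0].
have sU : subspace U.
  split=> [h _|u v Uu Uv h Hh|e u Uu h Hh]; first exact: rmorph0.
    by rewrite pevalD Uu // Uv // addr0.
  by rewrite pevalZ Uu // mulr0.
have twU k u : H k -> U u -> U (tw k u).
  move=> Hk Uu h Hh; rewrite -[h](mulVKg k) -map_act peval_act Uu ?rmorph0 //.
  by apply: HM => //; apply: HV.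
pose theta (k : {k | H k}) : {additive E -> E} := act (sval k) \- idfun.
have theta1 k : theta k 1 = 0 by rewrite /theta /= rmorph1 subrr.
have thetaE k u : map_mpoly (theta k) u = tw (sval k) u - u.
  by apply/mpolyP => m; rewrite mcoeffB !mcoeff_map_mpoly.
pose fixes (xs : seq E) g := forall x, x \in xs -> act g x = x.
pose V := [set u : {mpoly E[n * n]} | exists xs : seq E,
  (forall x h, x \in xs -> H h -> act h x = x) /\ forall g, fixes xs g -> U (tw g u)].
have UV : U `<=` V.
  apply: (@descent _ _ _ theta U theta1 sU) => [[k Hk] u Uu||v Uv vfix].
  - by rewrite thetaE; apply: (subspaceB sU) => //; apply: twU.
  - split.
    + by exists [::]; split=> // g _; rewrite rmorph0; case: sU.
    + move=> u v [xs [xsH xsU]] [ys [ysH ysU]]; exists (xs ++ ys); split.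
        by move=> x h; rewrite mem_cat => /orP[/xsH|/ysH]; apply.
      move=> g fg; rewrite rmorphD; apply: (subspaceD sU).
        by apply: xsU => x xx; apply: fg; rewrite mem_cat xx.
      by apply: ysU => x xx; apply: fg; rewrite mem_cat xx orbT.
    move=> e u [xs [xsH xsU]]; exists xs; split=> // g fg.
    by rewrite map_mpolyZ; apply: (subspaceZ sU); apply: xsU.
  have vE k m : H k -> act k v@_m = v@_m.
    by move=> Hk; apply/eqP; rewrite -subr_eq0; apply/eqP; apply: (vfix (exist _ k Hk)).
  exists [seq v@_m | m <- msupp v]; split=> [_ h /mapP[m _ ->]|g fg]; first exact: vE.
  suff -> : tw g v = v by [].
  apply/mpolyP => m; rewrite mcoeff_map_mpoly.
  have [mv|mv] := boolP (m \in msupp v); first by apply: fg; apply: map_f.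
  by rewrite (memN_msupp_eq0 mv); apply: rmorph0.
pose I := [set p : {mpoly C[n * n]} | forall h A, H h ->
  map_mx (act h) Y = Y *m map_mx ic A -> peval idfun A p = 0].
have idA A : ideal [set p : {mpoly C[n * n]} | peval idfun A p = 0].
  split; first exact: rmorph0.
    by move=> p q; rewrite /= pevalD => -> ->; rewrite addr0.
  by move=> p q; rewrite /= pevalM => ->; rewrite mulr0.
have idI : ideal I.
  split=> [h A _ _|p q Ip Iq h A Hh hA|a p Ip h A Hh hA]; first exact: rmorph0.
    by rewrite pevalD (Ip h) // (Iq h) // addr0.
  by rewrite pevalM (Ip h) // mulr0.
have [s sI sgen] := noetherian_mpoly idI.
pose tr p := peval (@mpolyC _ E \o ic)
  (map_mx (@mpolyC _ E) (invmx Y) *m generic_mx E n) p.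
have trE g A p : map_mx (act g) Y = Y *m map_mx ic A ->
    peval idfun (map_mx (act g) Y) (tr p) = ic (peval idfun A p).
  by move=> ->; rewrite /tr peval_translate mulmxA mulVmx // mul1mx peval_const.
have [xs [xsH xsU]] : exists xs : seq E,
    (forall x h, x \in xs -> H h -> act h x = x) /\
    forall p g, p \in s -> fixes xs g -> U (tw g (tr p)).
  elim: s sI {sgen} => [|p s ih] sI; first by exists [::].
  have [|xs [xsH xsU]] := ih; first by move=> q qs; apply: sI; rewrite inE qs orbT.
  have [ys [ysH ysU]] : V (tr p).
    apply: UV => h Hh; have [A hA] := actY h; rewrite (trE _ A) //.
    by rewrite (sI p _ h) ?rmorph0 // inE eqxx.
  exists (ys ++ xs); split.
    by move=> x h; rewrite mem_cat => /orP[/ysH|/xsH]; apply.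
  move=> q g; rewrite inE => /predU1P[->|qs] fg.
    by apply: ysU => x xx; apply: fg; rewrite mem_cat xx.
  by apply: xsU => // x xx; apply: fg; rewrite mem_cat xx orbT.
exists xs => // g fg; rewrite -(invgK g); apply: HV.
have [A gA] := actY g^-1%g; apply/(HP gA) => p Pp.
have : I p by move=> h B Hh hB; apply: (HP hB).1.
apply: (sgen _ (idA A)) => q qs /=; have := xsU q g qs fg 1%g H1.
rewrite -{1}(mulgV g) -map_act peval_act (trE _ A) // => /eqP.
by rewrite !fmorph_eq0 => /eqP.
Qed.

End ClosedSubgroup.

(** * Differential subfields and their Galois groups *)

Section Inclusion.
Variables (F : diffFieldType) (K K' : diffSubfield F).

Definition dsub_incl (sKK' : {subset K <= K'}) (x : dsub K) : dsub K' :=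
  Dsub (sKK' _ (dsub_valP x)).

Variable sKK' : {subset K <= K'}.

Fact dsub_incl_zmod : zmod_morphism (dsub_incl sKK').
Proof. by move=> x y; apply: val_inj. Qed.
Fact dsub_incl_monoid : GRing.monoid_morphism (dsub_incl sKK').
Proof. by split=> [|x y]; apply: val_inj. Qed.
HB.instance Definition _ := GRing.isZmodMorphism.Build _ _ (dsub_incl sKK') dsub_incl_zmod.
HB.instance Definition _ := GRing.isMonoidMorphism.Build _ _ (dsub_incl sKK') dsub_incl_monoid.

Lemma dsub_incl_der x : der (dsub_incl sKK' x) = dsub_incl sKK' (der x).
Proof. exact: val_inj. Qed.

End Inclusion.

Section GaloisElements.
Variables (F : diffFieldType) (E B : diffSubfield F).

HB.instance Definition _ (s : 'DGal(E / B)) :=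
  GRing.isZmodMorphism.Build _ _ (gal_fun s) (gal_zmod s).
HB.instance Definition _ (s : 'DGal(E / B)) :=
  GRing.isMonoidMorphism.Build _ _ (gal_fun s) (gal_monoid s).

Definition gal_act (s : 'DGal(E / B)) : {rmorphism dsub E -> dsub E} := gal_fun s.

Definition gal_lower (K : diffSubfield F) (sBK : {subset B <= K}) (s : 'DGal(E / K)) :
    'DGal(E / B) :=
  @DiffGal F E B (gal_fun s) (gal_inv s) (@gal_funK _ _ _ s) (@gal_invK _ _ _ s)
    (gal_zmod s) (gal_monoid s) (gal_der s)
    (fun x xB => gal_fix s (sBK _ xB)).

Definition gal_raise (K : diffSubfield F) (s : 'DGal(E / B))
    (sK : forall x : dsub E, val x \in K -> gal_fun s x = x) : 'DGal(E / K) :=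
  @DiffGal F E K (gal_fun s) (gal_inv s) (@gal_funK _ _ _ s) (@gal_invK _ _ _ s)
    (gal_zmod s) (gal_monoid s) (gal_der s) sK.

End GaloisElements.

(** ** Fields of fixed elements and generated fields *)

Section FixedField.
Variables (F : diffFieldType) (E B : diffSubfield F) (H : set 'DGal(E / B)).

Definition fixfield : {pred F} :=
  [pred x | `[< exists z : dsub E, val z = x /\ forall h, H h -> gal_fun h z = z >]].

Lemma fixfieldP (z : dsub E) :
  (val z \in fixfield) <-> (forall h, H h -> gal_fun h z = z).
Proof.
split=> [/asboolP[t [/val_inj <-]]//|fz]; apply/asboolP; by exists z.
Qed.

Lemma fixfield_sub : {subset fixfield <= E}.
Proof. by move=> _ /asboolP[z [<- _]]; apply: valP. Qed.

Fact fixfield_divring : divring_closed fixfield.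
Proof.
split=> [|x y|x y].
- by apply/asboolP; exists 1; split=> // h _; rewrite rmorph1.
- move=> /asboolP[a [<- fa]] /asboolP[b [<- fb]]; apply/asboolP; exists (a - b).
  by split=> // h Hh; rewrite rmorphB /= fa ?fb.
move=> /asboolP[a [<- fa]] /asboolP[b [<- fb]]; apply/asboolP; exists (a / b).
by split=> [|h Hh]; [rewrite fmorph_div|rewrite fmorph_div /= fa ?fb].
Qed.

Fact fixfield_der : {in fixfield, forall x, der x \in fixfield}.
Proof.
move=> _ /asboolP[a [<- fa]]; apply/asboolP; exists (der a); split=> // h Hh.
by rewrite gal_der fa.
Qed.

HB.instance Definition _ := GRing.isDivringClosed.Build F fixfield fixfield_divring.
HB.instance Definition _ := isDerClosed.Build F fixfield fixfield_der.

End FixedField.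

Section GeneratedField.
Variables (F : diffFieldType) (B : diffSubfield F) (U : set F).

Definition genfield : {pred F} := [pred x | `[< diff_formula B U x >]].

Fact genfield_divring : divring_closed genfield.
Proof.
split=> [|x y|x y].
- by apply/asboolP; apply: DFconst; apply: rpred1.
- by move=> /asboolP ux /asboolP uy; apply/asboolP; apply: DFadd => //; apply: DFopp.
move=> /asboolP ux /asboolP uy; apply/asboolP; have [->|y0] := eqVneq y 0.
  by rewrite invr0 mulr0; apply: DFconst; apply: rpred0.
by apply: DFmul => //; apply: DFinv.
Qed.

Fact genfield_der : {in genfield, forall x, der x \in genfield}.
Proof. by move=> x /asboolP ux; apply/asboolP; apply: DFder. Qed.

HB.instance Definition _ := GRing.isDivringClosed.Build F genfield genfield_divring.
HB.instance Definition _ := isDerClosed.Build F genfield genfield_der.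

Lemma genfield_min (K : diffSubfield F) :
  {subset B <= K} -> (forall u, U u -> u \in K) -> {subset genfield <= K}.
Proof.
move=> sBK sUK x /asboolP.
elim=> {x} [b /sBK|u /sUK|x y _ xK _ yK|x _ xK|x y _ xK _ yK|x _ xK _|x _ xK] //.
- exact: rpredD.
- by rewrite rpredN.
- exact: rpredM.
- by rewrite rpredV.
exact: der_closed.
Qed.

Lemma genfield_base : {subset B <= genfield}.
Proof. by move=> b Bb; apply/asboolP; apply: DFconst. Qed.

Lemma genfield_gen u : U u -> u \in genfield.
Proof. by move=> Uu; apply/asboolP; apply: DFgen. Qed.

End GeneratedField.

(** ** Solutions of a linear differential equation *)

Lemma size_diff_order (F : diffFieldType) (L : {poly F}) :
  (0 < diff_order L)%N -> size L = (diff_order L).+1.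
Proof. by rewrite /diff_order; case: (size L). Qed.

Lemma diffopE (F : diffFieldType) (L : {poly F}) x : (0 < diff_order L)%N ->
  diffop L x = \sum_(i < diff_order L + 1) L`_i * iter i der x.
Proof. by move=> L_gt0; rewrite addn1 -size_diff_order. Qed.

Lemma iter_der_val (F : diffFieldType) (K : diffSubfield F) i (x : dsub K) :
  val (iter i der x) = iter i der (val x).
Proof. by elim: i => //= i <-. Qed.

Section Constants.
Variables (F : diffFieldType) (E : diffSubfield F).

Lemma constants_sub : {subset constants E <= E}.
Proof. by move=> x /andP[]. Qed.

Definition const_incl : {rmorphism dsub (constants E) -> dsub E} := dsub_incl constants_sub.

Lemma const_inclP (x : dsub E) : der x = 0 -> exists c, x = const_incl c.
Proof.
move=> dx; have xc : val x \in constants E.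
  by rewrite inE (valP x) /= -[der _]/(val (der x)) dx eqxx.
by exists (Dsub xc); apply: val_inj.
Qed.

Lemma const_incl_der c : der (const_incl c) = 0.
Proof. by apply: val_inj; have /andP[_ /eqP] := valP c. Qed.

Variable L : {poly F}.
Hypothesis L_gt0 : (0 < diff_order L)%N.

Lemma fundamental_independent (y : 'rV[dsub E]_(diff_order L)) :
  fundamental_system y -> independent const_incl y.
Proof.
move=> [_ indy] c yc; apply: indy.
have /matrixP/(_ 0 0)/(congr1 val) := yc.
rewrite !mxE raddf_sum => e; rewrite -[RHS]e; apply: eq_bigr => j _.
by rewrite mxE /= mulrC.
Qed.

(** Were z independent of a fundamental system y, the Wronskian matrix of (y, z)
    would be invertible, while L gives a relation between its rows. *)
Lemma solution_span (y : 'rV[dsub E]_(diff_order L)) (z : dsub E) :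
  independent const_incl y -> (forall j, diffop L (val (y 0 j)) = 0) ->
  diffop L (val z) = 0 -> rspan const_incl y z.
Proof.
move=> indy soly solz; apply: contrapT => yz.
have ind := independent_extend indy yz.
have := wronskian_unit (@const_inclP) ind; set W := wronskian _ => unitW.
have : map_mx val W \in unitmx by rewrite map_unitmx.
pose l : 'rV[F]_(diff_order L + 1) := \row_i L`_i.
have lW : l *m map_mx val W = 0.
  apply/rowP => j; rewrite [RHS]mxE mxE.
  have : diffop L (val (row_mx y (\row_(j < 1) z) 0 j)) = 0.
    by case: (split_ordP j) => k ->; rewrite ?row_mxEl ?row_mxEr ?mxE.
  rewrite diffopE // => e; rewrite -[RHS]e.
  by apply: eq_bigr => i _; rewrite !mxE iter_der_val.
move=> uW; have : l = 0 by rewrite -(mulmxK uW l) lW mul0mx.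
have lt : (diff_order L < diff_order L + 1)%N by rewrite addn1.
move=> /rowP/(_ (Ordinal lt)); rewrite !mxE /= => /eqP.
rewrite /diff_order -lead_coefE lead_coef_eq0 => /eqP L0.
by move: L_gt0; rewrite L0 /diff_order size_poly0.
Qed.

End Constants.

(** * The fundamental theorem of Picard-Vessiot theory *)

Section PicardVessiot.
Variables (F : diffFieldType) (B E : diffSubfield F) (L : {poly F}).
Hypothesis closedC : GRing.closed_field_axiom (dsub (constants E)).
Hypothesis pvL : picard_vessiot B E L.

Local Notation n := (diff_order L).
Local Notation ic := (const_incl E).
Let sBE : {subset B <= E} := pv_sub pvL.

Lemma pv_gt0 : (0 < n)%N. Proof. by case: (pv_equation pvL). Qed.

Lemma constants_base : {subset constants E <= B}.
Proof. by move=> x; rewrite (pv_constants pvL) => /andP[]. Qed.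

Fact coef_in_base k : L`_k \in B.
Proof. by have [/polyOverP] := pv_equation pvL. Qed.

Let l k : dsub B := Dsub (coef_in_base k).

Definition companion : 'M[dsub B]_n :=
  \matrix_(i, k) if i.+1 == n then - (l k / l n) else (k == i.+1 :> nat)%:R.

Lemma der_wronskian (y : 'rV[dsub E]_n) :
  (forall j, diffop L (val (y 0 j)) = 0) ->
  map_mx der (wronskian y) = map_mx (dsub_incl sBE) companion *m wronskian y.
Proof.
move=> soly; apply/matrixP => i j; rewrite [LHS]mxE [wronskian y i j]mxE [RHS]mxE.
have entry k : map_mx (dsub_incl sBE) companion i k =
    dsub_incl sBE (if i.+1 == n then - (l k / l n) else (k == i.+1 :> nat)%:R).
  by rewrite !mxE.
under eq_bigr do rewrite entry [wronskian _ _ _]mxE.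
case: eqP => [ie|/eqP ine]; last first.
  have iS : (i.+1 < n)%N by rewrite ltn_neqAle ine ltn_ord.
  rewrite (bigD1 (Ordinal iS)) //= eqxx rmorph1 mul1r big1 ?addr0 // => k ki.
  by rewrite -val_eqE /= in ki; rewrite (negPf ki) rmorph0 mul0r.
have ln0 : L`_n != 0.
  rewrite /diff_order -lead_coefE lead_coef_eq0; apply: contraTneq pv_gt0 => ->.
  by rewrite /diff_order size_poly0.
rewrite -iterS ie; apply: val_inj; apply: (mulfI ln0).
have := soly j; rewrite diffopE ?pv_gt0 // addn1 big_ord_recr /= => /eqP.
rewrite addrC addr_eq0 => /eqP; rewrite -iter_der_val => ->.
rewrite -[X in _ = _ * X]/(\val _) [X in _ = _ * X]raddf_sum mulr_sumr -sumrN.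
apply: eq_bigr => k _.
have lE : \val (- (l k / l n)) = - (L`_k / L`_n) by rewrite rmorphN fmorph_div.
rewrite -[X in _ = _ * X]/(\val (- (l k / l n)) * \val (iter k der (y 0 j))) lE.
by rewrite iter_der_val mulrA mulrN mulrCA divff // mulr1 mulNr.
Qed.

Section FundamentalMatrix.
Variable y : 'rV[dsub E]_n.
Hypothesis fundy : fundamental_system y.

Local Notation Y := (wronskian y).

Let soly j : diffop L (val (y 0 j)) = 0.
Proof. by case: fundy => /(_ j)[]. Qed.

Lemma fundamental_unit : Y \in unitmx.
Proof. exact: (wronskian_unit (@const_inclP _ E) (fundamental_independent fundy)). Qed.

Lemma wronskian_first j : Y (Ordinal pv_gt0) j = y 0 j.
Proof. by rewrite mxE. Qed.

(** Every element of E is a rational function over B of the entries of Y, as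
    these functions form a differential field. *)
Lemma wronskian_fractions (x : dsub E) : exists a b,
  peval (dsub_incl sBE) Y b != 0 /\ x = peval (dsub_incl sBE) Y a / peval (dsub_incl sBE) Y b.
Proof.
pose pe := peval (dsub_incl sBE) Y.
have peM : {morph pe : p q / p * q} := pevalM (dsub_incl sBE) Y.
have peD : {morph pe : p q / p + q} := pevalD (dsub_incl sBE) Y.
have pe1 : pe 1 = 1 := peval1 (dsub_incl sBE) Y.
have peC c : pe c%:MP = dsub_incl sBE c := pevalC (dsub_incl sBE) Y c.
have peX i j : pe (generic_mx (dsub B) n i j) = Y i j := pevalX (dsub_incl sBE) Y i j.
pose Q z := exists a b, pe b != 0 /\ z = pe a / pe b.
have Qpoly a : Q (pe a).
  by exists a, 1; rewrite pe1 oner_eq0 divr1.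
have QD z t : Q z -> Q t -> Q (z + t).
  move=> [a [b [b0 ->]]] [c [d [d0 ->]]]; exists (a * d + c * b), (b * d).
  rewrite peD !peM (addf_div _ _ b0 d0); split=> //; exact: mulf_neq0 b0 d0.
have QM z t : Q z -> Q t -> Q (z * t).
  move=> [a [b [b0 ->]]] [c [d [d0 ->]]]; exists (a * c), (b * d).
  rewrite !peM mulf_div; split=> //; exact: mulf_neq0 b0 d0.
have QV z : Q z -> z != 0 -> Q z^-1.
  move=> [a [b [b0 ->]]] ab0; exists b, a; rewrite invf_div; split; last by [].
  by move: ab0; rewrite mulf_eq0 negb_or => /andP[].
have QC c : Q (dsub_incl sBE c) by rewrite -peC; apply: Qpoly.
have Qder z : Q z -> Q (der z).
  have Qderp a : Q (der (pe a)).
    have [q qP] := der_peval companion a.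
    have -> : der (pe a) = pe q; last exact: Qpoly.
    exact: (qP _ (@der (dsub E)) (dsub_incl sBE) Y (@derM (dsub E))
      (dsub_incl_der sBE) (der_wronskian soly)).
  move=> [a [b [b0 ->]]].
  have -> : der (pe a / pe b) = (der (pe a) - pe a / pe b * der (pe b)) * (pe b)^-1.
    apply: (mulIf b0); rewrite mulfVK //; apply: (canRL (addrK _)).
    by rewrite -derM divfK.
  apply: (QM); last by apply: QV.
  apply: QD => //; rewrite -mulN1r; apply: (QM).
    have -> : -1 = dsub_incl sBE (-1) by rewrite rmorphN1.
    exact: QC.
  by apply: QM => //; exists a, b.
have Qy j : Q (y 0 j).
  by rewrite -wronskian_first -peX; apply: Qpoly.
have [y0 [soly0 _] gen] := pv_generated pvL.
suff QE u : diff_formula B [set val (y0 0 j) | j in setT] u ->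
    exists2 z : dsub E, val z = u & Q z.
  by have [z /val_inj <-] := QE _ (gen _ (valP x)).
elim=> {u} [b bB|_ [j _ <-]|_ _ _ [z <- Qz] _ [t <- Qt]|_ _ [z <- Qz]
  |_ _ _ [z <- Qz] _ [t <- Qt]|_ _ [z <- Qz]|_ _ [z <- Qz]].
- by exists (dsub_incl sBE (Dsub bB)) => //; apply: QC.
- exists (y0 0 j) => //; have [_ sol0] := soly0 j.
  have [c ->] := solution_span pv_gt0 (fundamental_independent fundy) soly sol0.
  rewrite mxE; elim/big_ind: _ => [|z t|k _]; [|exact: QD|].
    by rewrite -(rmorph0 (dsub_incl sBE)); apply: QC.
  apply: (QM); first exact: Qy.
  rewrite mxE (_ : ic _ = dsub_incl sBE (Dsub (constants_base (valP (c k 0))))).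
    exact: QC.
  exact: val_inj.
- by exists (z + t); [rewrite rmorphD|apply: QD].
- exists (- z); first by rewrite rmorphN.
  rewrite -mulN1r; apply: (QM) => //.
  have -> : -1 = dsub_incl sBE (-1) by rewrite rmorphN1.
  exact: QC.
- by exists (z * t); [rewrite rmorphM|apply: QM].
- move=> z0; exists z^-1; first by rewrite fmorphV.
  by apply: QV => //; apply: contraNneq z0 => ->.
by exists (der z) => //; apply: Qder.
Qed.

Section Intermediate.
Variables (K0 K : diffSubfield F).
Hypotheses (sB0 : {subset B <= K0}) (s0K : {subset K0 <= K}) (sKE : {subset K <= E}).

Local Notation ik := (dsub_incl sKE).
Let sBK : {subset B <= K}. Proof. by move=> x /sB0/s0K. Qed.
Let A := map_mx (dsub_incl sBK) companion.

Lemma dsub_incl_comp x : ik (dsub_incl sBK x) = dsub_incl sBE x.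
Proof. exact: val_inj. Qed.

Lemma der_wronskianK : map_mx der Y = map_mx ik A *m Y.
Proof.
rewrite der_wronskian // /A -map_mx_comp; congr (_ *m _).
by apply/matrixP => i j; rewrite !mxE /= dsub_incl_comp.
Qed.

Lemma wronskian_fractionsK x : exists a b,
  peval ik Y b != 0 /\ x = peval ik Y a / peval ik Y b.
Proof.
have mapE a : peval ik Y (map_mpoly (dsub_incl sBK) a) = peval (dsub_incl sBE) Y a.
  apply: (@peval_ext _ _ _ (peval ik Y \o map_mpoly (dsub_incl sBK)) (peval (dsub_incl sBE) Y))
    => [c|i j] /=.
    by rewrite map_mpolyC !pevalC /= dsub_incl_comp.
  transitivity (peval ik Y (generic_mx (dsub K) n i j)); last by rewrite !pevalX.
  by congr peval; rewrite !mxE map_mpolyX.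
have [a [b [b0 xE]]] := wronskian_fractions x.
exists (map_mpoly (dsub_incl sBK) a), (map_mpoly (dsub_incl sBK) b).
split; first by rewrite (mapE b).
by rewrite xE; congr (_ / _); apply: esym; apply: mapE.
Qed.

Variable tau : 'DGal(K / K0).

Lemma tau_base (x : dsub B) : gal_fun tau (dsub_incl sBK x) = dsub_incl sBK x.
Proof. by apply: gal_fix; apply: sB0; apply: dsub_valP. Qed.

Lemma der_wronskian_tau :
  map_mx der Y = map_mx (ik \o gal_act tau) A *m Y.
Proof.
rewrite der_wronskianK; congr (_ *m _); rewrite /A -!map_mx_comp.
by apply/matrixP => i j; rewrite !mxE /= tau_base.
Qed.

(** The hypotheses of the abstract extension lemma hold in a Picard-Vessiot
    extension, since all constants are in B and E is generated by Y. *)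
Lemma galois_of_specialisation M : specialises ic ik (ik \o gal_act tau) Y M ->
  exists2 s : 'DGal(E / K0), forall x, gal_fun s (ik x) = ik (gal_fun tau x) &
    map_mx (gal_fun s) Y = Y *m map_mx ic M.
Proof.
move=> spM.
have tauK' : cancel (gal_act (tau^-1)%g) (gal_act tau) by exact: gal_invK.
have tau_der a : der (gal_act tau a) = gal_act tau (der a) by rewrite /= gal_der.
have tau_const c : exists2 k, ik k = ic c & gal_act tau k = k.
  exists (dsub_incl sBK (Dsub (constants_base (valP c)))); first exact: val_inj.
  exact: tau_base.
have [s [s' [[sK sK' sZ sM] sder sk sY]]] := specialisation_automorphism
  (@const_incl_der _ E) (dsub_incl_der sKE) tauK' tau_der tau_const
  der_wronskianK der_wronskian_tau wronskian_fractionsK spM.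
have sfix x : val x \in K0 -> s x = x.
  move=> x0; have -> : x = ik (Dsub (s0K x0)) by exact: val_inj.
  by rewrite sk /= gal_fix.
by exists (DiffGal sK sK' sZ sM sder sfix).
Qed.

Lemma galois_extension : exists s : 'DGal(E / K0),
  forall x, gal_fun s (ik x) = ik (gal_fun tau x).
Proof.
have der_tau a : der ((ik \o gal_act tau) a) = (ik \o gal_act tau) (der a).
  by rewrite /= dsub_incl_der gal_der.
have [M spM] := specialisation_exists (@const_inclP _ E) (@const_incl_der _ E)
  closedC (dsub_incl_der sKE) der_tau fundamental_unit der_wronskianK der_wronskian_tau.
by have [s sk _] := galois_of_specialisation spM; exists s.
Qed.

End Intermediate.

End FundamentalMatrix.

End PicardVessiot.

(** ** Galois groups over intermediate fields *)

Lemma subgroupP (gT : groupType) (H : set gT) : subgroup H ->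
  [/\ H 1%g, forall g h, H g -> H h -> H (g * h)%g & forall g, H g -> H g^-1%g].
Proof.
move=> sH; have HM := group_closedM sH; have HV := group_closedV sH.
have [H1 _] := sH; split=> [|g h Hg Hh|g Hg].
- by move: H1; rewrite !inE.
- by have := HM g h; rewrite !inE; apply.
by have := HV g; rewrite !inE; apply.
Qed.

Lemma der_exp (E : diffFieldType) (x : E) k : der (x ^+ k.+1) = k.+1%:R * x ^+ k * der x.
Proof.
elim: k => [|k ih]; first by rewrite !expr1 expr0 !mul1r.
by rewrite exprS derM ih -[k.+2%:R]/(1 *+ k.+2) mulrS exprS; ring.
Qed.

(** In characteristic p the p-th powers are constants; as the constants are
    perfect, there are no other elements. *)
Lemma constant_of_pchar (E : diffFieldType) (C : fieldType) (ic : {rmorphism C -> E}) p :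
  (forall x : E, der x = 0 -> exists c, x = ic c) ->
  GRing.closed_field_axiom C -> p \in [pchar E] -> forall x, exists c, x = ic c.
Proof.
move=> icP closedC pE x; have p_pr := pcharf_prime pE; have p0 := prime_gt0 p_pr.
have [c xc] : exists c, x ^+ p = ic c.
  by apply: icP; rewrite -(prednK p0) der_exp prednK // (pcharf0 pE) !mul0r.
have [w wE] := closedC p (fun i => if i == 0%N then c else 0) p0.
have {}wE : w ^+ p = c.
  rewrite wE -(prednK p0) big_ord_recl /= mulr1 big1 ?addr0 // => i _.
  by rewrite mul0r.
exists w; apply/eqP; rewrite -subr_eq0.
have : (x - ic w) ^+ p == 0.
  have := pFrobenius_autB_comm pE (mulrC x (ic w)); rewrite !pFrobenius_autE => ->.
  by rewrite xc -rmorphXn wE subrr.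
by rewrite expf_eq0 => /andP[].
Qed.

Lemma gal_solution (F : diffFieldType) (K E : diffSubfield F) (L : {poly F})
    (s : 'DGal(E / K)) x :
  {subset K <= E} -> L \is a polyOver K -> diffop L (val x) = 0 ->
  diffop L (val (gal_fun s x)) = 0.
Proof.
move=> sKE /polyOverP LK; pose l i := dsub_incl sKE (Dsub (LK i)).
have LE (z : dsub E) : diffop L (val z) = val (\sum_(i < size L) l i * iter i der z).
  by rewrite raddf_sum; apply: eq_bigr => i _; rewrite -iter_der_val.
rewrite !LE -[X in _ = X -> _]/(\val (0 : dsub E)) => /val_inj/(congr1 (gal_fun s)).
rewrite rmorph0 rmorph_sum /= => e; rewrite -[RHS]/(\val (0 : dsub E)) -[in RHS]e.
congr dsub_val; apply: eq_bigr => i _.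
rewrite rmorphM /= [X in _ = X * _]gal_fix ?LK //; congr (_ * _).
by elim: (nat_of_ord i) => //= k ->; rewrite gal_der.
Qed.

Section Correspondence.
Variables (F : diffFieldType) (B E : diffSubfield F) (L : {poly F}).
Hypothesis closedC : GRing.closed_field_axiom (dsub (constants E)).
Hypothesis pvL : picard_vessiot B E L.

Local Notation n := (diff_order L).
Local Notation ic := (const_incl E).
Let sBE : {subset B <= E} := pv_sub pvL.

Lemma gal_peval (K K0 : diffSubfield F) (sKE : {subset K <= E}) (s : 'DGal(E / K0)) X a :
  (forall x, gal_fun s (dsub_incl sKE x) = dsub_incl sKE x) ->
  gal_fun s (@peval _ n _ (dsub_incl sKE) X a) =
    peval (dsub_incl sKE) (map_mx (gal_fun s) X) a.
Proof.
move=> sK; rewrite (peval_comp (dsub_incl sKE) (gal_act s)).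
apply: (@peval_ext _ _ _ (peval (gal_act s \o dsub_incl sKE) _) (peval (dsub_incl sKE) _))
  => [c|i j] /=; first by rewrite !pevalC /= sK.
by rewrite !pevalX.
Qed.

(** The specialisations of Y over K being the images of Y under automorphisms,
    they fix z; the statement about specialisations needs characteristic 0, but
    E = C otherwise. *)
Lemma fixed_by_galois (K : diffSubfield F) (z : dsub E) :
  {subset B <= K} -> {subset K <= E} ->
  (forall s : 'DGal(E / K), gal_fun s z = z) -> val z \in K.
Proof.
move=> sBK sKE fixz.
have constK c : val (ic c) \in K by apply/sBK/(constants_base pvL)/dsub_valP.
have [char0|] := pselect (forall k, (0 < k)%N -> k%:R != 0 :> dsub E); last first.
  move=> /existsNP[k /not_implyP[k0 /negP/negPn/(natf0_pchar k0)[p pE]]].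
  by have [c ->] := constant_of_pchar (@const_inclP _ E) closedC pE z.
have [y fundy _] := pv_generated pvL.
have [a [b [b0 zE]]] := wronskian_fractionsK pvL fundy sBK (fun x h => h) sKE z.
have [k ->] : exists k, z = dsub_incl sKE k; last exact: dsub_valP.
apply: (fixed_by_specialisations (@const_inclP _ E) (@const_incl_der _ E) closedC
  (dsub_incl_der sKE) (fundamental_unit fundy)
  (der_wronskianK pvL fundy sBK (fun x h => h) sKE) char0 b0) => [|M spM].
  by rewrite zE divfK.
have [s sk sY] := @galois_of_specialisation _ _ _ _ pvL _ fundy K K sBK (fun x h => h)
  sKE 1%g M spM.
rewrite -sY -!(gal_peval _ _ sk) -{1}(fixz s) -rmorphM; congr gal_fun.
by rewrite zE divfK.
Qed.

Section FundamentalAction.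
Variable y : 'rV[dsub E]_n.
Hypothesis fundy : fundamental_system y.

Local Notation Y := (wronskian y).

Lemma gal_fundamental (s : 'DGal(E / B)) : exists A, map_mx (gal_fun s) y = y *m map_mx ic A.
Proof.
have [soly _] := fundy; apply: rspan_matrix => j; rewrite mxE.
apply: (solution_span (pv_gt0 pvL) (fundamental_independent fundy)).
  by move=> k; case: (soly k).
have [_ sol0] := soly j.
by apply: gal_solution => //; case: (pv_equation pvL).
Qed.

Lemma gal_wronskian (s : 'DGal(E / B)) A :
  (map_mx (gal_fun s) Y = Y *m map_mx ic A) <-> (map_mx (gal_fun s) y = y *m map_mx ic A).
Proof.
split=> [YA|]; last first.
  exact: (wronskian_act (@const_incl_der _ E) (act := @gal_act F E B) (@gal_der F E B)).
apply/rowP => j; have /matrixP/(_ (Ordinal (pv_gt0 pvL)) j) := YA.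
rewrite !mxE /= => ->; apply: eq_bigr => k _; by rewrite !mxE.
Qed.

Lemma gal_matrixP (s : 'DGal(E / B)) A :
  gal_matrix y s A <-> map_mx (gal_fun s) y = y *m map_mx ic A.
Proof.
have valE j : val ((y *m map_mx ic A) 0 j) = \sum_i val (y 0 i) * val (A i j).
  by rewrite mxE raddf_sum; apply: eq_bigr => i _; rewrite mxE.
split=> [sA|sA j].
  by apply/rowP => j; apply: val_inj; rewrite mxE sA -valE.
by rewrite -valE -sA mxE.
Qed.

Lemma gal_eq_wronskian (s t : 'DGal(E / B)) :
  map_mx (gal_fun s) Y = map_mx (gal_fun t) Y -> s = t.
Proof.
move=> st; apply: diff_gal_inj => x.
have fixB (r : 'DGal(E / B)) (c : dsub B) : gal_fun r (dsub_incl sBE c) = dsub_incl sBE c.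
  by apply: gal_fix; apply: dsub_valP.
have [a [b [b0 ->]]] := wronskian_fractions pvL fundy x.
rewrite !fmorph_div /= !gal_peval; [|exact: fixB|exact: fixB|exact: fixB|exact: fixB].
by rewrite st.
Qed.

(** The entries of Y are derivatives of solutions, and the solutions form a
    stable space of finite dimension. *)
Lemma orbit_finite_fractions (z : dsub E) : exists a b,
  [/\ orbit_finite ic (@gal_act F E B) a, orbit_finite ic (@gal_act F E B) b,
      b != 0 & z = a / b].
Proof.
have [a [b [b0 zE]]] := wronskian_fractions pvL fundy z.
have fin p : orbit_finite ic (@gal_act F E B) (peval (dsub_incl sBE) Y p).
  move: p; apply: mpoly_closed => [c|k|p q fp fq|p q fp fq].
  - rewrite pevalC; apply: orbit_finite_fixed => g.
    by apply: gal_fix; apply: dsub_valP.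
  - have [i [j ->]] := generic_var (dsub B) k; rewrite pevalX mxE.
    elim: (nat_of_ord i) => [|m ih] /=; last first.
      by apply: orbit_finite_der; [exact: const_incl_der|exact: gal_der|].
    exists [seq y 0 l | l <- enum 'I_n] => g.
    have [A /rowP/(_ j)] := gal_fundamental g; rewrite !mxE /gal_act /= => ->.
    have sp := cspan_csubspace ic [seq y 0 l | l <- enum 'I_n].
    apply: (csubspace_sum _ sp) => l; rewrite mxE mulrC; apply: (csubspaceZ sp).
    by apply: cspan_mem; apply: map_f; rewrite mem_enum.
  - by rewrite pevalD; apply: orbit_finiteD.
  by rewrite pevalM; apply: orbit_finiteM.
by exists (peval (dsub_incl sBE) Y a), (peval (dsub_incl sBE) Y b).
Qed.

End FundamentalAction.

(** An automorphism is determined by its matrix, so that it belongs to H as soon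
    as this matrix satisfies the equations of H. *)
Lemma closed_fixer (H : set 'DGal(E / B)) : subgroup H -> gal_zariski_closed L H ->
  exists2 xs : seq (dsub E), forall x h, x \in xs -> H h -> gal_fun h x = x &
    forall g, (forall x, x \in xs -> gal_fun g x = x) -> H g.
Proof.
move=> /subgroupP[H1 HM HV] [y fundy [P HPE]].
have actY (g : 'DGal(E / B)) :
    exists A, map_mx (gal_act g) (wronskian y) = wronskian y *m map_mx ic A.
  by have [A gA] := gal_fundamental fundy g; exists A; apply/gal_wronskian.
have HP (g : 'DGal(E / B)) A : map_mx (gal_act g) (wronskian y) = wronskian y *m map_mx ic A ->
    (H g <-> forall p, P p -> peval idfun A p = 0).
  move=> gA; have uA : A \in unitmx.
    have : wronskian y *m map_mx ic A \in unitmx.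
      by rewrite -gA map_unitmx; apply: fundamental_unit.
    by rewrite unitmx_mul map_unitmx => /andP[].
  have HPA : (exists2 s, H s & gal_matrix y s A) <-> (A \in unitmx /\
      forall p, P p -> p.@[fun k => mxvec A 0 k] = 0).
    by move: (congr1 (@^~ A) HPE); rewrite /mkset /= => ->.
  split=> [Hg p Pp|PA].
    have gmA : gal_matrix y g A by apply/gal_matrixP; apply/gal_wronskian.
    by have [_ hA] := HPA.1 (ex_intro2 _ _ g Hg gmA); apply: hA.
  have [s Hs sA] := HPA.2 (conj uA PA).
  have {}sA : map_mx (gal_fun s) (wronskian y) = wronskian y *m map_mx ic A.
    by apply/gal_wronskian; apply/gal_matrixP.
  by rewrite (@gal_eq_wronskian _ fundy g s) // sA.
have [xs xsH xsg] := @closed_subgroup_fixer _ _ ic _ (@gal_act F E B)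
  (fun _ _ _ => erefl) _ _ (fundamental_unit fundy) actY H P H1 HM HV HP.
by exists xs.
Qed.

End Correspondence.

(** ** Normal subgroups and Picard-Vessiot subextensions *)

(** The length r of v is separate from the order of M, which saves casting v when
    that order is computed. *)
Lemma pv_intro (F : diffFieldType) (K0 K1 : diffSubfield F) (M : {poly F}) r
    (v : 'rV[dsub K1]_r) :
  {subset K0 <= K1} -> M \is a polyOver K0 -> diff_order M = r -> (0 < r)%N ->
  constants K1 =i constants K0 -> (forall j, diffop M (val (v 0 j)) = 0) ->
  (forall c : 'cV[dsub (constants K1)]_r,
     \sum_j val (c j 0) * val (v 0 j) = 0 -> c = 0) ->
  (forall x, x \in K1 -> diff_formula K0 [set val (v 0 j) | j in setT] x) ->
  picard_vessiot K0 K1 M.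
Proof.
move=> s01 MK e; move: v; rewrite -e => v r0 cst sol ind gen; split=> //.
exists v => //; split=> // j; split=> //; exact: dsub_valP.
Qed.

(** The monic operator annihilating a basis v of a stable space of functions has
    as coefficients the entries of - v^(r) W^-1, W the Wronskian matrix of v. *)
Lemma stable_space_equation (E : diffFieldType) (C : fieldType) (ic : {rmorphism C -> E})
    (icP : forall x : E, der x = 0 -> exists c, x = ic c)
    (ic_der : forall c, der (ic c) = 0) (gT : groupType)
    (act : gT -> {rmorphism E -> E})
    (act_der : forall g x, act g (der x) = der (act g x)) r (v : 'rV[E]_r) :
  independent ic v ->
  exists2 c : 'I_r -> E,
    forall j, \sum_(i < r) c i * iter i der (v 0 j) + iter r der (v 0 j) = 0 &
    forall g A, map_mx (act g) v = v *m map_mx ic A -> forall i, act g (c i) = c i.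
Proof.
move=> ind; have unitW := wronskian_unit icP ind; set W := wronskian v in unitW.
pose d := map_mx (iter r der) v; pose c := - d *m invmx W.
have cW : c *m W = - d by rewrite /c mulmxKV.
exists (fun i => c 0 i) => [j|g A gA i].
  have /rowP/(_ j) := cW; rewrite [LHS]mxE [RHS]mxE => /eqP.
  rewrite -addr_eq0 => /eqP; rewrite /d [map_mx _ _ _ _]mxE => e.
  rewrite -[RHS]e; congr (_ + _); apply: eq_bigr => i _; congr (_ * _).
  by rewrite /W [RHS]mxE.
have gW := wronskian_act ic_der act_der gA; have gd := iter_der_act ic_der act_der r gA.
have ugW : map_mx (act g) W \in unitmx by rewrite map_unitmx.
suff /rowP/(_ i) : map_mx (act g) c = c by rewrite [LHS]mxE.
apply: (can_inj (mulmxK ugW)); rewrite -map_mxM cW map_mxN gd gW mulmxA cW.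
by rewrite mulNmx.
Qed.

Section NormalSubgroup.
Variables (F : diffFieldType) (B E : diffSubfield F) (L : {poly F}).
Hypothesis closedC : GRing.closed_field_axiom (dsub (constants E)).
Hypothesis pvL : picard_vessiot B E L.

Local Notation ic := (const_incl E).
Let sBE : {subset B <= E} := pv_sub pvL.

Lemma fixfield_base (H : set 'DGal(E / B)) : {subset B <= fixfield H}.
Proof.
move=> x xB; apply/asboolP; exists (Dsub (sBE xB)); split=> // h _.
exact: gal_fix.
Qed.

Lemma fixfieldS (G H : set 'DGal(E / B)) : H `<=` G -> {subset fixfield G <= fixfield H}.
Proof.
move=> HG _ /asboolP[z [<- Gz]]; apply/fixfieldP => h Hh; exact/Gz/HG.
Qed.

Lemma constants_intermediate (K : diffSubfield F) :
  {subset B <= K} -> {subset K <= E} -> constants K =i constants E.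
Proof.
move=> sBK sKE x; apply/idP/idP; rewrite !inE => /andP[xK dx]; rewrite dx andbT.
  exact: sKE.
by apply: sBK; apply: (constants_base pvL); rewrite inE xK.
Qed.

(** Each of the finitely many elements x whose fixer is H lies in a field
    generated by a stable finite-dimensional space fixed by H; the sum of these
    spaces is the solution space of an equation over the fixed field of G, and
    the field it generates has the same fixer H as the whole fixed field. *)
Lemma normal_subextension (G H : set 'DGal(E / B)) :
  subgroup G -> normal_subgroup H G -> gal_zariski_closed L H ->
  exists M, picard_vessiot (fixfield G) (fixfield H) M.
Proof.
move=> /subgroupP[G1 GM GV] [sgH HG nHG] clH.
have [y fundy _] := pv_generated pvL.
have [xs xsH xsg] := closed_fixer pvL sgH clH.
have fixT x : x \in xs -> exists T : set (dsub E), [/\ exists s, T `<=` cspan ic s,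
    forall g z, G g -> T z -> T (gal_fun g z),
    forall h z, H h -> T z -> gal_fun h z = z &
    forall s : {rmorphism dsub E -> dsub E}, (forall c, s (ic c) = ic c) ->
      (forall z, T z -> s z = z) -> s x = x].
  move=> xx; have [a [b [fa fb b0 xE]]] := orbit_finite_fractions pvL fundy x.
  have const (g : 'DGal(E / B)) c : gal_act g (ic c) = ic c.
    by apply: gal_fix; apply: (constants_base pvL); apply: dsub_valP.
  have [u [v [fu fv v0 uE Hv]]] := ratio_of_semi_invariants (@const_inclP _ E)
    (@const_incl_der _ E) (act := @gal_act F E B) (fun=> erefl) (fun _ _ _ => erefl)
    (@gal_der F E B) const (fun h => xsH x h xx) fa fb b0 xE.
  have Huv h : H h -> exists c, gal_act h v = ic c * v /\ gal_act h u = ic c * u.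
    move=> Hh; have [c hv] := Hv h Hh; exists c; split=> //.
    by rewrite uE rmorphM hv /= (xsH x h xx Hh) mulrCA.
  have [T [Ts TG TH Tuv]] := normal_invariants (@const_inclP _ E)
    (@const_incl_der _ E) (act := @gal_act F E B) (fun=> erefl) (fun _ _ _ => erefl)
    (@gal_der F E B) const GV nHG GM G1 fu fv v0 Huv.
  exists T; split=> // s sc sT; have := Tuv s sc sT.
  by rewrite uE mulfK.
have [T [s [Ts TG TH Tfix]]] : exists (T : set (dsub E)) s, [/\ T `<=` cspan ic s,
    forall g z, G g -> T z -> T (gal_fun g z),
    forall h z, H h -> T z -> gal_fun h z = z &
    forall s : {rmorphism dsub E -> dsub E}, (forall c, s (ic c) = ic c) ->
      (forall z, T z -> s z = z) -> forall x, x \in xs -> s x = x].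
  elim: xs fixT {xsH xsg} => [|x xs ih] fixT.
    by exists set0, [::]; split.
  have [|T [s [Ts TG TH Tfix]]] := ih.
    by move=> z zx; apply: fixT; rewrite inE zx orbT.
  have [|U [[t Ut] UG UH Ufix]] := fixT x; first by rewrite inE eqxx.
  exists (U `|` T), (t ++ s); split.
  - move=> z [/Ut|/Ts]; first by apply: cspanS => w; rewrite mem_cat => ->.
    by apply: cspanS => w; rewrite mem_cat orbC => ->.
  - by move=> g z Gg [?|?]; [left; apply: UG|right; apply: TG].
  - by move=> h z Hh [?|?]; [apply: UH|apply: TH].
  move=> si sc sU z; rewrite inE => /predU1P[->|]; last first.
    by apply: Tfix => // w Tw; apply: sU; right.
  by apply: Ufix => // w Uw; apply: sU; left.
(* 1 is added to ensure that the equation has positive order. *)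
pose T1 := [set 1] `|` T.
have T1s : T1 `<=` cspan ic (1 :: s).
  move=> z [->|/Ts]; first by apply: cspan_mem; rewrite inE eqxx.
  by apply: cspanS => w; rewrite inE orbC => ->.
have T1G g z : G g -> T1 z -> T1 (gal_fun g z).
  by move=> Gg [->|Tz]; [left; rewrite rmorph1|right; apply: TG].
have T1H h z : H h -> T1 z -> gal_fun h z = z.
  by move=> Hh [->|Tz]; [rewrite rmorph1|apply: TH].
have [r [v [ind vT Tv]]] := basis_exists T1s.
have r0 : (0 < r)%N.
  rewrite lt0n; apply/eqP => r0; have [c /eqP] := Tv 1 (or_introl erefl).
  rewrite mxE big1 ?oner_eq0 // => i _; exfalso.
  by case: i => k; rewrite r0.
have [c cv cG] := stable_space_equation (@const_inclP _ E) (@const_incl_der _ E)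
  (act := @gal_act F E B) (@gal_der F E B) ind.
have cfix i : val (c i) \in fixfield G.
  apply/fixfieldP => g Gg.
  have [|A gA] := @rspan_matrix _ _ ic _ _ v (map_mx (gal_fun g) v).
    by move=> j; rewrite mxE; apply: Tv; apply: T1G.
  exact: cG gA i.
pose m k := if insub k is Some i then val (c i) else 1.
have m1 : m r = 1 by rewrite /m insubF ?ltnn.
have mc (i : 'I_r) : m i = val (c i) by rewrite /m valK.
pose M := \poly_(i < r.+1) m i.
have szM : size M = r.+1 by rewrite size_poly_eq // m1 oner_eq0.
have oM : diff_order M = r by rewrite /diff_order szM.
have solM j : diffop M (val (v 0 j)) = 0.
  have /(congr1 val) := cv j; rewrite rmorphD rmorph_sum rmorph0 /= => e.
  rewrite diffopE oM // addn1 big_ord_recr /= coef_poly ltnSn m1 mul1r -[RHS]e.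
  rewrite -iter_der_val; congr (_ + _); apply: eq_bigr => i _.
  by rewrite coef_poly ltnS ltnW // mc -iter_der_val.
have vH j : val (v 0 j) \in fixfield H by apply/fixfieldP => h Hh; apply: T1H.
pose v1 : 'rV[dsub (fixfield H)]_r := \row_j Dsub (vH j).
have v1E j : val (v1 0 j) = val (v 0 j) by rewrite mxE.
have sBG := @fixfield_base G; have sGH := fixfieldS HG.
have sHE : {subset fixfield H <= E} := @fixfield_sub _ _ _ H.
have sGE : {subset fixfield G <= E} := @fixfield_sub _ _ _ G.
exists M; apply: (@pv_intro _ _ _ M r v1) => //.
- apply/polyOverP => k; rewrite coef_poly; case: ifP => [kr|_]; last exact: rpred0.
  by rewrite /m; case: insubP => [i _ _|_]; [exact: cfix|exact: rpred1].
- move=> x; rewrite (constants_intermediate (fixfield_base H) sHE).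
  by rewrite (constants_intermediate sBG sGE).
- by move=> j; rewrite v1E.
- move=> d dv; have dE j : val (d j 0) \in constants E.
    by rewrite -(constants_intermediate (fixfield_base H) sHE); apply: dsub_valP.
  pose d' : 'cV[dsub (constants E)]_r := \col_j Dsub (dE j).
  have /ind d0 : v *m map_mx ic d' = 0.
    apply/matrixP => i j; rewrite !ord1 [RHS]mxE mxE; apply: val_inj.
    rewrite raddf_sum -[RHS]dv; apply: eq_bigr => k _.
    by rewrite !mxE /= mulrC -v1E.
  apply/matrixP => j i; rewrite ord1 [RHS]mxE; apply: val_inj.
  by have /matrixP/(_ j 0)/(congr1 val) := d0; rewrite !mxE.
move=> x xH; set U := [set val (v1 0 j) | j in setT].
have sGU := @genfield_base _ (fixfield G) U.
have sBU : {subset B <= genfield (fixfield G) U} by move=> w /sBG/sGU.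
have UH w : U w -> w \in fixfield H by move=> [j _ <-]; apply: dsub_valP.
have sUE : {subset genfield (fixfield G) U <= E}.
  by apply: genfield_min => // w /UH/sHE.
apply/asboolP; rewrite -[`[< _ >]]/(x \in genfield (fixfield G) U).
have [z zx] : exists z : dsub E, val z = x by exists (Dsub (sHE _ xH)).
rewrite -zx; apply: (fixed_by_galois closedC pvL sBU sUE) => t.
rewrite -zx in xH; apply: ((fixfieldP H z).1 xH (gal_lower sBU t)).
have tc e : gal_fun t (ic e) = ic e.
  by apply: gal_fix; apply: sBU; apply: (constants_base pvL); apply: dsub_valP.
apply: xsg => w wx; apply: (Tfix (gal_act (gal_lower sBU t)) tc) => // q Tq.
have [e ->] := Tv q (or_intror Tq).
rewrite mxE /gal_act rmorph_sum /=; apply: eq_bigr => k _.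
rewrite rmorphM [map_mx _ _ _ _]mxE /=; congr (_ * _); last exact: tc.
by apply: (gal_fix t); rewrite -v1E; apply: genfield_gen; exists k.
Qed.

End NormalSubgroup.

(** ** Fixers of intermediate fields *)

Section Subextensions.
Variables (F : diffFieldType) (B E : diffSubfield F) (L : {poly F}).
Hypothesis closedC : GRing.closed_field_axiom (dsub (constants E)).
Hypothesis pvL : picard_vessiot B E L.

Local Notation ic := (const_incl E).

Definition fixer (K : diffSubfield F) : set 'DGal(E / B) :=
  [set s | forall z : dsub E, val z \in K -> gal_fun s z = z].

Lemma fixer_lower (K : diffSubfield F) (sBK : {subset B <= K}) (s : 'DGal(E / K)) :
  fixer K (gal_lower sBK s).
Proof. by move=> z zK; apply: (gal_fix s). Qed.

Lemma fixer_subgroup K : subgroup (fixer K).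
Proof.
split=> [|s t]; rewrite !inE; first by move=> z.
move=> sK tK z zK; have tz : gal_inv t z = z by rewrite -{1}(tK z zK) gal_funK.
by rewrite -[LHS]/(gal_fun s (gal_inv t z)) tz sK.
Qed.

Lemma fixfield_fixer (K : diffSubfield F) :
  {subset B <= K} -> {subset K <= E} -> fixfield (fixer K) =i K.
Proof.
move=> sBK sKE x; apply/idP/idP => [/asboolP[z [<- zfix]]|xK].
  apply: (fixed_by_galois closedC pvL sBK sKE) => s.
  exact: zfix (fixer_lower sBK s).
by apply/asboolP; exists (Dsub (sKE _ xK)); split=> // h; apply.
Qed.

(** The fixer of K consists of the matrices that specialise the relations of a
    fundamental matrix over K, which are the zeros of polynomials over C. *)
Lemma fixer_closed (K : diffSubfield F) : {subset B <= K} -> {subset K <= E} ->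
  gal_zariski_closed L (fixer K).
Proof.
move=> sBK sKE; have [y fundy _] := pv_generated pvL.
pose ik := dsub_incl sKE; have sKK : {subset K <= K} by [].
have der_K := der_wronskianK pvL fundy sBK sKK sKE.
exists y => //; exists [set p | relspan ik ik (wronskian y) (map_mpoly ic p)].
apply/seteqP; split=> [A [s sK /gal_matrixP/(gal_wronskian pvL) sA]|A [uA PA]].
  have uA : A \in unitmx.
    have : wronskian y *m map_mx ic A \in unitmx.
      by rewrite -sA (map_unitmx (gal_act s)); apply: fundamental_unit.
    by rewrite unitmx_mul map_unitmx => /andP[].
  have [spA _] := specialisesP (@const_inclP _ E)
    (dsub_incl_der sKE) (dsub_incl_der sKE) der_K der_K uA.
  split=> // p Pp; apply: (spA _ p Pp); split=> // f.
  rewrite /relation -sA -gal_peval => [->|x]; first exact: rmorph0.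
  by apply: sK; apply: dsub_valP.
have [_ /(_ PA) spA] := specialisesP (@const_inclP _ E)
  (dsub_incl_der sKE) (dsub_incl_der sKE) der_K der_K uA.
have [s sk sY] := @galois_of_specialisation _ _ _ _ pvL _ fundy K K sBK sKK sKE 1%g A spA.
exists (gal_lower sBK s); first exact: fixer_lower.
by apply/gal_matrixP/(gal_wronskian pvL).
Qed.

(** A Picard-Vessiot subextension is stable under automorphisms: these permute
    the solutions of its equation, all of which are combinations of a
    fundamental system in it. *)
Lemma pv_stable (K0 K : diffSubfield F) (M : {poly F}) (s : 'DGal(E / B)) (z : dsub E) :
  {subset B <= K0} -> {subset K <= E} -> picard_vessiot K0 K M ->
  (forall x : dsub E, val x \in K0 -> gal_fun s x = x) ->
  val z \in K -> val (gal_fun s z) \in K.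
Proof.
move=> sB0 sKE pvK s0; have [v [solv indv] gen] := pv_generated pvK.
have [sK0 [MK M0] _ _] := pvK; have sBK : {subset B <= K} by move=> x /sB0/sK0.
have s0E : {subset K0 <= E} by move=> x /sK0/sKE.
pose w : 'rV[dsub E]_(diff_order M) := map_mx (dsub_incl sKE) v.
have solw j : diffop M (val (w 0 j)) = 0 by rewrite mxE; case: (solv j).
have indw : independent ic w.
  move=> c wc; have cE j : val (c j 0) \in constants K.
    by rewrite (constants_intermediate pvL sBK sKE); apply: dsub_valP.
  have d0 : (\col_j Dsub (cE j)) = 0 :> 'cV[dsub (constants K)]_(diff_order M).
    apply: indv; have /matrixP/(_ 0 0)/(congr1 val) := wc.
    rewrite [in RHS]mxE [in LHS]mxE raddf_sum => e; rewrite -[RHS]e.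
    by apply: eq_bigr => j _; rewrite !mxE /= mulrC.
  apply/matrixP => j i; rewrite ord1 [RHS]mxE; apply: val_inj.
  by have /matrixP/(_ j 0)/(congr1 val) := d0; rewrite !mxE.
have cK e : val (ic e) \in K by apply: sBK; apply: (constants_base pvL); apply: dsub_valP.
suff QE u : diff_formula K0 [set val (v 0 j) | j in setT] u ->
    exists2 t : dsub E, val t = u & val (gal_fun s t) \in K.
  by move=> /gen/QE[t /val_inj ->].
elim=> {u} [b b0|_ [j _ <-]|_ _ _ [t <- tK] _ [t' <- tK']|_ _ [t <- tK]
  |_ _ _ [t <- tK] _ [t' <- tK']|_ _ [t <- tK]|_ _ [t <- tK]].
- by exists (Dsub (s0E _ b0)) => //; rewrite s0 //; apply: sK0.
- exists (w 0 j); first by rewrite mxE.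
  have sol : diffop M (val (gal_fun s (w 0 j))) = 0.
    exact: (gal_solution (gal_raise s0) s0E MK (solw j)).
  have [c ->] := solution_span M0 indw solw sol.
  rewrite mxE raddf_sum; apply: rpred_sum => k _ /=.
  by apply: rpredM; rewrite mxE; [apply: dsub_valP|apply: cK].
- by exists (t + t'); [rewrite rmorphD|rewrite !rmorphD rpredD].
- by exists (- t); [rewrite rmorphN|rewrite !rmorphN rpredN].
- by exists (t * t'); [rewrite rmorphM|rewrite !rmorphM rpredM].
- by move=> _; exists t^-1; [rewrite fmorphV|rewrite !fmorphV rpredV].
exists (der t) => //; rewrite gal_der; exact: (der_closed _ tK).
Qed.

End Subextensions.

(** * The quotient of a Galois group by a normal subgroup *)

Section Restriction.
Variables (F : diffFieldType) (B E : diffSubfield F) (L : {poly F}).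
Hypothesis closedC : GRing.closed_field_axiom (dsub (constants E)).
Hypothesis pvL : picard_vessiot B E L.

(** Closedness of H is essential here: the fixer of a field is always closed. *)
Lemma fixer_fixfield (H : set 'DGal(E / B)) : subgroup H -> gal_zariski_closed L H ->
  fixer (fixfield H) = H.
Proof.
move=> sgH clH; have [xs xsH xsg] := closed_fixer pvL sgH clH.
apply/seteqP; split=> [g gfix|h Hh z]; last by move=> /fixfieldP; apply.
apply: xsg => x xx; apply: gfix; apply/fixfieldP => h; exact: xsH.
Qed.

Lemma restriction_exists (K0 K : diffSubfield F) (sKE : {subset K <= E})
    (g : 'DGal(E / B)) :
  (forall z : dsub E, val z \in K -> val (gal_fun g z) \in K) ->
  (forall z : dsub E, val z \in K -> val (gal_fun (g^-1)%g z) \in K) ->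
  (forall x : dsub K, val x \in K0 -> gal_fun g (dsub_incl sKE x) = dsub_incl sKE x) ->
  exists r : 'DGal(K / K0), forall x,
    dsub_incl sKE (gal_fun r x) = gal_fun g (dsub_incl sKE x).
Proof.
move=> gK gVK g0.
pose r (x : dsub K) : dsub K := Dsub (gK (dsub_incl sKE x) (valP x)).
pose r' (x : dsub K) : dsub K := Dsub (gVK (dsub_incl sKE x) (valP x)).
have rE x : dsub_incl sKE (r x) = gal_fun g (dsub_incl sKE x) by apply: val_inj.
have r'E x : dsub_incl sKE (r' x) = gal_inv g (dsub_incl sKE x) by apply: val_inj.
have inj : injective (dsub_incl sKE) by apply: fmorph_inj.
have rK : cancel r r' by move=> x; apply: inj; rewrite r'E rE gal_funK.
have r'K : cancel r' r by move=> x; apply: inj; rewrite rE r'E gal_invK.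
have rB : zmod_morphism r by move=> x y; apply: inj; rewrite rmorphB /= !rE !rmorphB.
have rM : GRing.monoid_morphism r.
  by split=> [|x y]; apply: inj; rewrite ?rmorph1 ?rmorphM /= !rE ?rmorph1 ?rmorphM.
have rd : {morph r : x / der x}.
  by move=> x; apply: inj; rewrite -dsub_incl_der !rE -dsub_incl_der gal_der.
have r0 (x : dsub K) : val x \in K0 -> r x = x.
  by move=> x0; apply: inj; rewrite rE g0.
by exists (DiffGal rK r'K rB rM rd r0).
Qed.

Lemma normal_stable (G H : set 'DGal(E / B)) (g : 'DGal(E / B)) (z : dsub E) :
  normal_subgroup H G -> G g -> val z \in fixfield H ->
  val (gal_fun g z) \in fixfield H.
Proof.
move=> [_ _ nHG] Gg /fixfieldP Hz; apply/fixfieldP => h Hh.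
have := Hz _ (nHG _ _ Gg Hh); rewrite -[gal_fun _ z]/(gal_inv g (gal_fun h (gal_fun g z))).
by move=> /(congr1 (gal_fun g)); rewrite gal_invK.
Qed.

(** Restriction to the fixed field of H is defined on G as H is normal; its
    kernel is H because H is closed, and it is onto because automorphisms of an
    intermediate field extend and G is closed. *)
Lemma galois_quotient (G H : set 'DGal(E / B)) :
  subgroup G -> gal_zariski_closed L G ->
  normal_subgroup H G -> gal_zariski_closed L H ->
  quotient_isog G H 'DGal(fixfield H / fixfield G).
Proof.
move=> sgG clG nHG clH; have [sgH HG conjH] := nHG.
have [G1 GM GV] := subgroupP sgG; have [H1 HM HV] := subgroupP sgH.
have sKE := @fixfield_sub _ _ _ H; have s0K := @fixfieldS _ _ _ _ _ HG.
have sB0 := @fixfield_base _ _ _ _ pvL G; have [y fundy _] := pv_generated pvL.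
pose restr (g : 'DGal(E / B)) (r : 'DGal(fixfield H / fixfield G)) :=
  forall x, dsub_incl sKE (gal_fun r x) = gal_fun g (dsub_incl sKE x).
have restrG g : G g -> exists r, restr g r.
  move=> Gg; apply: restriction_exists => [z|z|x].
  - exact: normal_stable nHG Gg.
  - exact: normal_stable nHG (GV _ Gg).
  by move=> x0; apply: (fixfieldP G (dsub_incl sKE x)).1.
have restr_inj g r r' : restr g r -> restr g r' -> r = r'.
  move=> gr gr'; apply: diff_gal_inj => x.
  by apply: (fmorph_inj (dsub_incl sKE)); apply: etrans (gr x) (esym (gr' x)).
have restrM g g' r r' : restr g r -> restr g' r' -> restr (g * g')%g (r * r')%g.
  by move=> gr gr' x; rewrite -[RHS]/(gal_fun g (gal_fun g' _)) -gr' -gr.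
have restrH g h r : H h -> restr (g * h)%g r -> restr g r.
  move=> Hh ghr x; rewrite ghr -[LHS]/(gal_fun g (gal_fun h _)).
  by rewrite ((fixfieldP H (dsub_incl sKE x)).1 (dsub_valP x)).
pose coset (g : 'DGal(E / B)) : set 'DGal(E / B) := [set (g * h)%g | h in H].
pose f (A : set 'DGal(E / B)) := xget 1%g [set r | exists2 g, A g & restr g r].
have fE g r : restr g r -> f (coset g) = r.
  move=> gr; apply: xget_unique => [|r' [_ [h Hh <-] ghr]].
    by exists g => //; exists 1%g => //; rewrite mulg1.
  exact: restr_inj (restrH _ _ _ Hh ghr) gr.
exists f; split; first split.
- by [].
- move=> _ _ /[!inE] -[g Gg <-] [g' Gg' <-]; rewrite -!/(coset _).
  have [r gr] := restrG g Gg; have [r' gr'] := restrG g' Gg'.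
  rewrite (fE _ _ gr) (fE _ _ gr') => rr'.
  have Hgg : H (g^-1 * g')%g.
    rewrite -(fixer_fixfield sgH clH) => z zK.
    have := gr' (Dsub zK); rewrite -rr' gr.
    have -> : dsub_incl sKE (Dsub zK) = z by apply: val_inj.
    by rewrite -[gal_fun (_ * _)%g z]/(gal_inv g (gal_fun g' z)) => <-; rewrite gal_funK.
  apply/seteqP; split=> _ [h Hh <-].
    exists ((g^-1 * g')^-1 * h)%g; first by apply: (HM) => //; apply: (HV).
    by rewrite invgM invgK !mulgA mulgV mul1g.
  exists (g^-1 * g' * h)%g; first exact: (HM).
  by rewrite !mulgA mulgV mul1g.
- move=> r _; have [s sr] := galois_extension closedC pvL fundy sB0 s0K sKE r.
  pose g := gal_lower sB0 s; have Gg : G g.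
    by rewrite -(fixer_fixfield sgG clG); apply: fixer_lower.
  exists (coset g); first by exists g.
  by apply: fE => x; rewrite -sr.
move=> _ _ [g Gg <-] [g' Gg' <-]; rewrite -!/(coset _).
have -> : mulset (coset g) (coset g') = coset (g * g')%g.
  apply/seteqP; split=> [_ [_ [h Hh <-] [_ [h' Hh' <-] <-]]|_ [h Hh <-]].
    exists (h ^ g' * h')%g; first by apply: (HM) => //; apply: (conjH).
    by rewrite mulgA -(mulgA g) -conjgC !mulgA.
  exists g; first by exists 1%g => //; rewrite mulg1.
  by exists (g' * h)%g; [exists h|rewrite mulgA].
have [r gr] := restrG g Gg; have [r' gr'] := restrG g' Gg'.
by rewrite (fE _ _ gr) (fE _ _ gr'); apply/fE/restrM.
Qed.

End Restriction.

(** * Series of closed subgroups *)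

Section Series.
Variables (F : diffFieldType) (B E : diffSubfield F) (L : {poly F}).
Variables (m : nat) (G : nat -> set 'DGal(E / B)).
Hypothesis closedC : GRing.closed_field_axiom (dsub (constants E)).
Hypothesis pvL : picard_vessiot B E L.
Hypothesis seriesG : normal_zclosed_series L m G.

Lemma series_subgroup i : (i <= m)%N -> subgroup (G i).
Proof.
case: i => [_|i im]; last by have [] := nzs_normal seriesG im.
by rewrite (nzs_first seriesG); split=> [|x y _ _]; apply: mem_set.
Qed.

Lemma series_decreasing i j : (i <= j <= m)%N -> G j `<=` G i.
Proof.
elim: j => [|j IH]; first by rewrite leqn0 => /andP[/eqP-> _] s.
move=> /andP[]; rewrite leq_eqVlt => /orP[/eqP-> _ s //|ij jm].
have [_ sub _] := nzs_normal seriesG jm.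
by move=> s /sub; apply: IH; rewrite -ltnS ij; apply: ltnW.
Qed.

Lemma fixfield_first : fixfield (G 0) =i B.
Proof.
move=> x; apply/idP/idP => [|xB]; last exact: fixfield_base pvL (G 0) _ xB.
rewrite (nzs_first seriesG) => /asboolP[z [<- fz]].
by apply: (fixed_by_galois closedC pvL _ (pv_sub pvL)) => // s; apply: fz.
Qed.

Lemma fixfield_last : fixfield (G m) =i E.
Proof.
move=> x; apply/idP/idP => [|xE]; first exact: fixfield_sub.
by apply/asboolP; exists (Dsub xE); split=> // h; rewrite (nzs_last seriesG) => ->.
Qed.

(** ** Refining a series by an intermediate Picard-Vessiot extension *)

Section Refinement.
Variables (i : nat) (K : diffSubfield F) (M : {poly F}).
Hypotheses (i_gt0 : (0 < i)%N) (im : (i <= m)%N).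
Hypotheses (sK1 : {subset K <= fixfield (G i)}).
Hypothesis pvK : picard_vessiot (fixfield (G i.-1)) K M.

Let im1 : (i.-1 <= m)%N. Proof. exact: leq_trans (leq_pred i) im. Qed.
Let i1 : i.-1.+1 = i. Proof. exact: prednK. Qed.
Let s0K : {subset fixfield (G i.-1) <= K} := pv_sub pvK.
Let sBK : {subset B <= K}.
Proof. by move=> x /(fixfield_base pvL (G i.-1))/s0K. Qed.
Let sKE : {subset K <= E}. Proof. by move=> x /sK1/fixfield_sub. Qed.

Lemma fixer_upper : fixer K `<=` G i.-1.
Proof.
rewrite -(fixer_fixfield pvL (series_subgroup im1) (nzs_closed seriesG im1)).
by move=> s sK z /s0K; apply: sK.
Qed.

Lemma fixer_above : G i `<=` fixer K.
Proof.
rewrite -(fixer_fixfield pvL (series_subgroup im) (nzs_closed seriesG im)).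
by move=> s si z /sK1; apply: si.
Qed.

Lemma fixer_normal : normal_subgroup (fixer K) (G i.-1).
Proof.
split=> [||g h Gg hK z zK]; [exact: fixer_subgroup|exact: fixer_upper|].
have gz : val (gal_fun g z) \in K.
  by apply: (pv_stable pvL (fixfield_base pvL (G i.-1)) sKE pvK _ zK) => x /fixfieldP; apply.
by rewrite -[LHS]/(gal_inv g (gal_fun h (gal_fun g z))) (hK _ gz) gal_funK.
Qed.

Lemma fixer_normal_above : normal_subgroup (G i) (fixer K).
Proof.
have := nzs_normal seriesG (_ : (i.-1 < m)%N); rewrite i1 => /(_ im)[sgi _ ni].
by split=> // [|g h gK]; [exact: fixer_above|apply/ni/fixer_upper].
Qed.

Definition refined (j : nat) : set 'DGal(E / B) :=
  if (j < i)%N then G j else if j == i then fixer K else G j.-1.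

Lemma refined_series : normal_zclosed_series L m.+1 refined.
Proof.
split=> // [|| |].
- by rewrite /refined i_gt0 (nzs_first seriesG).
- by rewrite /refined ltnNge (leqW im) gtn_eqF ?ltnS //= (nzs_last seriesG).
- move=> j jm; rewrite /refined; case: (ltngtP j.+1 i) => [ji|ij|ji].
  + by apply: (nzs_normal seriesG); apply: leq_trans im; apply: ltnW.
  + case: eqP => [->|/eqP ji]; first exact: fixer_normal_above.
    have lt : (i < j)%N by rewrite ltn_neqAle eq_sym ji -ltnS.
    have j_gt0 : (0 < j)%N by apply: leq_ltn_trans lt.
    have := nzs_normal seriesG (_ : (j.-1 < m)%N); rewrite (prednK j_gt0); exact.
  by move: fixer_normal; rewrite -ji.
move=> j jm; rewrite /refined; case: (ltngtP j i) => [ji|ij|_].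
- by apply: (nzs_closed seriesG); apply: leq_trans im; apply: ltnW.
- by apply: (nzs_closed seriesG); case: j jm {ij}.
exact: (fixer_closed pvL sBK sKE).
Qed.

Lemma refined_proper : ~ K =i fixfield (G i.-1) -> ~ K =i fixfield (G i) ->
  proper_refinement m G m.+1 refined.
Proof.
move=> nK0 nK1; split.
  exists (fun j => if (j < i)%N then j else j.+1); split=> [j k _ _ /= jk|j jm|j jm].
  - case: ifP => ji; case: ifP => // ki; first exact: leqW.
    by have := ltn_trans jk ki; rewrite ji.
  - by case: ifP => _; rewrite ?ltnS // leqW.
  rewrite /refined; case: (ltnP j i) => [->//|ij].
  by rewrite ltnNge leqW ?gtn_eqF //= ltnS.
exists i => [|k km]; first exact: leqW.
have -> : refined i = fixer K by rewrite /refined ltnn eqxx.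
move=> KG; have [ki|ik] := ltnP k i.
  apply: nK0 => x; rewrite -(fixfield_fixer closedC pvL sBK sKE).
  suff -> : fixer K = G i.-1 by [].
  apply/seteqP; split; first exact: fixer_upper.
  by rewrite KG; apply: series_decreasing; rewrite im1 andbT -ltnS i1.
apply: nK1 => x; rewrite -(fixfield_fixer closedC pvL sBK sKE).
suff -> : fixer K = G i by [].
apply/seteqP; split; last exact: fixer_above.
by rewrite KG; apply: series_decreasing; rewrite ik km.
Qed.

End Refinement.

(** An intermediate Picard-Vessiot extension would give, by its fixer, a normal
    closed subgroup strictly between two consecutive terms. *)
Lemma composition_irreducible i : composition_zclosed_series L m G -> (1 <= i <= m)%N ->
  pv_irreducible (fixfield (G i.-1)) (fixfield (G i)).
Proof.
move=> [_ comp] /andP[i_gt0 im] K _ nK0 sK1 nK1 [M pvK].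
exact: comp _ _ (refined_proper i_gt0 im sK1 pvK nK0 nK1) (refined_series i_gt0 im sK1 pvK).
Qed.

(** Each K_j is generated over K_(j-1) by solutions of M_j, so the field
    generated over B by all these solutions contains the K_j one after the
    other. *)
Lemma solutions_generate (M : nat -> {poly F}) i :
  (forall j, (1 <= j <= m)%N -> picard_vessiot (fixfield (G j.-1)) (fixfield (G j)) (M j)) ->
  (i <= m)%N ->
  {subset fixfield (G i) <=
    genfield B [set u | exists2 j, (1 <= j <= m)%N & solutions E (M j) u]}.
Proof.
move=> pvM; elim: i => [_ x|i IH im x].
  by rewrite fixfield_first; apply: genfield_base.
have [v [solv _] gen] := pv_generated (pvM i.+1 im) => /gen vx.
apply: (genfield_min (IH (ltnW im)) _ (asboolT vx)) => _ [j _ <-].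
apply: genfield_gen; exists i.+1 => //; have [vK v0] := solv j; split=> //.
exact: fixfield_sub vK.
Qed.

End Series.

Theorem corollary16p3p6 (F : diffFieldType) (B E : diffSubfield F)
    (L : {poly F}) (m : nat) (G : nat -> set 'DGal(E / B))
    (closedC : GRing.closed_field_axiom (dsub (constants E)))
    (pvL : picard_vessiot B E L)
    (seriesG : normal_zclosed_series L m G) :
  exists (K : nat -> diffSubfield F) (M : nat -> {poly F}),
    [/\ [/\ K 0%N =i B, K m =i E &
          forall i, (i <= m)%N -> {subset B <= K i} /\ {subset K i <= E}],
        forall i, (1 <= i <= m)%N ->
          quotient_isog (G i.-1) (G i) 'DGal(K i / K i.-1),
        forall i, (1 <= i <= m)%N -> picard_vessiot (K i.-1) (K i) (M i),
        forall y, solutions E L y ->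
          diff_formula B
            [set u | exists2 i, (1 <= i <= m)%N & solutions E (M i) u] y &
        composition_zclosed_series L m G ->
          forall i, (1 <= i <= m)%N -> pv_irreducible (K i.-1) (K i)].
Proof.
have steps i : (1 <= i <= m)%N ->
    [/\ subgroup (G i.-1), gal_zariski_closed L (G i.-1),
        normal_subgroup (G i) (G i.-1) & gal_zariski_closed L (G i)].
  case: i => // i im; split; [exact: series_subgroup seriesG _ (ltnW im)|
    exact: (nzs_closed seriesG (ltnW im))|exact: (nzs_normal seriesG im)|
    exact: (nzs_closed seriesG im)].
have /choice[M pvM] i : exists Mi, (1 <= i <= m)%N ->
    picard_vessiot (fixfield (G i.-1)) (fixfield (G i)) Mi.
  have [/steps[sg _ nm cl]|_] := boolP (1 <= i <= m)%N; last by exists 0.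
  by have [Mi pvMi] := normal_subextension closedC pvL sg nm cl; exists Mi.
exists (fun i => fixfield (G i) : diffSubfield F), M.
split=> [|i /steps[sg cl nm cl']||y [yE _]|comp i im] //.
- split=> [||i _]; [exact: (fixfield_first closedC pvL seriesG)|exact: (fixfield_last seriesG)|].
  by split; [exact: fixfield_base pvL (G i)|exact: fixfield_sub].
- exact: (galois_quotient closedC pvL).
- apply/asboolP; apply: (solutions_generate closedC pvL seriesG pvM (leqnn m)).
  by rewrite (fixfield_last seriesG).
exact: (composition_irreducible closedC pvL seriesG).
Qed.
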